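(* Let $n\ge1$, $K\ge2$, $m\ge1$, $\mu\in\mathbb{R}^n$, $\sigma^2>0$ and $\rho\in[-1/(K-1),1]$ be fixed. Let $Y\sim\mathcal{N}(\mu,\sigma^2I_n)$, and let $(\omega^1,\ldots,\omega^K)$ be random vectors in $\mathbb{R}^n$, jointly independent of $Y$, forming an exchangeable normal randomization with correlation $\rho$. Let \[ g(y)=f_0(y)+\sum_{\ell=1}^m a_\ell(y)\,\mathbf{1}\{h_\ell(y)>0\}, \] where $f_0,a_1,\ldots,a_m:\mathbb{R}^n\to\mathbb{R}^n$ each satisfy the smoothness-and-moment condition and $h_1,\ldots,h_m:\mathbb{R}^n\to\mathbb{R}$ are measurable, and assume $\mathbb{E}\left[\|f_0(Y)-Y\|_2^2\right]>0$. Then \[ \mathbb{E}\left[\operatorname{Var}\left(\widetilde{\mathrm{CV}}_\alpha\mid Y\right)\right]=O(1)\ \text{ as }\alpha\downarrow0\quad\text{if and only if}\quad \rho=-\frac{1}{K-1}. \]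
   Context: Cross-validation estimator: for $\alpha>0$, \[ \mathrm{CV}_\alpha=\frac1K\sum_{k=1}^K\left\{\left\|g(Y+\sqrt\alpha\,\omega^k)-\left(Y-\tfrac{1}{\sqrt\alpha}\omega^k\right)\right\|_2^2-\frac1\alpha\|\omega^k\|_2^2\right\}. \] Control variate and adjusted estimator: for $\ell=1,\ldots,m$ and $k=1,\ldots,K$, let \[ r_\ell(\omega^k,Y)=\mathbb{E}\left[\omega^k\mathbf{1}\{h_\ell(Y+\sqrt\alpha\,\omega^k)>0\}\,\middle|\,Y\right]-\omega^k\mathbf{1}\{h_\ell(Y+\sqrt\alpha\,\omega^k)>0\}, \] \[ \mathcal{V}_\alpha=\frac{2}{K\sqrt\alpha}\sum_{k=1}^K\sum_{\ell=1}^m\left\langle a_\ell(Y),r_\ell(\omega^k,Y)\right\rangle,\qquad \widetilde{\mathrm{CV}}_\alpha=\mathrm{CV}_\alpha+\mathcal{V}_\alpha. \] Exchangeable normal randomization with correlation $\rho$: (i) $(\omega^{\pi(1)},\ldots,\omega^{\pi(K)})$ has the same distribution as $(\omega^1,\ldots,\omega^K)$ for every permutation $\pi$ of $\{1,\ldots,K\}$; (ii) $\omega^k\sim\mathcal{N}(0,\sigma^2 I_n)$ for every $k$, and $\operatorname{Cov}(\omega^k,\omega^{k'})=\rho\sigma^2 I_n$ for every $k\ne k'$. Joint normality is not assumed. The joint law of $(\omega^1,\ldots,\omega^K)$ does not depend on $\alpha$. Smoothness-and-moment condition on a map $f:\mathbb{R}^n\to\mathbb{R}^n$: every component $f_i$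 is weakly differentiable, meaning that there is a function $\nabla f_i:\mathbb{R}^n\to\mathbb{R}^n$ with \[ f_i(y+z)-f_i(y)=\int_0^1 z\cdot\nabla f_i(y+tz)\,dt\quad\text{for almost all } y,z\in\mathbb{R}^n; \] $\nabla f$ denotes the $n\times n$ Jacobian matrix with $i$-th row $\nabla f_i$; and there exists $\alpha_0>0$ such that, for $Z_{\alpha_0}\sim\mathcal{N}(\mu,(1+\alpha_0)\sigma^2I_n)$, $\mathbb{E}\|f(Z_{\alpha_0})\|_2^4<\infty$ and $\mathbb{E}\|\nabla f(Z_{\alpha_0})\|_{\mathrm F}^2<\infty$ ($\|\cdot\|_{\mathrm F}$ the Frobenius norm). *)

(* Defs.v *)
From HB Require Import structures.
From mathcomp Require Import all_boot all_order all_algebra all_fingroup.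
From mathcomp Require Import all_classical all_reals all_analysis measurable_realfun.
Set Implicit Arguments.
Unset Strict Implicit.
Unset Printing Implicit Defensive.
Import Order.TTheory GRing.Theory Num.Theory.
Import numFieldNormedType.Exports.
Local Open Scope classical_set_scope.
Local Open Scope ring_scope.

Definition measure_matrix_display : measure_display.
Proof. exact: default_measure_display. Qed.

Definition matrix_entry_sets (R : realType) m n : set (set 'M[R]_(m, n)) :=
  \bigcup_(ij in [set: 'I_m * 'I_n])
     preimage_set_system setT (fun M : 'M[R]_(m, n) => M ij.1 ij.2) measurable.

(* The Borel sets of the m x n real matrices, presented as the sigma-algebra
   generated by the entries. *)
HB.instance Definition _ (R : realType) m n :=
  @isMeasurable.Build measure_matrix_display 'M[R]_(m, n)
    <<s @matrix_entry_sets R m n >>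
    (@sigma_algebra0 _ setT _) (@sigma_algebraC _ _)
    (@sigma_algebra_bigcup _ setT _).

Lemma measurable_entry (R : realType) m n (i : 'I_m) (j : 'I_n) :
  measurable_fun setT (fun M : 'M[R]_(m, n) => M i j).
Proof.
move=> _ B mB; rewrite setTI; apply: sub_sigma_algebra.
by exists (i, j) => //=; exists B => //; rewrite setTI.
Qed.

Lemma measurable_fun_matrixP d (T : measurableType d) (R : realType) m n
    (f : T -> 'M[R]_(m, n)) :
  measurable_fun setT f <-> forall i j, measurable_fun setT (fun t => f t i j).
Proof.
split=> [mf i j|mf].
  exact: (measurableT_comp (@measurable_entry R m n i j) mf).
apply: (@measurability _ _ _ _ _ _ (@matrix_entry_sets R m n)) => //.
move=> _ [_ [[i j] _ [B mB <-]] <-].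
by rewrite setTI; exact: (mf i j).
Qed.

(* The first factor is measurableTypeR R because this is the type on which
   lebesgue_measure and normal_prob are defined; its measurable sets are those
   of R. Note that 1 + n is convertible to n.+1. *)
Definition cons_rV (R : realType) n (p : measurableTypeR R * 'rV[R]_n) : 'rV[R]_n.+1 :=
  row_mx (const_mx p.1 : 'rV_1) p.2.

Definition uncons_rV (R : realType) n (v : 'rV[R]_n.+1) : measurableTypeR R * 'rV[R]_n :=
  (v 0 0, rsubmx (v : 'rV_(1 + n))).

Lemma cons_rVK (R : realType) n : cancel (@cons_rV R n) (@uncons_rV R n).
Proof.
move=> [x v]; rewrite /uncons_rV /cons_rV row_mxKr; congr (_, _).
rewrite (_ : 0 = lshift n (0 : 'I_1) :> 'I_(1 + n)); last exact/val_inj.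
by rewrite [LHS](@row_mxEl R 1 1 n) mxE.
Qed.

Lemma uncons_rVK (R : realType) n : cancel (@uncons_rV R n) (@cons_rV R n).
Proof.
move=> v; apply: etrans (@hsubmxK R 1 1 n v).
apply: (f_equal2 (@row_mx R 1 1 n)) => //.
by apply/rowP => i; rewrite !mxE (ord1 i); congr (v _ _); exact/val_inj.
Qed.

Lemma measurable_cons_rV (R : realType) n :
  measurable_fun setT (@cons_rV R n).
Proof.
apply/measurable_fun_matrixP => i j.
rewrite (_ : (fun t => _) = fun p : measurableTypeR R * 'rV[R]_n =>
    match fintype.split (j : 'I_(1 + n)) with inl _ => p.1 | inr k => p.2 i k end).
  case: (fintype.split _) => k; first exact: measurable_fst.
  exact: (measurableT_comp (@measurable_entry R 1 n i k) measurable_snd).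
by apply/funext => -[x v]; rewrite /cons_rV mxE; case: (fintype.split _) => k; rewrite ?mxE.
Qed.

Lemma measurable_uncons_rV (R : realType) n :
  measurable_fun setT (@uncons_rV R n).
Proof.
apply/measurable_fun_pairP; split; first exact: measurable_entry.
apply/measurable_fun_matrixP => i j.
rewrite (_ : (fun t => _) = fun v : 'rV[R]_n.+1 => v i (rshift 1 j)).
  exact: (@measurable_entry R 1 n.+1).
by apply/funext => v; rewrite /= mxE.
Qed.

Section cons_measure.
Variables (R : realType) (n : nat).
Variables (m1 : {sigma_finite_measure set (measurableTypeR R) -> \bar R}).
Variables (m2 : {sigma_finite_measure set 'rV[R]_n -> \bar R}).

Definition cons_measure : set 'rV[R]_n.+1 -> \bar R :=
  pushforward (m1 \x m2)%E (@cons_rV R n).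

Let cons_measure0 : cons_measure set0 = 0%E.
Proof. by rewrite /cons_measure /pushforward preimage_set0 measure0. Qed.

Let cons_measure_ge0 A : (0 <= cons_measure A)%E.
Proof. by rewrite /cons_measure /pushforward measure_ge0. Qed.

Let cons_measure_sigma_additive : semi_sigma_additive cons_measure.
Proof.
move=> F mF tF mUF; apply: measure_semi_sigma_additive => //.
exact: measurable_cons_rV.
Qed.

HB.instance Definition _ := isMeasure.Build _ _ _ cons_measure
  cons_measure0 cons_measure_ge0 cons_measure_sigma_additive.

Let product_sigma_finite : sigma_finite setT (m1 \x m2)%E.
Proof.
have /sigma_finiteP[F [TF ndF Foo]] := sigma_finiteT m1.
have /sigma_finiteP[G [TG ndG Goo]] := sigma_finiteT m2.
exists (fun k => F k `*` G k).
  rewrite -setXTT TF TG predeqE => -[x y]; split.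
    move=> [/= [i _ Fx] [j _ Gy]]; exists (maxn i j) => //; split.
    - by move: x Fx; exact/subsetPset/ndF/leq_maxl.
    - by move: y Gy; exact/subsetPset/ndG/leq_maxr.
  by move=> [k _ []/= ? ?]; split; exists k.
move=> k; have [? ?] := Foo k; have [? ?] := Goo k.
split; first exact: measurableX.
by rewrite product_measure1E// lte_mul_pinfty// ge0_fin_numE.
Qed.

Let cons_measure_sigma_finite : sigma_finite setT cons_measure.
Proof.
have [F FT Foo] := product_sigma_finite.
exists (fun k => @uncons_rV R n @^-1` F k).
  by rewrite -preimage_bigcup -FT preimage_setT.
move=> k; have [mF Fk] := Foo k; split.
  by rewrite -[X in measurable X]setTI; exact: measurable_uncons_rV.
rewrite /cons_measure /pushforward -comp_preimage.
by rewrite (_ : _ \o _ = id) //; apply/funext => p; rewrite /= cons_rVK.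
Qed.

HB.instance Definition _ := Measure_isSigmaFinite.Build _ _ _ cons_measure
  cons_measure_sigma_finite.

End cons_measure.

Fixpoint product_rV (R : realType) (n : nat) :
    ('I_n -> {sigma_finite_measure set (measurableTypeR R) -> \bar R}) ->
    {sigma_finite_measure set 'rV[R]_n -> \bar R} :=
  match n with
  | 0 => fun _ => dirac (0 : 'rV[R]_0)
  | n'.+1 => fun mu =>
      cons_measure (mu ord0) (product_rV (fun i => mu (lift ord0 i)))
  end.

Lemma measurable_box (R : realType) n (A : 'I_n -> set R) :
  (forall i, measurable (A i)) ->
  measurable [set v : 'rV[R]_n | forall i, A i (v 0 i)].
Proof.
move=> mA; rewrite (_ : [set v | _] = \bigcap_(i in [set: 'I_n])
    ((fun v : 'rV[R]_n => v 0 i) @^-1` A i)).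
  apply: fin_bigcap_measurable => // i _.
  by rewrite -[X in measurable X]setTI; exact: measurable_entry.
by apply/seteqP; split => v /= Av i; [move=> _|]; exact: Av.
Qed.

Lemma product_rV_box (R : realType) n
    (mu : 'I_n -> {sigma_finite_measure set (measurableTypeR R) -> \bar R})
    (A : 'I_n -> set R) : (forall i, measurable (A i)) ->
  product_rV mu [set v | forall i, A i (v 0 i)] = (\prod_(i < n) mu i (A i))%E.
Proof.
elim: n mu A => [|n IH] mu A mA.
  by rewrite big_ord0 /= diracE mem_set//; case.
rewrite big_ord_recl -IH//= -product_measure1E//; last first.
  by apply: (@measurable_box R n (fun i => A (lift ord0 i))) => i; exact: mA.
  exact: mA.
have E p : (cons_rV p) 0 0 = p.1 by rewrite -[RHS]/(p.1) -{2}(cons_rVK p).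
have L (p : measurableTypeR R * 'rV[R]_n) i :
    (cons_rV p) 0 (lift ord0 i) = p.2 0 i.
  rewrite /cons_rV mxE; case: splitP => k.
    by rewrite (ord1 k).
  by rewrite /= /bump /= => -[] /val_inj ->.
rewrite /cons_measure /pushforward.
apply: (congr1 (product_measure1 _ _)); apply/seteqP; split => p /=.
  move=> Ap; split => [|i]; first by rewrite -E; exact: Ap.
  by rewrite -L; exact: Ap.
move=> [A0 AS] i; have [j ->|->] := unliftP ord0 i; first by rewrite L; exact: AS.
by rewrite [X in A _ X]E.
Qed.

Definition lebesgue_rV (R : realType) (n : nat) :
    {sigma_finite_measure set 'rV[R]_n -> \bar R} :=
  @product_rV R n (fun _ => @lebesgue_measure R).

(* N(mu, s^2 I_n): normal_prob takes the standard deviation s. *)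
Definition normal_rV (R : realType) (n : nat) (mu : 'rV[R]_n) (s : R) :
    {sigma_finite_measure set 'rV[R]_n -> \bar R} :=
  @product_rV R n (fun i => normal_prob (mu 0 i) s).


Definition dot_rV (R : realType) n (u v : 'rV[R]_n) : R :=
  \sum_(i < n) u 0 i * v 0 i.

(* The library's norm `|v| on matrices is the sup norm. *)
Definition norm2 (R : realType) n (v : 'rV[R]_n) : R := Num.sqrt (dot_rV v v).

Definition normF (R : realType) m n (A : 'M[R]_(m, n)) : R :=
  Num.sqrt (\sum_(i < m) \sum_(j < n) A i j ^+ 2).

(* The integral is the extended-real Lebesgue one: an equation with a finite
   left-hand side forces the integrand to be integrable on [0, 1]. *)
Definition weak_gradient (R : realType) n (f : 'rV[R]_n -> R)
    (df : 'rV[R]_n -> 'rV[R]_n) : Prop :=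
  {ae (lebesgue_rV R n \x lebesgue_rV R n)%E, forall yz : 'rV[R]_n * 'rV[R]_n,
    (f (yz.1 + yz.2) - f yz.1)%:E =
    (\int[lebesgue_measure]_(t in `[0%R, 1%R])
       (dot_rV yz.2 (df (yz.1 + t *: yz.2)))%:E)%E}.

Definition smooth_moment (R : realType) n (mu : 'rV[R]_n) (sigma : R)
    (f : 'rV[R]_n -> 'rV[R]_n) : Prop :=
  measurable_fun setT f /\
  exists df : 'rV[R]_n -> 'M[R]_n,
    [/\ measurable_fun setT df,
        forall i, weak_gradient (fun y => f y 0 i) (fun y => row i (df y)) &
        exists alpha0 : R,
          [/\ 0 < alpha0,
              (\int[normal_rV mu (Num.sqrt (1 + alpha0) * sigma)]_z
                 (norm2 (f z) ^+ 4)%:E < +oo)%E &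
              (\int[normal_rV mu (Num.sqrt (1 + alpha0) * sigma)]_z
                 (normF (df z) ^+ 2)%:E < +oo)%E]].

Section random_vectors.
Context d (T : measurableType d) (R : realType) (P : probability T R).

Definition has_law d' (T' : measurableType d') (X : {RV P >-> T'})
    (m : set T' -> \bar R) : Prop :=
  forall A, measurable A -> distribution P X A = m A.

Definition joint n K (w : 'I_K -> {RV P >-> 'rV[R]_n}) (t : T) :
    K.-tuple 'rV[R]_n :=
  [tuple w k t | k < K].

Definition independent_joint n K (Y : {RV P >-> 'rV[R]_n})
    (w : 'I_K -> {RV P >-> 'rV[R]_n}) : Prop :=
  forall A B, measurable A -> measurable B ->
    P (Y @^-1` A `&` joint w @^-1` B) =
    (P (Y @^-1` A) * P (joint w @^-1` B))%E.

Definition exchangeable_normal n K (sigma rho : R)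
    (w : 'I_K -> {RV P >-> 'rV[R]_n}) : Prop :=
  [/\ forall (pi : 'S_K) A, measurable A ->
        P (joint (fun k => w (pi k)) @^-1` A) = P (joint w @^-1` A),
      forall k, has_law (w k) (normal_rV 0 sigma) &
      forall k k', k != k' -> forall i j,
        covariance P (fun t => w k t 0 i) (fun t => w k' t 0 j) =
        (rho * sigma ^+ 2 * (i == j)%:R)%:E].

Section conditional.
Context d' (T' : measurableType d') (Y : T -> T').

Definition is_cond_exp (X Z : T -> \bar R) : Prop :=
  measurable_fun [set: g_sigma_algebra_preimageType Y] Z /\
  forall A, g_sigma_algebra_preimage Y A ->
    (\int[P]_(t in A) Z t = \int[P]_(t in A) X t)%E.

(* A version of E[X | Y], for X integrable or nonnegative; for such X a
   version exists and any two versions agree almost surely. *)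
Definition cond_exp (X : T -> \bar R) : T -> \bar R :=
  xget (cst 0%E) [set Z | is_cond_exp X Z].

(* Var(X | Y) = E[(X - E[X | Y])^2 | Y], possibly infinite. *)
Definition cond_var (X : T -> R) : T -> \bar R :=
  cond_exp (fun t => ((X t)%:E - cond_exp (EFin \o X) t) ^+ 2)%E.

Definition cond_exp_rV n (X : T -> 'rV[R]_n) (t : T) : 'rV[R]_n :=
  \row_i fine (cond_exp (fun u => (X u 0 i)%:E) t).

End conditional.

End random_vectors.

Section cond_exp_existence.
Context d (T : measurableType d) (R : realType) (P : probability T R).
Context d' (T' : measurableType d') (Y : {RV P >-> T'}).

Lemma cond_expP (X : T -> \bar R) : P.-integrable setT X ->
  is_cond_exp P Y X (cond_exp P Y X).
Proof.
move=> iX; apply: xgetPex.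
have mX : measurable_fun setT X by exact: (measurable_int P).
have mY : measurable_fun setT Y by [].
pose nu0 : {charge set T -> \bar R} := induced_charge iX.
have nu0P : nu0 `<< P.
  apply/null_content_dominatesP => A mA PA0.
  by rewrite /nu0 /induced_charge; apply: null_set_integral => //; exact: measurable_funTS.
have [nu nuE] : exists nu : {charge set T' -> \bar R},
    nu = pushforward nu0 Y :> (set T' -> \bar R).
  by unshelve eexists (pushforward nu0 Y : {charge set T' -> \bar R}).
have nuP : nu `<< distribution P Y by rewrite nuE; exact: dominates_pushforward.
pose z := Radon_Nikodym nu (distribution P Y).
have iz : (distribution P Y).-integrable setT z by exact: Radon_Nikodym_integrable.
have mz : measurable_fun setT z by exact: (measurable_int (distribution P Y)).
exists (z \o Y); split.
  move=> _ B mB; rewrite setTI; exists (z @^-1` B); last by rewrite setTI.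
  by rewrite -[X in measurable X]setTI; exact: mz.
move=> _ [B mB <-]; rewrite setTI.
rewrite -[RHS]/(pushforward nu0 Y B) -nuE (Radon_Nikodym_integral nuP mB).
have izY : P.-integrable setT (z \o Y).
  apply/integrableP; split; first exact: measurableT_comp.
  have /integrableP[_] := iz; rewrite ge0_integral_pushforward//.
  exact: measurableT_comp.
rewrite integral_pushforward//; apply: integrableS izY => //.
by rewrite -[X in measurable X]setTI; exact: mY.
Qed.
End cond_exp_existence.

Section estimators.
Context d (T : measurableType d) (R : realType) (P : probability T R).
Context (n K m : nat).
Variables (Y : {RV P >-> 'rV[R]_n}) (w : 'I_K -> {RV P >-> 'rV[R]_n}).

Definition CV (g : 'rV[R]_n -> 'rV[R]_n) (alpha : R) (t : T) : R :=
  K%:R^-1 * \sum_(k < K)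
    (norm2 (g (Y t + Num.sqrt alpha *: w k t)
            - (Y t - (Num.sqrt alpha)^-1 *: w k t)) ^+ 2
     - alpha^-1 * norm2 (w k t) ^+ 2).

(* omega^k 1{h(Y + sqrt alpha omega^k) > 0} *)
Definition gated_noise (h : 'rV[R]_n -> R) (alpha : R) (k : 'I_K) (t : T) :
    'rV[R]_n :=
  \1_[set y | 0 < h y] (Y t + Num.sqrt alpha *: w k t) *: w k t.

(* r(omega^k, Y); the conditional expectation is taken entrywise. *)
Definition residual (h : 'rV[R]_n -> R) (alpha : R) (k : 'I_K) (t : T) :
    'rV[R]_n :=
  cond_exp_rV P Y (gated_noise h alpha k) t - gated_noise h alpha k t.

Definition control_variate (a : 'I_m -> 'rV[R]_n -> 'rV[R]_n)
    (h : 'I_m -> 'rV[R]_n -> R) (alpha : R) (t : T) : R :=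
  2 / (K%:R * Num.sqrt alpha) *
  \sum_(k < K) \sum_(l < m) dot_rV (a l (Y t)) (residual (h l) alpha k t).

Definition adjusted_CV (g : 'rV[R]_n -> 'rV[R]_n)
    (a : 'I_m -> 'rV[R]_n -> 'rV[R]_n) (h : 'I_m -> 'rV[R]_n -> R)
    (alpha : R) (t : T) : R :=
  CV g alpha t + control_variate a h alpha t.

End estimators.

Definition piecewise (R : realType) n m (f0 : 'rV[R]_n -> 'rV[R]_n)
    (a : 'I_m -> 'rV[R]_n -> 'rV[R]_n) (h : 'I_m -> 'rV[R]_n -> R)
    (y : 'rV[R]_n) : 'rV[R]_n :=
  f0 y + \sum_(l < m) \1_[set x | 0 < h l x] y *: a l y.

(* Main.v *)
Require Import Defs.
From HB Require Import structures.
From mathcomp Require Import all_boot all_order all_algebra all_fingroup.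
From mathcomp Require Import all_classical all_reals all_analysis measurable_realfun.
From mathcomp Require Import ring lra.
Set Implicit Arguments.
Unset Strict Implicit.
Unset Printing Implicit Defensive.
Import Order.TTheory GRing.Theory Num.Theory.
Import numFieldNormedType.Exports.
Local Open Scope classical_set_scope.
Local Open Scope ring_scope.

(** The expected conditional variance of the adjusted estimator is compared with
    that of one explicit linear statistic of the noise.

    Write [s] for the square root of [alpha]. In each replicate the terms
    [|omega|^2 / alpha] cancel when the square is expanded, and the cross term
    [(2 / s) <omega, g (Y + s omega) - Y>] is what may explode. Replacing the
    values of [f0] and [a_l] at [Y + s omega] by their values at [Y] creates
    increments of size [s]; the gated terms with [a_l Y] are exactly those that
    the control variate exchanges for a function of [Y]. By
    [replicate_decomposition], a replicate is thus the sum of a regular part, of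
    the linear term [(2 / s) <omega, f0 Y - Y>] and of a function of [Y].

    The regular part is bounded in mean square, uniformly for small [alpha]
    ([regular_part_bound]). The increments are integrals of the weak gradient
    along segments, so their squares, divided by [alpha], are controlled by the
    mean of [|omega|^4 |df (Y + t s omega)|^2] with [t] in [0, 1]. The two factors
    are dependent, but for [u^2 <= alpha0 / 2] the law of [(Y + u omega, omega)]
    has a density at most a constant times that of an independent pair of normal
    vectors with variances [(1 + alpha0) sigma^2] and [2 sigma^2]
    ([normal_rV_shear_dominated]): in dimension one this is completing the
    square, and the comparison tensorizes ([product_rV_dominated]). The moment
    assumption at [alpha0] then applies.

    Since the signal and the replicates are independent, twice the expected
    conditional variance of [phi (Y, W)] is the mean of
    [(phi (y, x) - phi (y, x'))^2], where [x] and [x'] are independent copies of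
    [W] ([integral_cond_var_independent]). This resampling energy ignores
    functions of [Y]. The linear term, averaged over the replicates, has energy
    exactly [8 kappa / (K^2 alpha)] times the mean of [|f0 Y - Y|^2], where
    [kappa = K (1 + (K - 1) rho) sigma^2] is the variance of each coordinate of
    the sum of the replicates ([linear_part_energy]); only pairwise covariances
    enter. It vanishes for [rho = - 1 / (K - 1)], and the estimator then has the
    energy of its regular part, up to a factor. For any other admissible [rho]
    it is of order [1 / alpha], as that mean is positive, while it is at most
    twice the energy of the
    estimator plus twice that of the regular part; so the energy of the
    estimator is unbounded. *)

(** * Tonelli and measurability of row-vector expressions *)

Section tonelli.
Context d1 d2 (T1 : measurableType d1) (T2 : measurableType d2) (R : realType).
Variable m1 : {sigma_finite_measure set T1 -> \bar R}.
Variable m2 : {sigma_finite_measure set T2 -> \bar R}.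
Local Open Scope ereal_scope.

Lemma ge0_integral_swap (F : T1 -> T2 -> \bar R) :
  measurable_fun setT (fun p : T1 * T2 => F p.1 p.2) ->
  (forall x y, 0 <= F x y) ->
  \int[m1]_x \int[m2]_y F x y = \int[m2]_y \int[m1]_x F x y.
Proof. by move=> mF F0; exact: (fubini_tonelli (fun p => F p.1 p.2)). Qed.

Lemma ge0_integral_product (F : T1 * T2 -> \bar R) :
  measurable_fun setT F -> (forall p, 0 <= F p) ->
  \int[m1 \x m2]_p F p = \int[m1]_x \int[m2]_y F (x, y).
Proof. by move=> mF F0; exact: (fubini_tonelli1 F). Qed.

End tonelli.

Lemma measurable_ge0_integral d1 d2 (T1 : measurableType d1)
    (T2 : measurableType d2) (R : realType)
    (m2 : {sigma_finite_measure set T2 -> \bar R}) (F : T1 -> T2 -> \bar R) :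
  measurable_fun setT (fun p : T1 * T2 => F p.1 p.2) ->
  (forall x y, (0 <= F x y)%E) ->
  measurable_fun setT (fun x => \int[m2]_y F x y)%E.
Proof.
by move=> mF F0; exact: (measurable_fun_fubini_tonelli_F (fun p => F p.1 p.2)).
Qed.

Lemma ge0_le_integralT d (T : measurableType d) (R : realType)
    (m : {measure set T -> \bar R}) (f g : T -> \bar R) :
  measurable_fun setT f -> measurable_fun setT g ->
  (forall x, (0 <= f x)%E) -> (forall x, (f x <= g x)%E) ->
  (\int[m]_x f x <= \int[m]_x g x)%E.
Proof. by move=> mf mg f0 fg; exact: ge0_le_integral. Qed.

Section row_vectors.
Variable R : realType.

Lemma measurable_cons_rV_comp d (T : measurableType d) n
    (f : T -> measurableTypeR R) (g : T -> 'rV[R]_n) :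
  measurable_fun setT f -> measurable_fun setT g ->
  measurable_fun setT (fun t => cons_rV (f t, g t)).
Proof.
move=> mf mg; apply: (measurableT_comp (@measurable_cons_rV R n)).
exact: measurable_fun_pair.
Qed.

Lemma measurable_rV_coord d (T : measurableType d) m n (f : T -> 'M[R]_(m, n)) i j :
  measurable_fun setT f -> measurable_fun setT (fun t => f t i j).
Proof. by move=> /measurable_fun_matrixP; exact. Qed.

Lemma measurable_rV_add d (T : measurableType d) n (f g : T -> 'rV[R]_n) :
  measurable_fun setT f -> measurable_fun setT g ->
  measurable_fun setT (fun t => f t + g t).
Proof.
move=> mf mg; apply/measurable_fun_matrixP => i j.
under eq_fun do rewrite mxE.
by apply: measurable_funD; exact: measurable_rV_coord.
Qed.

Lemma measurable_rV_scale d (T : measurableType d) n (c : T -> R) (f : T -> 'rV[R]_n) :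
  measurable_fun setT c -> measurable_fun setT f ->
  measurable_fun setT (fun t => c t *: f t).
Proof.
move=> mc mf; apply/measurable_fun_matrixP => i j.
under eq_fun do rewrite mxE.
by apply: measurable_funM => //; exact: measurable_rV_coord.
Qed.

Lemma measurable_rV_opp d (T : measurableType d) n (f : T -> 'rV[R]_n) :
  measurable_fun setT f -> measurable_fun setT (fun t => - f t).
Proof.
move=> mf; apply/measurable_fun_matrixP => i j.
under eq_fun do rewrite mxE.
by apply: measurableT_comp => //; exact: measurable_rV_coord.
Qed.

Lemma measurable_oppr_comp d (T : measurableType d) (f : T -> R) :
  measurable_fun setT f -> measurable_fun setT (fun t => - f t).
Proof. by move=> mf; apply: measurableT_comp. Qed.

Lemma measurable_rV_sum d (T : measurableType d) n I (s : seq I)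
    (f : I -> T -> 'rV[R]_n) :
  (forall i, measurable_fun setT (f i)) ->
  measurable_fun setT (fun t => \sum_(i <- s) f i t).
Proof.
move=> mf; elim: s => [|i s IH].
  by under eq_fun do rewrite big_nil; exact: measurable_cst.
by under eq_fun do rewrite big_cons; exact: measurable_rV_add.
Qed.

Lemma measurable_dot_rV d (T : measurableType d) n (f g : T -> 'rV[R]_n) :
  measurable_fun setT f -> measurable_fun setT g ->
  measurable_fun setT (fun t => dot_rV (f t) (g t)).
Proof.
move=> mf mg; apply: measurable_sum => i.
by apply: measurable_funM; exact: measurable_rV_coord.
Qed.

Lemma measurable_norm2 d (T : measurableType d) n (f : T -> 'rV[R]_n) :
  measurable_fun setT f -> measurable_fun setT (fun t => norm2 (f t)).
Proof.
move=> mf; apply: (measurableT_comp (continuous_measurable_fun (@sqrt_continuous R))).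
exact: measurable_dot_rV.
Qed.

Lemma measurable_normF d (T : measurableType d) m n (f : T -> 'M[R]_(m, n)) :
  measurable_fun setT f -> measurable_fun setT (fun t => normF (f t)).
Proof.
move=> mf; apply: (measurableT_comp (continuous_measurable_fun (@sqrt_continuous R))).
apply: measurable_sum => i; apply: measurable_sum => j.
by apply: measurable_funX; exact: measurable_rV_coord.
Qed.

Lemma measurable_row d (T : measurableType d) m n (f : T -> 'M[R]_(m, n)) i :
  measurable_fun setT f -> measurable_fun setT (fun t => row i (f t)).
Proof.
move=> mf; apply/measurable_fun_matrixP => k j.
by under eq_fun do rewrite mxE; exact: measurable_rV_coord.
Qed.

Lemma ge0_integral_cons_measure n
    (m1 : {sigma_finite_measure set (measurableTypeR R) -> \bar R})
    (m2 : {sigma_finite_measure set 'rV[R]_n -> \bar R}) (F : 'rV[R]_n.+1 -> \bar R) :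
  measurable_fun setT F -> (forall v, (0 <= F v)%E) ->
  (\int[cons_measure m1 m2]_v F v =
   \int[m1]_x \int[m2]_y F (cons_rV (x, y)))%E.
Proof.
move=> mF F0; rewrite ge0_integral_pushforward//.
  rewrite preimage_setT ge0_integral_product//; last first.
    by move=> p; exact: F0.
  exact: (measurableT_comp mF (@measurable_cons_rV R n)).
exact: measurable_cons_rV.
Qed.

Lemma cons_rV_affine n (a : R) (x y : R) (v w : 'rV[R]_n) :
  cons_rV (x : measurableTypeR R, v) + a *: cons_rV (y : measurableTypeR R, w) =
  cons_rV (x + a * y : measurableTypeR R, v + a *: w).
Proof.
apply/rowP => i; rewrite !mxE.
by case: (fintype.split _) => k; rewrite !mxE.
Qed.

Lemma cons_rV_scale n (a : R) (y : R) (w : 'rV[R]_n) :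
  a *: cons_rV (y : measurableTypeR R, w) =
  cons_rV (a * y : measurableTypeR R, a *: w).
Proof.
apply/rowP => i; rewrite !mxE.
by case: (fintype.split _) => k; rewrite !mxE.
Qed.

End row_vectors.

(** Follows the head symbol of the body; the order of the alternatives decides
    between the scalar, extended and vector readings of a shared notation. *)
Ltac meas :=
  lazymatch goal with
  | |- measurable_fun _ fst => exact: measurable_fst
  | |- measurable_fun _ snd => exact: measurable_snd
  | |- measurable_fun _ (fun t => fst t) => exact: measurable_fst
  | |- measurable_fun _ (fun t => snd t) => exact: measurable_snd
  | |- measurable_fun _ (fun t => t) => exact: measurable_id
  | |- measurable_fun _ (fun t => fst (@?f t)) =>
      apply: (measurableT_comp measurable_fst); meas
  | |- measurable_fun _ (fun t => snd (@?f t)) =>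
      apply: (measurableT_comp measurable_snd); meas
  | |- measurable_fun _ (fun t => (@?f t, @?g t)) =>
      apply: measurable_fun_pair; meas
  | |- measurable_fun _ (fun t => cons_rV (@?f t, @?g t)) =>
      apply: (measurable_cons_rV_comp (f := f) (g := g)); meas
  | |- measurable_fun _ (fun t => dot_rV _ _) => apply: measurable_dot_rV; meas
  | |- measurable_fun _ (fun t => norm2 _) => apply: measurable_norm2; meas
  | |- measurable_fun _ (fun t => normF _) => apply: measurable_normF; meas
  | |- measurable_fun _ (fun t => row _ _) => apply: measurable_row; meas
  | |- measurable_fun _ (fun t => normal_pdf ?m ?s _) =>
      apply: (measurableT_comp (measurable_normal_pdf m s)); meas
  | |- measurable_fun _ (fun t => EFin _) => apply/measurable_EFinP; meas
  | |- measurable_fun _ (fun t => tnth _ ?k) =>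
      apply: (measurableT_comp (@measurable_tnth _ _ _ k)); meas
  | |- measurable_fun _ (fun t => fun_of_matrix _ _ _) =>
      apply: measurable_rV_coord; meas
  | |- measurable_fun _ (fun t => (_ + _)%E) =>
      first [apply: emeasurable_funD | apply: measurable_funD | apply: measurable_rV_add]; meas
  | |- measurable_fun _ (fun t => (_ + _)%R) =>
      first [apply: measurable_funD | apply: measurable_rV_add | apply: emeasurable_funD]; meas
  | |- measurable_fun _ (fun t => (- _)%R) =>
      first [ exact: measurable_cst
            | exact: oppr_measurable
            | apply: measurable_oppr_comp
            | apply: measurable_rV_opp]; meas
  | |- measurable_fun _ (fun t => (_ * _)%E) => apply: emeasurable_funM; meas
  | |- measurable_fun _ (fun t => (_ * _)%R) => apply: measurable_funM; meas
  | |- measurable_fun _ (fun t => (_ *: _)%R) => apply: measurable_rV_scale; meas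
  | |- measurable_fun _ (fun t => (_ ^+ _)%R) => apply: measurable_funX; meas
  | |- measurable_fun _ (fun t => (\sum_(i <- _) _)%E) =>
      apply: emeasurable_sum => ?; meas
  | |- measurable_fun _ (fun t => (\sum_(i <- _) _)%R) =>
      first [apply: measurable_sum
            | apply: emeasurable_sum | apply: measurable_rV_sum] => ?; meas
  | H : measurable_fun _ ?f |- measurable_fun _ (fun t => ?f (@?g t)) =>
          apply: (measurableT_comp H); meas
  | |- measurable_fun _ (@norm2 _ _) => apply: measurable_norm2; exact: measurable_id
  | |- measurable_fun _ (@normF _ _ _) => apply: measurable_normF; exact: measurable_id
  | |- measurable_fun _ -%R =>
      first [exact: oppr_measurable | apply: measurable_rV_opp; exact: measurable_id]
  | |- measurable_fun _ (normal_pdf _ _) => exact: measurable_normal_pdf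
  | _ => first [exact: measurable_cst | assumption | done]
  end.

(** * Domination of product laws *)

Section tensorization.
Variable R : realType.
Local Notation RT := (measurableTypeR R).
Local Open Scope ereal_scope.

Lemma ge0_integral_cons_measure2 n (m1 m2 : {sigma_finite_measure set RT -> \bar R})
    (p1 p2 : {sigma_finite_measure set 'rV[R]_n -> \bar R})
    (F : 'rV[R]_n.+1 * 'rV[R]_n.+1 -> \bar R) :
  measurable_fun setT F -> (forall p, 0 <= F p) ->
  \int[cons_measure m1 p1]_y \int[cons_measure m2 p2]_x F (y, x) =
  \int[m1]_a \int[m2]_b \int[p1]_v \int[p2]_w F (cons_rV (a, v), cons_rV (b, w)).
Proof.
move=> mF F0; rewrite ge0_integral_cons_measure; last 2 first.
  by apply: measurable_ge0_integral => //; meas.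
  by move=> v; exact: integral_ge0.
apply: eq_integral => a _.
transitivity (\int[p1]_v \int[m2]_b \int[p2]_w F (cons_rV (a, v), cons_rV (b, w))).
  apply: eq_integral => v _; rewrite (ge0_integral_cons_measure _ _ (F := fun x => F (_, x)))//.
  by meas.
rewrite ge0_integral_swap// => [|v b]; last exact: integral_ge0.
by apply: measurable_ge0_integral => //; meas.
Qed.

(** The map [(y, x) |-> (y + u x, c x)] acts coordinate by coordinate, so a
    comparison of the one-dimensional laws passes to their products, each
    coordinate costing one factor [C]. Two cases are used: [c = 1], a shear, and
    [u = 0], a dilation of the second vector. *)
Lemma product_rV_dominated n
    (m1 m2 l1 l2 : 'I_n -> {sigma_finite_measure set RT -> \bar R})
    (u c C : R) :
  (0 <= C)%R ->
  (forall i (F : RT * RT -> \bar R), measurable_fun setT F -> (forall p, 0 <= F p) ->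
    \int[m1 i]_y \int[m2 i]_x F (y + u * x, c * x)%R <=
    C%:E * \int[l1 i]_y \int[l2 i]_x F (y, x)) ->
  forall F : 'rV[R]_n * 'rV[R]_n -> \bar R, measurable_fun setT F ->
    (forall p, 0 <= F p) ->
    \int[product_rV m1]_y \int[product_rV m2]_x F (y + u *: x, c *: x)%R <=
    (C ^+ n)%:E * \int[product_rV l1]_y \int[product_rV l2]_x F (y, x).
Proof.
move=> C0; elim: n m1 m2 l1 l2 => [|n IH] m1 m2 l1 l2 H F mF F0.
  rewrite expr0 mul1e le_eqVlt; apply/orP; left; apply/eqP.
  apply: eq_integral => y _; apply: eq_integral => x _.
  by rewrite (thinmx0 (y + _)%R) (thinmx0 (c *: x)%R) [in RHS](thinmx0 y) [in RHS](thinmx0 x).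
(* An equation instead of a local definition, so that unification never unfolds the inner integrals. *)
have [J JE] : exists J : RT * RT -> \bar R, J = fun p =>
  \int[product_rV (fun i => l1 (lift ord0 i))]_v
    \int[product_rV (fun i => l2 (lift ord0 i))]_w
       F (cons_rV (p.1, v), cons_rV (p.2, w)) by eexists.
have mJ : measurable_fun setT J.
  rewrite JE; apply: measurable_ge0_integral => [|p v]; last exact: integral_ge0.
  by apply: measurable_ge0_integral => //; meas.
have J0 p : 0 <= J p.
  by rewrite JE; apply: integral_ge0 => v _; exact: integral_ge0.
have Cn0 : 0 <= (C ^+ n)%:E by rewrite lee_fin exprn_ge0.
rewrite (ge0_integral_cons_measure2 _ _ _ _ (F := fun p => F (p.1 + u *: p.2, c *: p.2)%R))//; last by meas.
rewrite (ge0_integral_cons_measure2 _ _ _ _ mF)//.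
under eq_integral do under eq_integral do under eq_integral do
  under eq_integral do rewrite /= cons_rV_affine cons_rV_scale.
apply: (@le_trans _ _ (\int[m1 ord0]_a \int[m2 ord0]_b
    ((C ^+ n)%:E * J (a + u * b, c * b)%R))).
  apply: ge0_le_integralT => [|||a].
  - apply: measurable_ge0_integral => [|a b]; last first.
      by apply: integral_ge0 => v _; exact: integral_ge0.
    apply: measurable_ge0_integral => [|p v]; last exact: integral_ge0.
    by apply: measurable_ge0_integral => //; meas.
  - apply: measurable_ge0_integral => [|a b]; last exact: mule_ge0.
    by meas.
  - move=> a; apply: integral_ge0 => b _; apply: integral_ge0 => v _.
    exact: integral_ge0.
  - apply: ge0_le_integralT => [|||b].
    + apply: measurable_ge0_integral => [|p v]; last exact: integral_ge0.
      by apply: measurable_ge0_integral => //; meas.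
    + by meas.
    + by move=> b; apply: integral_ge0 => v _; exact: integral_ge0.
    + rewrite JE; apply: (IH (fun i => m1 (lift ord0 i)) (fun i => m2 (lift ord0 i))
        (fun i => l1 (lift ord0 i)) (fun i => l2 (lift ord0 i)) _
        (fun q => F (cons_rV (a + u * b : RT, q.1), cons_rV (c * b : RT, q.2))%R)) => //.
        by move=> i; exact: H.
      by meas.
rewrite (eq_integral (fun a : RT => (C ^+ n)%:E * \int[m2 ord0]_b J ((a + u * b)%R, (c * b)%R))); last first.
  by move=> a _; rewrite ge0_integralZl//; meas.
rewrite ge0_integralZl//; last first.
  by move=> a _; exact: integral_ge0.
  by apply: measurable_ge0_integral => //; meas.
rewrite exprS mulrC EFinM -muleA lee_wpmul2l//.
by rewrite JE in mJ J0 *; exact: (H ord0 _ mJ J0).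
Qed.
End tensorization.

(** * Shears of the one-dimensional normal law *)

Section lebesgue_affine.
Variable R : realType.
Local Notation RT := (measurableTypeR R).
Local Notation lam := (@lebesgue_measure R).

(** Lebesgue measure is determined by half-open intervals, whose preimages under
    an affine map are again half-open; for [c < 0] the open end changes side. *)
Lemma ge0_integral_lebesgue_affine (c e : R) (F : RT -> \bar R) : c != 0 ->
  measurable_fun setT F -> (forall x, (0 <= F x)%E) ->
  (\int[lam]_x F x = `|c|%:E * \int[lam]_x F (c * x + e)%R)%E.
Proof.
move=> c0 mF F0.
pose phi (x : RT) : RT := c * x + e.
have mphi : measurable_fun setT phi.
  by apply: measurable_funD => //; apply: measurable_funM.
have c'0 : 0 < `|c| by rewrite normr_gt0.
pose m := mscale (NngNum (ltW c'0)) (pushforward lam phi) : {measure set RT -> \bar R}.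
transitivity (\int[m mphi]_x F x)%E.
  apply: eq_measure_integral => A mA _; apply: lebesgue_measure_unique => // _ [[a b] _ <-] /=.
  rewrite /m /mscale /= /pushforward.
  have [cp|cn] := ltP 0 c.
    rewrite (_ : _ @^-1` _ = `](a - e) / c, (b - e) / c]%classic); last first.
      apply/seteqP; split => x /=; rewrite !in_itv/= /phi ltr_pdivrMr// ler_pdivlMr//;
      by rewrite ltrBlDr lerBrDr mulrC.
    rewrite !lebesgue_measure_itv/= !lte_fin ltr_pM2r ?invr_gt0// ltrD2r.
    case: ifP => _; last by rewrite mule0.
    by rewrite -!EFinB -EFinM gtr0_norm//; congr EFin; field.
  have {}cn : c < 0 by rewrite lt_neqAle c0.
  rewrite (_ : _ @^-1` _ = `[(b - e) / c, (a - e) / c[%classic); last first.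
    apply/seteqP; split => x /=; rewrite !in_itv/= /phi ltr_ndivlMr// ler_ndivrMr//;
    by rewrite ltrBlDr lerBrDr mulrC andbC.
  rewrite !lebesgue_measure_itv/= !lte_fin ltr_nM2r ?invr_lt0// ltrD2r.
  case: ifP => _; last by rewrite mule0.
  by rewrite -!EFinB -EFinM ltr0_norm//; congr EFin; field.
rewrite ge0_integral_mscale//= ge0_integral_pushforward//.
Qed.

End lebesgue_affine.

Section normal_prob_1d.
Variable R : realType.
Local Notation RT := (measurableTypeR R).
Local Notation lam := (@lebesgue_measure R).

(** The Radon-Nikodym derivative of the normal law has the same integrals as its
    density, hence agrees with it almost everywhere. *)
Lemma ge0_integral_normal_prob (m s : R) (F : RT -> \bar R) :
  measurable_fun setT F -> (forall x, (0 <= F x)%E) ->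
  (\int[normal_prob m s]_x F x = \int[lam]_x (F x * (normal_pdf m s x)%:E))%E.
Proof.
move=> mF F0.
have dom := normal_prob_dominates m s.
rewrite -(Radon_Nikodym_SigmaFinite.change_of_variables dom)//.
have iRN := Radon_Nikodym_SigmaFinite.f_integrable dom.
apply: ae_eq_integral => //.
- by apply: emeasurable_funM => //; exact: measurable_int iRN.
- by apply: emeasurable_funM => //; apply/measurable_EFinP; exact: measurable_normal_pdf.
- apply: ae_eqe_mul2l; apply: integral_ae_eq => //.
    by apply/measurable_EFinP; exact: measurable_normal_pdf.
  by move=> E _ mE; rewrite -Radon_Nikodym_SigmaFinite.f_integral.
Qed.

Lemma ge0_integral_normal_probN (s : R) (F : RT -> \bar R) : s != 0 ->
  measurable_fun setT F -> (forall x, (0 <= F x)%E) ->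
  (\int[normal_prob 0 s]_x F (- x)%R = \int[normal_prob 0 s]_x F x)%E.
Proof.
move=> s0 mF F0.
have mN : measurable_fun setT (fun x : RT => - x) by exact: oppr_measurable.
rewrite !ge0_integral_normal_prob//; last exact: (measurableT_comp mF mN).
rewrite (@ge0_integral_lebesgue_affine _ (-1) 0); first last.
- by move=> x; rewrite mule_ge0// lee_fin normal_pdf_ge0.
- by meas.
- by rewrite oppr_eq0 oner_eq0.
rewrite normrN1 mul1e; apply: eq_integral => x _; rewrite mulN1r addr0 opprK.
by rewrite normal_pdfE// /normal_fun !subr0 sqrrN.
Qed.

(** Completing the square: shearing a Gaussian pair [(Z, x)] by a small multiple
    [u] costs only a slightly wider Gaussian in [Z] and a doubled variance in
    [x]. *)
Lemma sheared_square_ge (e u Z x : R) : 0 < e -> u ^+ 2 <= e / 2 ->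
  Z ^+ 2 / (1 + e) + x ^+ 2 / 2 <= (Z - u * x) ^+ 2 + x ^+ 2.
Proof.
move=> e0 ue.
have e1 : 0 < 1 + e by lra.
rewrite -subr_ge0.
have -> : (Z - u * x) ^+ 2 + x ^+ 2 - (Z ^+ 2 / (1 + e) + x ^+ 2 / 2) =
  e / (1 + e) * (Z - (1 + e) / e * (u * x)) ^+ 2 + x ^+ 2 * ((e / 2 - u ^+ 2) / e).
  by field; rewrite !gt_eqF.
apply: addr_ge0; apply: mulr_ge0; try exact: sqr_ge0.
  by apply: divr_ge0; exact: ltW.
by apply: divr_ge0; [rewrite subr_ge0 | exact: ltW].
Qed.

(** The ratio of the normalizing constants of the two pairs of densities. *)
Definition shear_cst (s e : R) : R :=
  normal_peak s ^+ 2 / (normal_peak (Num.sqrt (1 + e) * s) * normal_peak (Num.sqrt 2 * s)).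

Lemma normal_pdf_shear (m s e u z x : R) : s != 0 -> 0 < e -> u ^+ 2 <= e / 2 ->
  normal_pdf m s (z - u * x) * normal_pdf 0 s x <=
  shear_cst s e * (normal_pdf m (Num.sqrt (1 + e) * s) z * normal_pdf 0 (Num.sqrt 2 * s) x).
Proof.
move=> s0 e0 ue.
have s2 : 0 < s ^+ 2 by rewrite exprn_even_gt0.
have e1 : 0 < 1 + e by lra.
have t0 : Num.sqrt (1 + e) * s != 0 by rewrite mulf_neq0// gt_eqF// sqrtr_gt0.
have t1 : Num.sqrt 2 * s != 0 by rewrite mulf_neq0// gt_eqF// sqrtr_gt0.
rewrite !normal_pdfE// /shear_cst.
have P0 := normal_peak_gt0 s0.
have P1 := normal_peak_gt0 t0.
have P2 := normal_peak_gt0 t1.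
rewrite [leLHS](_ : _ = normal_peak s ^+ 2 * (normal_fun m s (z - u * x) * normal_fun 0 s x)); last by ring.
rewrite [leRHS](_ : _ = normal_peak s ^+ 2 *
  (normal_fun m (Num.sqrt (1 + e) * s) z * normal_fun 0 (Num.sqrt 2 * s) x)); last first.
  by field; rewrite !gt_eqF.
apply: ler_wpM2l; first exact: sqr_ge0.
rewrite /normal_fun -!expRD ler_expR.
have M2 (a : R) : a *+ 2 = a * 2 by rewrite mulr_natr.
rewrite !(M2 (_ ^+ 2)) !exprMn !sqr_sqrtr ?(ltW e1)// !subr0.
rewrite [leLHS](_ : _ = - (((z - m) - u * x) ^+ 2 + x ^+ 2) / (s ^+ 2 * 2)); last first.
  by field.
rewrite [leRHS](_ : _ = - ((z - m) ^+ 2 / (1 + e) + x ^+ 2 / 2) / (s ^+ 2 * 2)); last first.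
  by field; rewrite s0 gt_eqF.
apply: ler_wpM2r; first by rewrite invr_ge0 mulr_ge0// ltW.
rewrite lerN2.
exact: sheared_square_ge.
Qed.

Lemma shear_cst_ge0 (s e : R) : 0 <= shear_cst s e.
Proof. by rewrite divr_ge0 ?sqr_ge0// mulr_ge0// normal_peak_ge0. Qed.

(** Once the first variable is translated by [u x], this is the pointwise
    comparison of densities [normal_pdf_shear]. The factor [1] matches the form
    required by [product_rV_dominated]. *)
Lemma normal_prob_shear_dominated (m s e u : R) (F : RT * RT -> \bar R) :
  s != 0 -> 0 < e -> u ^+ 2 <= e / 2 ->
  measurable_fun setT F -> (forall p, (0 <= F p)%E) ->
  (\int[normal_prob m s]_y \int[normal_prob 0 s]_x F (y + u * x, 1 * x)%R <=
   (shear_cst s e)%:E * \int[normal_prob m (Num.sqrt (1 + e) * s)]_y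
     \int[normal_prob 0 (Num.sqrt 2 * s)]_x F (y, x))%E.
Proof.
move=> s0 e0 ue mF F0.
have pdf0 (m' s' z : R) : (0 <= (normal_pdf m' s' z)%:E)%E by rewrite lee_fin normal_pdf_ge0.
pose C := shear_cst s e; have C0 : 0 <= C by exact: shear_cst_ge0.
under eq_integral do under eq_integral do rewrite mul1r.
have -> : (\int[normal_prob m s]_y \int[normal_prob 0 s]_x F ((y + u * x)%R, x) =
   \int[lam]_x \int[lam]_z (F (z, x) * (normal_pdf m s (z - u * x) * normal_pdf 0 s x)%:E))%E.
  rewrite ge0_integral_swap//; last by meas.
  rewrite ge0_integral_normal_prob; last 2 first.
    by apply: measurable_ge0_integral => //; meas.
    by move=> x; exact: integral_ge0.
  apply: eq_integral => x _.
  rewrite ge0_integral_normal_prob//; last by meas.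
  rewrite muleC -ge0_integralZl//; last 2 first.
    by meas.
    by move=> y _; exact: mule_ge0.
  rewrite [RHS](@ge0_integral_lebesgue_affine _ 1 (u * x)) ?oner_eq0//.
  - rewrite normr1 mul1e; apply: eq_integral => z _.
    by rewrite mul1r addrK muleC -muleA -EFinM.
  - by meas.
  - by move=> y; rewrite mule_ge0// EFinM mule_ge0.
have -> : (\int[normal_prob m (Num.sqrt (1 + e) * s)]_y
     \int[normal_prob 0 (Num.sqrt 2 * s)]_x F (y, x) =
   \int[lam]_x \int[lam]_z (F (z, x) * (normal_pdf m (Num.sqrt (1 + e) * s) z * normal_pdf 0 (Num.sqrt 2 * s) x)%:E))%E.
  rewrite ge0_integral_swap//; last by meas.
  rewrite ge0_integral_normal_prob; last 2 first.
    by apply: measurable_ge0_integral => //; meas.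
    by move=> x; exact: integral_ge0.
  apply: eq_integral => x _.
  rewrite ge0_integral_normal_prob//; last by meas.
  rewrite muleC -ge0_integralZl//; last 2 first.
    by meas.
    by move=> y _; exact: mule_ge0.
  by apply: eq_integral => z _; rewrite muleC -muleA -EFinM.
rewrite -ge0_integralZl//; last 2 first.
- apply: measurable_ge0_integral; first by meas.
  by move=> x z; rewrite mule_ge0// EFinM mule_ge0.
- by move=> x _; apply: integral_ge0 => z _; rewrite mule_ge0// EFinM mule_ge0.
apply: ge0_le_integralT.
- apply: measurable_ge0_integral; first by meas.
  by move=> x z; rewrite mule_ge0// EFinM mule_ge0.
- apply: emeasurable_funM => //; apply: measurable_ge0_integral; first by meas.
  by move=> x z; rewrite mule_ge0// EFinM mule_ge0.
- by move=> x; apply: integral_ge0 => z _; rewrite mule_ge0// EFinM mule_ge0.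
- move=> x; rewrite -ge0_integralZl//; last 2 first.
    by meas.
    by move=> z _; rewrite mule_ge0// EFinM mule_ge0.
  apply: ge0_le_integralT.
  + by meas.
  + by meas.
  + by move=> z; rewrite mule_ge0// EFinM mule_ge0.
  + move=> z; rewrite muleCA lee_wpmul2l// -EFinM lee_fin.
    exact: normal_pdf_shear.
Qed.

(** Normal densities are bounded by their peak. The product [0 * x] matches the
    form required by [product_rV_dominated]. *)
Lemma normal_prob_le_lebesgue (m s c : R) (F : RT * RT -> \bar R) :
  s != 0 -> 0 < c -> measurable_fun setT F -> (forall p, (0 <= F p)%E) ->
  (\int[normal_prob m s]_y \int[normal_prob 0 s]_x F (y + 0 * x, c * x)%R <=
   (normal_peak s ^+ 2 / c)%:E * \int[lam]_y \int[lam]_x F (y, x))%E.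
Proof.
move=> s0 c0 mF F0.
have pdf0 (m' s' z : R) : (0 <= (normal_pdf m' s' z)%:E)%E by rewrite lee_fin normal_pdf_ge0.
have P0 : (0 <= (normal_peak s)%:E)%E by rewrite lee_fin normal_peak_ge0.
have bnd m' (G : RT -> \bar R) : measurable_fun setT G -> (forall p, (0 <= G p)%E) ->
    (\int[normal_prob m' s]_x G x <= (normal_peak s)%:E * \int[lam]_x G x)%E.
  move=> mG G0; rewrite ge0_integral_normal_prob// -ge0_integralZl//.
  apply: ge0_le_integralT.
  - by meas.
  - by meas.
  - by move=> x; exact: mule_ge0.
  - by move=> x; rewrite muleC lee_wpmul2r// lee_fin normal_pdf_ub.
under eq_integral do under eq_integral do rewrite mul0r addr0.
have [J JE] : exists J : RT -> \bar R, J = fun y => (\int[lam]_x F (y, x))%E by eexists.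
have mJ : measurable_fun setT J by rewrite JE; apply: measurable_ge0_integral => //; meas.
have J0 y : (0 <= J y)%E by rewrite JE; exact: integral_ge0.
have c'0 : 0 <= c^-1 by rewrite invr_ge0 ltW.
apply: (@le_trans _ _ (\int[normal_prob m s]_y ((normal_peak s / c)%:E * J y))%E).
  apply: ge0_le_integralT.
  - by apply: measurable_ge0_integral => //; meas.
  - by meas.
  - by move=> y; exact: integral_ge0.
  - move=> y; apply: le_trans (bnd _ _ _ _) _ => //; first by meas.
    rewrite EFinM -muleA lee_wpmul2l// JE [in leRHS](@ge0_integral_lebesgue_affine _ c 0)//.
    + rewrite gtr0_norm// muleA -EFinM mulVf ?gt_eqF// mul1e.
      by apply: ge0_le_integralT => [|||x]; rewrite ?addr0//; meas.
    + by rewrite gt_eqF.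
    + by meas.
have Pc : (0 <= (normal_peak s / c)%:E)%E by rewrite lee_fin mulr_ge0 ?normal_peak_ge0.
rewrite ge0_integralZl//; apply: le_trans (lee_wpmul2l Pc (bnd m J mJ J0)) _.
rewrite muleA -EFinM mulrAC -expr2 JE; exact: lexx.
Qed.

End normal_prob_1d.

(** * Moments of the one-dimensional normal law *)

Section normal_moments.
Variable R : realType.
Local Notation RT := (measurableTypeR R).
Local Notation lam := (@lebesgue_measure R).

Lemma is_derive_normal_pdf (s x : R) : s != 0 ->
  is_derive x (1 : R) (normal_pdf 0 s) (- (x / s ^+ 2 * normal_pdf 0 s x)).
Proof.
move=> s0; rewrite normal_pdfE// /normal_fun.
pose c := (s ^+ 2 *+ 2)^-1.
have -> : (fun x0 : R => normal_peak s * expR (- (x0 - 0) ^+ 2 / (s ^+ 2 *+ 2))) =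
    normal_peak s *: (expR \o (fun y : R => - c *: (y ^+ 2))).
  apply/funext => y; rewrite /= subr0; congr (_ * expR _).
  by rewrite /GRing.scale/= !mulNr mulrC.
apply: is_derive_eq.
have -> : - (x - 0) ^+ 2 / (s ^+ 2 *+ 2) = - c *: x ^+ 2.
  by rewrite subr0 /GRing.scale/= !mulNr mulrC.
have cE : c *+ 2 = (s ^+ 2)^-1 by rewrite /c -mulr_natr; field.
by rewrite /GRing.scale/= !mulr1 -cE; ring.
Qed.

Lemma cvg_normal_pdfy (s : R) : s != 0 -> normal_pdf 0 s x @[x --> +oo] --> (0 : R).
Proof.
move=> s0; rewrite normal_pdfE// -[X in _ --> X](mulr0 (normal_peak s)).
apply: cvgMr.
have -> : normal_fun 0 s = @gauss_fun R \o (fun x => x / Num.sqrt (s ^+ 2 *+ 2)).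
  apply/funext => x; rewrite /normal_fun /gauss_fun /= subr0; congr expR.
  by rewrite expr_div_n sqr_sqrtr ?mulNr// mulrn_wge0// sqr_ge0.
apply: (cvg_comp _ _ _ (@cvg_gauss_fun R)).
apply: gt0_cvgMly => //.
by rewrite invr_gt0 sqrtr_gt0 pmulrn_lgt0// exprn_even_gt0.
Qed.

(** The integrand is minus the derivative of the density. *)
Lemma integral_normal_pdf_tail (s y : R) : s != 0 -> 0 <= y ->
  (\int[lam]_(x in `[y, +oo[) (x / s ^+ 2 * normal_pdf 0 s x)%:E =
   (normal_pdf 0 s y)%:E)%E.
Proof.
move=> s0 y0.
have s2 : 0 < s ^+ 2 by rewrite exprn_even_gt0.
have cpdf : continuous (normal_pdf 0 s) by exact: continuous_normal_pdf.
rewrite (@ge0_continuous_FTC2y R _ (fun x => - normal_pdf 0 s x) y 0).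
- by rewrite sub0e EFinN oppeK.
- move=> x yx; rewrite mulr_ge0 ?normal_pdf_ge0// divr_ge0 ?(le_trans y0 yx)//.
  exact: ltW.
- apply: continuous_subspaceT => x; apply: cvgM; last exact: cpdf.
  by apply: cvgM; [exact: cvg_id | exact: cvg_cst].
- rewrite -[X in _ --> X]oppr0; apply: cvgN; exact: cvg_normal_pdfy.
- by move=> x _; apply: derivableN; have [] := is_derive_normal_pdf x s0.
- by apply: cvgN; apply: cvg_at_right_filter; exact: cpdf.
- move=> x _; rewrite derive1E deriveN.
    by have [_ ->] := is_derive_normal_pdf x s0; rewrite opprK.
  by have [] := is_derive_normal_pdf x s0.
Qed.

(** Tonelli for [x / s^2] times the density at [x], over the region
    [0 <= y <= x]: integrating in [y] first gives half of the second moment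
    divided by [s^2], and integrating in [x] first gives the density at [y], by
    the tail formula. *)
Lemma normal_prob_second_moment (s : R) : s != 0 ->
  (\int[normal_prob 0 s]_x (x ^+ 2)%:E = (s ^+ 2)%:E)%E.
Proof.
move=> s0.
have s2 : 0 < s ^+ 2 by rewrite exprn_even_gt0.
have cpdf : continuous (normal_pdf 0 s) by exact: continuous_normal_pdf.
have pdfN x : normal_pdf 0 s (- x) = normal_pdf 0 s x.
  by rewrite !normal_pdfE// /normal_fun !subr0 sqrrN.
have pdf0 x : (0 <= (normal_pdf 0 s x)%:E)%E by rewrite lee_fin normal_pdf_ge0.
pose f x := x ^+ 2 / s ^+ 2 * normal_pdf 0 s x.
have f0 x : 0 <= f x by rewrite /f mulr_ge0 ?normal_pdf_ge0// divr_ge0 ?sqr_ge0.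
have f0E x : (0 <= (f x)%:E)%E by rewrite lee_fin.
have cf : continuous f.
  move=> x; apply: cvgM; last exact: cpdf.
  by apply: cvgM; [exact: sqr_continuous | exact: cvg_cst].
have itvE : [set x : R | 0 <= x] = `[0, +oo[%classic.
  by apply/seteqP; split => x/=; rewrite in_itv/= andbT.
suff E : (\int[lam]_x (f x)%:E = 1)%E.
  rewrite ge0_integral_normal_prob//; last 2 first.
    by meas.
    by move=> x; rewrite lee_fin sqr_ge0.
  transitivity ((s ^+ 2)%:E * \int[lam]_x (f x)%:E)%E; last by rewrite E mule1.
  rewrite -ge0_integralZl//; last 2 first.
    by apply/measurable_EFinP; exact: continuous_measurable_fun.
    by rewrite lee_fin ltW.
  by apply: eq_integral => x _; rewrite -!EFinM /f; congr EFin; field.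
pose h (x y : RT) : \bar R := (x / s ^+ 2 * normal_pdf 0 s x * \1_[set p : RT * RT | 0 <= p.2 <= p.1] (x, y))%:E.
have mI : measurable [set p : RT * RT | 0 <= p.2 <= p.1].
  rewrite (_ : [set _ | _] = [set p : RT * RT | 0 <= p.2] `&` [set p : RT * RT | p.2 <= p.1]); last first.
    by apply/seteqP; split => p /=; [move/andP|move=> [-> ->]].
  apply: measurableI.
    rewrite -[X in measurable X]setTI; apply: measurable_fun_le => //; meas.
  rewrite -[X in measurable X]setTI; apply: measurable_fun_le => //; meas.
have h0 x y : (0 <= h x y)%E.
  rewrite lee_fin indicE; case: (boolP (_ \in _)); last by rewrite mulr0.
  rewrite inE/= => /andP[y0 yx]; rewrite mulr1 mulr_ge0 ?normal_pdf_ge0//.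
  by rewrite divr_ge0 ?(le_trans y0 yx)// ltW.
have mh : measurable_fun setT (fun p : RT * RT => h p.1 p.2).
  rewrite /h; apply/measurable_EFinP; apply: measurable_funM; first by meas.
  by under eq_fun do rewrite -surjective_pairing; exact: measurable_indic.
have hx x : (\int[lam]_y h x y = (if (0 <= x)%R then f x else 0)%:E)%E.
  case: ifPn => x0.
    rewrite (_ : (fun y => _) = fun y => ((x / s ^+ 2 * normal_pdf 0 s x)%:E * (\1_`[0, x] y)%:E)%E).
      rewrite ge0_integralZl//; last 2 first.
        by apply/measurable_EFinP; exact: measurable_indic.
        by rewrite lee_fin mulr_ge0 ?normal_pdf_ge0// divr_ge0// ltW.
      rewrite integral_indic//= setIT lebesgue_measure_itv/= lte_fin.
      have [x1|x1] := ltP 0 x; last first.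
        have -> : x = 0 by apply/le_anti/andP.
        by rewrite mul0r mul0r mul0e /f expr0n/= !mul0r.
      by rewrite sube0 -EFinM /f; congr EFin; ring.
    apply/funext => y; rewrite /h EFinM !indicE.
    rewrite (_ : ((x, y) \in _) = (y \in `[0, x]%classic))//.
  rewrite integral0_eq// => y _; rewrite /h indicE.
  rewrite (_ : _ \in _ = false) ?mulr0//; apply/negbTE/negP; rewrite inE/= => /andP[y0 yx].
  by rewrite (le_trans y0 yx) in x0.
have hy y : (\int[lam]_x h x y = (if (0 <= y)%R then normal_pdf 0 s y else 0)%:E)%E.
  case: ifPn => y0.
    rewrite -(integral_normal_pdf_tail s0 y0) [RHS]integral_mkcond.
    apply: eq_integral => x _; rewrite /h patchE indicE.
    case: ifPn => yx.
      rewrite (_ : _ \in _ = true) ?mulr1//; apply/idP; rewrite inE/=.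
      by move: yx; rewrite inE/= in_itv/= andbT y0.
    rewrite (_ : _ \in _ = false) ?mulr0//; apply/negbTE; apply: contra yx.
    by rewrite !inE/= in_itv/= andbT => /andP[].
  rewrite integral0_eq// => x _; rewrite /h indicE.
  by rewrite (_ : _ \in _ = false) ?mulr0//; apply/negbTE/negP; rewrite inE/= (negbTE y0).
have half (g : R -> R) : (\int[lam]_x (if (0 <= x)%R then g x else 0)%:E =
    \int[lam]_(x in [set x | (0 <= x)%R]) (g x)%:E)%E.
  rewrite [RHS]integral_mkcond; apply: eq_integral => x _.
  rewrite patchE; case: ifPn => x0; first by rewrite mem_set.
  by rewrite memNset//; exact/negP.
have S := ge0_integral_swap lam lam mh h0.
rewrite (eq_integral _ _ (fun x _ => hx x)) (eq_integral _ _ (fun x _ => hy x)) !half in S.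
rewrite ge0_symfun_integralT//; last first.
  by move=> x; rewrite /f /= sqrrN pdfN.
rewrite S -ge0_symfun_integralT//.
- exact: integral_normal_pdf.
- by move=> x; rewrite /= pdfN.
Qed.

End normal_moments.

Section fourth_moment.
Variable R : realType.
Local Notation RT := (measurableTypeR R).
Local Notation lam := (@lebesgue_measure R).

Lemma sqr_expRN_le (v : R) : 0 <= v -> v ^+ 2 * expR (- v) <= 8 * expR (- v / 4).
Proof.
move=> v0.
(* The share 3/8 leaves the exponent -v/4 once expR (3/8 v) is squared. *)
have -> : - v / 4 = - v + (3 / 8 * v) * 2%:R by field.
rewrite expRD expRM_natr.
have : (3 / 8 * v) ^+ 2 <= expR (3 / 8 * v) ^+ 2.
  rewrite lerXn2r ?nnegrE ?expR_ge0//; first by rewrite mulr_ge0.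
  by apply: le_trans (expR_ge1Dx _); rewrite lerDr.
have := expR_gt0 (- v); move: (expR (- v)) (expR (3 / 8 * v)) => a b a0 h.
have h2 : v ^+ 2 <= 8 * b ^+ 2 by nra.
rewrite [leRHS](_ : _ = 8 * b ^+ 2 * a); last by ring.
by rewrite ler_wpM2r// ltW.
Qed.

(** Doubling the standard deviation absorbs a fourth power, so that the fourth
    moment is bounded by a combination of total masses. *)
Lemma normal_pdf_fourth_le (m s : R) : s != 0 ->
  exists2 c : R * R, (0 <= c.1) /\ (0 <= c.2) &
  forall x, x ^+ 4 * normal_pdf m s x <=
    c.1 * normal_pdf m (2 * s) x + c.2 * normal_pdf m s x.
Proof.
move=> s0; exists (8 * (8 * (8 * s ^+ 4)), 8 * m ^+ 4).
  have s4 : 0 <= s ^+ 4 by rewrite exprn_even_ge0.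
  have m4 : 0 <= m ^+ 4 by rewrite exprn_even_ge0.
  by split; do !apply: mulr_ge0 => //.
move=> x /=; have t0 : 2 * s != 0 by rewrite mulf_neq0.
have s2 : 0 < s ^+ 2 by rewrite exprn_even_gt0.
have pdf0 : 0 <= normal_pdf m s x by exact: normal_pdf_ge0.
pose v := (x - m) ^+ 2 / (s ^+ 2 * 2).
have v0 : 0 <= v by rewrite divr_ge0 ?sqr_ge0// mulr_ge0// ltW.
have key : (x - m) ^+ 4 * normal_pdf m s x <= 8 * (8 * s ^+ 4) * normal_pdf m (2 * s) x.
  have M2 (a : R) : a *+ 2 = a * 2 by rewrite mulr_natr.
  rewrite !normal_pdfE// /normal_fun !(M2 (_ ^+ 2)).
  have -> : - (x - m) ^+ 2 / (s ^+ 2 * 2) = - v by rewrite /v mulNr.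
  have -> : - (x - m) ^+ 2 / ((2 * s) ^+ 2 * 2) = - v / 4 by rewrite /v; field.
  have -> : normal_peak (2 * s) = normal_peak s / 2.
    rewrite /normal_peak (_ : (2 * s) ^+ 2 * pi *+ 2 = 2 ^+ 2 * (s ^+ 2 * pi *+ 2)); last first.
      by rewrite exprMn -mulrA mulrnAr.
    by rewrite sqrtrM ?sqr_ge0// sqrtr_sqr ger0_norm// invfM mulrC.
  have -> : (x - m) ^+ 4 = 4 * s ^+ 4 * v ^+ 2 by rewrite /v; field.
  have := sqr_expRN_le v0; have := normal_peak_ge0 s.
  move: (normal_peak s) (expR (- v)) (expR (- v / 4)) => p a b p0 h.
  rewrite [leLHS](_ : _ = (4 * s ^+ 4 * p) * (v ^+ 2 * a)); last by ring.
  rewrite [leRHS](_ : _ = (4 * s ^+ 4 * p) * (8 * b)); last by field.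
  by rewrite ler_wpM2l// mulr_ge0// mulr_ge0// exprn_even_ge0.
have h4 : x ^+ 4 <= 8 * (x - m) ^+ 4 + 8 * m ^+ 4.
  rewrite -{1}(subrK m x); move: (x - m) => z.
  have h2 : (z + m) ^+ 2 <= 2 * (z ^+ 2 + m ^+ 2).
    by rewrite -subr_ge0 (_ : _ - _ = (z - m) ^+ 2) ?sqr_ge0//; ring.
  have h3 : (z ^+ 2 + m ^+ 2) ^+ 2 <= 2 * (z ^+ 4 + m ^+ 4).
    by rewrite -subr_ge0 (_ : _ - _ = (z ^+ 2 - m ^+ 2) ^+ 2) ?sqr_ge0//; ring.
  have : (z + m) ^+ 2 ^+ 2 <= (2 * (z ^+ 2 + m ^+ 2)) ^+ 2.
    by rewrite lerXn2r// ?nnegrE ?sqr_ge0// mulr_ge0// addr_ge0 ?sqr_ge0.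
  by rewrite -exprM exprMn; lra.
apply: (@le_trans _ _ ((8 * (x - m) ^+ 4 + 8 * m ^+ 4) * normal_pdf m s x)).
  by rewrite ler_wpM2r.
rewrite mulrDl lerD2r -mulrA.
rewrite [leRHS](_ : _ = 8 * (8 * (8 * s ^+ 4) * normal_pdf m (2 * s) x)) ?mulrA//.
by rewrite -!mulrA in key *; apply: ler_wpM2l.
Qed.

Lemma normal_prob_fourth_moment (m s : R) : s != 0 ->
  (\int[normal_prob m s]_x (x ^+ 4)%:E < +oo)%E.
Proof.
move=> s0.
have pdf0 s' x : 0 <= normal_pdf m s' x by exact: normal_pdf_ge0.
have [[c1 c2] /= [c10 c20] fourth_le] := normal_pdf_fourth_le m s0.
rewrite ge0_integral_normal_prob; last 2 first.
  by meas.
  by move=> x; rewrite lee_fin exprn_even_ge0.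
apply: (@le_lt_trans _ _ (\int[lam]_x (c1%:E * (normal_pdf m (2 * s) x)%:E
    + c2%:E * (normal_pdf m s x)%:E))%E).
  apply: ge0_le_integralT.
  - by meas.
  - by meas.
  - by move=> x; rewrite -EFinM lee_fin mulr_ge0// exprn_even_ge0.
  - move=> x; rewrite -!EFinM -EFinD lee_fin; exact: fourth_le.
rewrite ge0_integralD//; last 4 first.
- by move=> x _; rewrite -EFinM lee_fin mulr_ge0.
- by meas.
- by move=> x _; rewrite -EFinM lee_fin mulr_ge0.
- by meas.
rewrite !ge0_integralZl//; try by [meas | move=> x _; rewrite lee_fin].
by rewrite !integral_normal_pdf !mule1 -EFinD ltry.
Qed.

End fourth_moment.

(** * Marginals and symmetries of product laws *)

Section product_rV_theory.
Variable R : realType.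
Local Notation RT := (measurableTypeR R).
Local Open Scope ereal_scope.

Lemma product_rV_setT n (m : 'I_n -> {sigma_finite_measure set RT -> \bar R}) :
  (forall i, m i setT = 1) -> product_rV m setT = 1.
Proof.
move=> m1; have := product_rV_box m (A := fun=> setT) (fun=> measurableT).
rewrite (_ : [set _ | _] = setT); last by apply/seteqP; split.
by move=> ->; rewrite big1.
Qed.

Lemma product_rV_marginal n (m : 'I_n -> {sigma_finite_measure set RT -> \bar R})
    (i : 'I_n) (F : RT -> \bar R) : (forall j, m j setT = 1) ->
  measurable_fun setT F -> (forall x, 0 <= F x) ->
  \int[product_rV m]_v F (v 0%R i) = \int[m i]_x F x.
Proof.
move=> m1 mF F0.
have mi : measurable_fun setT (fun v : 'rV[R]_n => v 0%R i : RT).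
  exact: (@measurable_entry R 1 n).
transitivity (\int[pushforward (product_rV m) (fun v : 'rV[R]_n => v 0%R i : RT)]_x F x).
  by rewrite ge0_integral_pushforward.
apply: (@eq_measure_integral _ _ _ _ _ (pushforward (product_rV m) (fun v : 'rV[R]_n => v 0%R i : RT))).
move=> A mA _; rewrite /pushforward.
have mA' (j : 'I_n) : measurable (if j == i then A else setT) by case: ifP.
transitivity (product_rV m [set v : 'rV[R]_n | forall j, (if j == i then A else setT) (v 0%R j)]).
  congr (product_rV m _); apply/seteqP; split => v /=; last by move/(_ i); rewrite eqxx.
  by move=> Av j; case: eqP => // ->.
rewrite (product_rV_box m mA').
rewrite (bigD1 i)//= eqxx big1 ?mule1// => j ji.
by rewrite (negbTE ji).
Qed.

Lemma cons_rV_ord0 n x (v : 'rV[R]_n) : cons_rV (x : RT, v) 0%R ord0 = x.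
Proof. by rewrite -[RHS]/((x : RT, v).1) -[in RHS](cons_rVK (x : RT, v)). Qed.

Lemma cons_rV_lift n x (v : 'rV[R]_n) i :
  cons_rV (x : RT, v) 0%R (lift ord0 i) = v 0%R i.
Proof.
rewrite /cons_rV mxE; case: splitP => k; first by rewrite (ord1 k).
by rewrite /= /bump/= => -[] /val_inj ->.
Qed.

Lemma product_rV_coordinatewise_invariant n
   (m : 'I_n -> {sigma_finite_measure set RT -> \bar R}) (phi : 'I_n -> RT -> RT) :
  (forall i, measurable_fun setT (phi i)) ->
  (forall i (F : RT -> \bar R), measurable_fun setT F -> (forall x, 0 <= F x) ->
     \int[m i]_x F (phi i x) = \int[m i]_x F x) ->
  forall F : 'rV[R]_n -> \bar R, measurable_fun setT F -> (forall x, 0 <= F x) ->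
    \int[product_rV m]_v F (\row_i phi i (v 0%R i)) = \int[product_rV m]_v F v.
Proof.
elim: n m phi => [|n IH] m phi mphi H F mF F0.
  by apply: eq_integral => v _; rewrite (thinmx0 (\row_i _)) [in RHS](thinmx0 v).
have mrow (d : measure_display) (T : measurableType d) p (f : T -> 'rV[R]_p) (psi : 'I_p -> RT -> RT) :
    (forall i, measurable_fun setT (psi i)) -> measurable_fun setT f ->
    measurable_fun setT (fun t => \row_i psi i (f t 0%R i) : 'rV[R]_p).
  move=> mpsi mf; apply/measurable_fun_matrixP => k j.
  under eq_fun do rewrite mxE.
  by apply: (measurableT_comp (mpsi j)); meas.
have E x (v : 'rV[R]_n) : (\row_i phi i (cons_rV (x : RT, v) 0 i) =
    cons_rV (phi ord0 x, \row_i phi (lift ord0 i) (v 0 i)))%R.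
  apply/rowP => i; rewrite mxE; have [j ->|->] := unliftP ord0 i.
    by rewrite !cons_rV_lift mxE.
  by rewrite !cons_rV_ord0.
rewrite !ge0_integral_cons_measure//; last first.
  by apply: (measurableT_comp mF); apply: mrow => //; exact: measurable_id.
transitivity (\int[m ord0]_x \int[product_rV (fun i => m (lift ord0 i))]_v F (cons_rV (phi ord0 x, v))).
  apply: eq_integral => x _.
  under eq_integral do rewrite E.
  apply: (IH (fun i => m (lift ord0 i)) (fun i => phi (lift ord0 i)) _ _ (fun v => F (cons_rV (phi ord0 x, v)))) => //.
    by move=> i; exact: H.
  by meas.
apply: (H ord0 (fun x => \int[product_rV (fun i => m (lift ord0 i))]_v F (cons_rV (x, v)))).
  by apply: measurable_ge0_integral => //; meas.
by move=> x; exact: integral_ge0.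
Qed.

(** The map exchanges the positive and the negative part of [f], which therefore
    have the same integral. *)
Lemma integral_odd_eq0 d (T : measurableType d) (m : {measure set T -> \bar R})
    (phi : T -> T) (f : T -> R) :
  (forall F : T -> \bar R, measurable_fun setT F -> (forall x, 0 <= F x) ->
    \int[m]_x F (phi x) = \int[m]_x F x) ->
  (forall x, f (phi x) = - f x)%R ->
  m.-integrable setT (EFin \o f) -> \int[m]_x (f x)%:E = 0.
Proof.
move=> H fphi intf; rewrite integralE.
have mf := measurable_int _ intf.
have E : (EFin \o f)^\- = (EFin \o f)^\+ \o phi.
  by apply/funext => x; rewrite funenegE /= funeposE /= fphi EFinN.
have -> : \int[m]_x (fun x => (f x)%:E)^\- x = \int[m]_x (fun x => (f x)%:E)^\+ x.
  rewrite [LHS](eq_integral (((EFin \o f)^\+) \o phi)); last by move=> x _; rewrite -E.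
  by apply: H => //; exact: measurable_funepos.
by rewrite subee// integrable_pos_fin_num.
Qed.

End product_rV_theory.

(** * Euclidean inequalities *)

Section finite_sums.
Variable R : realType.

(** Lagrange's identity. *)
Lemma cauchy_schwarz_sum (I : finType) (a b : I -> R) :
  (\sum_i a i * b i) ^+ 2 <= (\sum_i a i ^+ 2) * (\sum_i b i ^+ 2).
Proof.
have H : 0 <= \sum_i \sum_j (a i * b j - a j * b i) ^+ 2.
  by apply: sumr_ge0 => i _; apply: sumr_ge0 => j _; exact: sqr_ge0.
have E : \sum_i \sum_j (a i * b j - a j * b i) ^+ 2 =
    ((\sum_i a i ^+ 2) * (\sum_i b i ^+ 2) - (\sum_i a i * b i) ^+ 2) *+ 2.
  have E1 : (\sum_i a i ^+ 2) * (\sum_i b i ^+ 2) = \sum_i \sum_j (a i ^+ 2 * b j ^+ 2).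
    by rewrite big_distrlr.
  have E2 : (\sum_i a i * b i) ^+ 2 = \sum_i \sum_j (a i * b i * (a j * b j)).
    by rewrite expr2 big_distrlr.
  have E3 : \sum_i \sum_j (a i ^+ 2 * b j ^+ 2) = \sum_i \sum_j (a j ^+ 2 * b i ^+ 2).
    exact: exchange_big.
  rewrite E1 E2 mulr2n {2}E3 -!sumrB -big_split/=.
  apply: eq_bigr => i _; rewrite -!sumrB -big_split/=.
  by apply: eq_bigr => j _; ring.
by rewrite E pmulrn_lge0// subr_ge0 in H.
Qed.

Lemma sqr_sum_le (I : finType) (a : I -> R) :
  (\sum_i a i) ^+ 2 <= #|I|%:R * \sum_i a i ^+ 2.
Proof.
have := cauchy_schwarz_sum (fun=> 1) a.
rewrite (_ : \sum_i 1 * a i = \sum_i a i); last by apply: eq_bigr => i _; rewrite mul1r.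
by rewrite (_ : \sum_(i : I) 1 ^+ 2 = #|I|%:R :> R)// expr1n sumr_const.
Qed.

End finite_sums.

Section euclidean.
Variables (R : realType) (n : nat).
Implicit Types u v w : 'rV[R]_n.

Lemma dot_rV_ge0 v : 0 <= dot_rV v v.
Proof. by apply: sumr_ge0 => i _; rewrite -expr2 sqr_ge0. Qed.

Lemma norm2_ge0 v : 0 <= norm2 v. Proof. exact: sqrtr_ge0. Qed.

Lemma norm2_sqr v : norm2 v ^+ 2 = dot_rV v v.
Proof. by rewrite sqr_sqrtr// dot_rV_ge0. Qed.

Lemma norm2_sqrE v : norm2 v ^+ 2 = \sum_i v 0 i ^+ 2.
Proof. by rewrite norm2_sqr; apply: eq_bigr => i _; rewrite expr2. Qed.

Lemma normF_sqrE m (A : 'M[R]_(m, n)) : normF A ^+ 2 = \sum_i norm2 (row i A) ^+ 2.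
Proof.
rewrite sqr_sqrtr; last by apply: sumr_ge0 => i _; apply: sumr_ge0 => j _; exact: sqr_ge0.
by apply: eq_bigr => i _; rewrite norm2_sqrE; apply: eq_bigr => j _; rewrite mxE.
Qed.

Lemma dot_rV_sqr_le u v : dot_rV u v ^+ 2 <= norm2 u ^+ 2 * norm2 v ^+ 2.
Proof. by rewrite !norm2_sqrE; exact: cauchy_schwarz_sum. Qed.

Lemma dot_rVDl u v w : dot_rV (u + v) w = dot_rV u w + dot_rV v w.
Proof. by rewrite -big_split/=; apply: eq_bigr => i _; rewrite mxE mulrDl. Qed.

Lemma dot_rVC u v : dot_rV u v = dot_rV v u.
Proof. by apply: eq_bigr => i _; rewrite mulrC. Qed.

Lemma dot_rVDr u v w : dot_rV u (v + w) = dot_rV u v + dot_rV u w.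
Proof. by rewrite dot_rVC dot_rVDl !(dot_rVC u). Qed.

Lemma dot_rVZl a u v : dot_rV (a *: u) v = a * dot_rV u v.
Proof. by rewrite mulr_sumr; apply: eq_bigr => i _; rewrite mxE mulrA. Qed.

Lemma dot_rVZr a u v : dot_rV u (a *: v) = a * dot_rV u v.
Proof. by rewrite dot_rVC dot_rVZl dot_rVC. Qed.

Lemma dot_rVNr u v : dot_rV u (- v) = - dot_rV u v.
Proof. by rewrite -scaleN1r dot_rVZr mulN1r. Qed.

Lemma dot_rV_suml I (s : seq I) (f : I -> 'rV[R]_n) v :
  dot_rV (\sum_(i <- s) f i) v = \sum_(i <- s) dot_rV (f i) v.
Proof.
elim: s => [|i s IH]; last by rewrite !big_cons dot_rVDl IH.
by rewrite !big_nil /dot_rV big1// => i _; rewrite mxE mul0r.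
Qed.

Lemma dot_rV_sumr I (s : seq I) (f : I -> 'rV[R]_n) v :
  dot_rV v (\sum_(i <- s) f i) = \sum_(i <- s) dot_rV v (f i).
Proof. by rewrite dot_rVC dot_rV_suml; apply: eq_bigr => i _; rewrite dot_rVC. Qed.

Lemma coord_sqr_le v i : v 0 i ^+ 2 <= norm2 v ^+ 2.
Proof.
rewrite norm2_sqrE (bigD1 i)//= lerDl.
by apply: sumr_ge0 => j _; exact: sqr_ge0.
Qed.

Lemma norm2D_pow4_le u v : norm2 (u + v) ^+ 4 <= 8 * (norm2 u ^+ 4 + norm2 v ^+ 4).
Proof.
have h : norm2 (u + v) ^+ 2 <= 2 * (norm2 u ^+ 2 + norm2 v ^+ 2).
  rewrite !norm2_sqrE -big_split/= mulr_sumr; apply: ler_sum => i _.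
  rewrite mxE -subr_ge0.
  by rewrite (_ : _ - _ = (u 0 i - v 0 i) ^+ 2) ?sqr_ge0//; ring.
have : (norm2 (u + v) ^+ 2) ^+ 2 <= (2 * (norm2 u ^+ 2 + norm2 v ^+ 2)) ^+ 2.
  by rewrite lerXn2r// ?nnegrE ?sqr_ge0// mulr_ge0// addr_ge0// sqr_ge0.
have : (norm2 u ^+ 2 + norm2 v ^+ 2) ^+ 2 <= 2 * (norm2 u ^+ 4 + norm2 v ^+ 4).
  rewrite -subr_ge0.
  by rewrite (_ : _ - _ = (norm2 u ^+ 2 - norm2 v ^+ 2) ^+ 2) ?sqr_ge0//; ring.
by rewrite -exprM exprMn; lra.
Qed.

End euclidean.

(** * The normal law on row vectors *)

Section normal_rV_theory.
Variables (R : realType) (n : nat).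
Implicit Types mu : 'rV[R]_n.
Local Notation RT := (measurableTypeR R).
Local Open Scope ereal_scope.

Lemma normal_rV_setT mu s : normal_rV mu s setT = 1.
Proof. by apply: product_rV_setT => i; exact: probability_setT. Qed.

Lemma normal_rV_marginal mu s i (F : RT -> \bar R) :
  measurable_fun setT F -> (forall x, 0 <= F x) ->
  \int[normal_rV mu s]_v F (v 0%R i) = \int[normal_prob (mu 0%R i) s]_x F x.
Proof. by apply: product_rV_marginal => j; exact: probability_setT. Qed.

Lemma normal_rV_norm2_pow4 mu s : (s != 0)%R ->
  \int[normal_rV mu s]_v (norm2 v ^+ 4)%:E < +oo.
Proof.
move=> s0.
apply: (@le_lt_trans _ _ (\int[normal_rV mu s]_v
   (n%:R%:E * \sum_(i < n) (v 0%R i ^+ 4)%:E))).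
  apply: ge0_le_integralT.
  - by meas.
  - by meas.
  - by move=> v; rewrite lee_fin exprn_ge0// norm2_ge0.
  - move=> v; rewrite sumEFin -EFinM lee_fin.
    rewrite (exprM _ 2 2) norm2_sqrE; apply: le_trans (sqr_sum_le _) _.
    by rewrite card_ord; under eq_bigr do rewrite -exprM.
rewrite ge0_integralZl//; last 2 first.
  by meas.
  by move=> v _; apply: sume_ge0 => i _; rewrite lee_fin exprn_even_ge0.
rewrite lte_mul_pinfty// ge0_integral_sum//; last 2 first.
  by move=> i; meas.
  by move=> i v _; rewrite lee_fin exprn_even_ge0.
apply/lte_sum_pinfty => i _.
rewrite (normal_rV_marginal mu s i (F := fun x => (x ^+ 4)%:E)).
- exact: normal_prob_fourth_moment.
- by meas.
- by move=> x; rewrite lee_fin exprn_even_ge0.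
Qed.

Lemma normal_rV_integrable mu s (f : 'rV[R]_n -> R) : (s != 0)%R ->
  measurable_fun setT f -> (forall v, `|f v| <= 1 + norm2 v ^+ 4)%R ->
  (normal_rV mu s).-integrable setT (EFin \o f).
Proof.
move=> s0 mf fle; apply/integrableP; split; first exact/measurable_EFinP.
apply: (@le_lt_trans _ _ (\int[normal_rV mu s]_v (1 + norm2 v ^+ 4)%:E)).
  apply: ge0_le_integralT => //.
  - by apply: measurableT_comp => //; exact/measurable_EFinP.
  - by meas.
under eq_integral do rewrite EFinD.
rewrite ge0_integralD//; last 2 first.
  by move=> v _; rewrite lee_fin exprn_ge0// norm2_ge0.
  by meas.
have -> : \int[normal_rV mu s]_v 1%:E = 1.
  by rewrite integral_cst// mul1e; exact: normal_rV_setT.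
rewrite lte_add_pinfty ?ltry//.
exact: normal_rV_norm2_pow4.
Qed.

Lemma normal_rV_second_moment s i : (s != 0)%R ->
  \int[normal_rV (0 : 'rV[R]_n) s]_v (v 0%R i ^+ 2)%:E = (s ^+ 2)%:E.
Proof.
move=> s0; rewrite (normal_rV_marginal 0 s i (F := fun x => (x ^+ 2)%:E)).
- by rewrite mxE normal_prob_second_moment.
- by meas.
- by move=> x; rewrite lee_fin sqr_ge0.
Qed.

Definition flip_coord (i : 'I_n) (v : 'rV[R]_n) : 'rV[R]_n :=
  \row_j (if j == i then - v 0 j else v 0 j)%R.

Lemma normal_rV_flip s i (F : 'rV[R]_n -> \bar R) : (s != 0)%R ->
  measurable_fun setT F -> (forall v, 0 <= F v) ->
  \int[normal_rV 0 s]_v F (flip_coord i v) = \int[normal_rV 0 s]_v F v.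
Proof.
move=> s0 mF F0.
pose phi (j : 'I_n) (x : RT) : RT := if j == i then (- x)%R else x.
apply: (@product_rV_coordinatewise_invariant _ _ _ phi) => //.
  by move=> j; rewrite /phi; case: (j == i); meas.
move=> j G mG G0; rewrite /phi; case: (j == i) => //.
by rewrite !mxE ge0_integral_normal_probN.
Qed.

Lemma normal_rV_mean0 s i : (s != 0)%R ->
  \int[normal_rV (0 : 'rV[R]_n) s]_v (v 0%R i)%:E = 0.
Proof.
move=> s0; apply: (@integral_odd_eq0 _ _ _ _ (flip_coord i)).
- by move=> F mF F0; exact: normal_rV_flip.
- by move=> v; rewrite mxE eqxx.
- apply: normal_rV_integrable => //; first by meas.
  move=> v; have := coord_sqr_le v i; have := sqr_ge0 (norm2 v ^+ 2 - 1).
  rewrite (exprM _ 2 2); move: (norm2 v ^+ 2)%R (v 0%R i) => N x h1 h2.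
  rewrite ler_norml; apply/andP; split; nra.
Qed.

Lemma normal_rV_uncorrelated s i j : (s != 0)%R -> i != j ->
  \int[normal_rV (0 : 'rV[R]_n) s]_v (v 0%R i * v 0%R j)%:E = 0.
Proof.
move=> s0 ij; apply: (@integral_odd_eq0 _ _ _ _ (flip_coord i)).
- by move=> F mF F0; exact: normal_rV_flip.
- by move=> v; rewrite !mxE eqxx eq_sym (negbTE ij) mulNr.
- apply: normal_rV_integrable => //; first by meas.
  move=> v; have := coord_sqr_le v i; have := coord_sqr_le v j.
  have := sqr_ge0 (norm2 v ^+ 2 - 1).
  rewrite (exprM _ 2 2); move: (norm2 v ^+ 2)%R (v 0%R i) (v 0%R j) => N x y h1 h2 h3.
  have := sqr_ge0 (x - y); have := sqr_ge0 (x + y).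
  rewrite ler_norml => h4 h5; apply/andP; split; nra.
Qed.

(** The vectors [Y + u omega] and [omega] are dependent; up to a constant factor
    they may be treated as independent normal vectors of larger variance. This
    is how a moment assumption at the variance [(1 + e) s^2] controls maps
    evaluated at the perturbed signal. *)
Lemma normal_rV_shear_dominated mu s e u (F : 'rV[R]_n * 'rV[R]_n -> \bar R) :
  (s != 0)%R -> (0 < e)%R -> (u ^+ 2 <= e / 2)%R ->
  measurable_fun setT F -> (forall p, 0 <= F p) ->
  \int[normal_rV mu s]_y \int[normal_rV 0 s]_x F (y + u *: x, x)%R <=
  (shear_cst s e ^+ n)%:E *
    \int[normal_rV mu (Num.sqrt (1 + e) * s)]_y
      \int[normal_rV 0 (Num.sqrt 2 * s)]_x F (y, x).
Proof.
move=> s0 e0 ue mF F0.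
have H i (G : RT * RT -> \bar R) (mG : measurable_fun setT G) (G0 : forall p, 0 <= G p) :
    \int[normal_prob (mu 0%R i) s]_y \int[normal_prob ((0 : 'rV[R]_n) 0%R i) s]_x G (y + u * x, 1 * x)%R <=
    (shear_cst s e)%:E * \int[normal_prob (mu 0%R i) (Num.sqrt (1 + e) * s)]_y
      \int[normal_prob ((0 : 'rV[R]_n) 0%R i) (Num.sqrt 2 * s)]_x G (y, x).
  by rewrite mxE; exact: normal_prob_shear_dominated.
have := product_rV_dominated (shear_cst_ge0 s e) H mF F0.
by under eq_integral do under eq_integral do rewrite scale1r.
Qed.

(** Weak differentiability is an almost-everywhere identity for Lebesgue measure;
    this carries it over to the pair [(Y, c omega)]. *)
Lemma normal_rV_null_set mu s c (N : set ('rV[R]_n * 'rV[R]_n)) :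
  (s != 0)%R -> (0 < c)%R -> measurable N ->
  (lebesgue_rV R n \x lebesgue_rV R n) N = 0 ->
  \int[normal_rV mu s]_y \int[normal_rV 0 s]_x (\1_N (y, c *: x)%R)%:E = 0.
Proof.
move=> s0 c0 mN N0.
have mF : measurable_fun setT (EFin \o \1_N : 'rV[R]_n * 'rV[R]_n -> \bar R).
  by apply/measurable_EFinP; exact: measurable_indic.
have F0 p : 0 <= (EFin \o \1_N : 'rV[R]_n * 'rV[R]_n -> \bar R) p by rewrite lee_fin.
apply/eqP; rewrite eq_le; apply/andP; split; last first.
  by apply: integral_ge0 => y _; apply: integral_ge0 => x _; rewrite lee_fin.
have H i (G : RT * RT -> \bar R) (mG : measurable_fun setT G) (G0 : forall p, 0 <= G p) :
    \int[normal_prob (mu 0%R i) s]_y \int[normal_prob ((0 : 'rV[R]_n) 0%R i) s]_x G (y + 0 * x, c * x)%R <=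
    (normal_peak s ^+ 2 / c)%:E * \int[@lebesgue_measure R]_y \int[@lebesgue_measure R]_x G (y, x).
  by rewrite mxE; exact: normal_prob_le_lebesgue.
have C0 : (0 <= normal_peak s ^+ 2 / c)%R by rewrite divr_ge0 ?sqr_ge0 ?ltW.
have := product_rV_dominated C0 H mF F0.
under eq_integral do under eq_integral do rewrite scale0r addr0.
move=> /le_trans; apply.
rewrite -(ge0_integral_product (lebesgue_rV R n) (lebesgue_rV R n) mF F0).
rewrite (_ : \int[_]_p _ = 0) ?mule0//.
by rewrite integral_indic// setIT; exact: N0.
Qed.

End normal_rV_theory.

(** * Increments of weakly differentiable maps *)

Lemma ge0_integral_rotate d1 d2 d3 (T1 : measurableType d1) (T2 : measurableType d2)
    (T3 : measurableType d3) (R : realType)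
    (m1 : {sigma_finite_measure set T1 -> \bar R})
    (m2 : {sigma_finite_measure set T2 -> \bar R})
    (m3 : {sigma_finite_measure set T3 -> \bar R}) (F : T1 -> T2 -> T3 -> \bar R) :
  measurable_fun setT (fun q : T1 * T2 * T3 => F q.1.1 q.1.2 q.2) ->
  (forall x y t, (0 <= F x y t)%E) ->
  (\int[m1]_x \int[m2]_y \int[m3]_t F x y t =
   \int[m3]_t \int[m1]_x \int[m2]_y F x y t)%E.
Proof.
move=> mF F0.
transitivity (\int[m1]_x \int[m3]_t \int[m2]_y F x y t)%E.
  apply: eq_integral => x _; apply: ge0_integral_swap => //.
  apply: (measurableT_comp mF (f := fun q : T1 * T2 * T3 => F q.1.1 q.1.2 q.2)
    (g := fun p : T2 * T3 => (x, p.1, p.2))).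
  by meas.
apply: ge0_integral_swap => [|x t]; last exact: integral_ge0.
apply: (@measurable_ge0_integral _ _ _ _ _ m2 (fun (p : T1 * T3) y => F p.1 y p.2)) => //.
apply: (measurableT_comp mF (f := fun q : T1 * T2 * T3 => F q.1.1 q.1.2 q.2)
    (g := fun p : (T1 * T3) * T2 => (p.1.1, p.2, p.1.2))).
by meas.
Qed.

Section square_integrable.
Context d (T : measurableType d) (R : realType) (m : {measure set T -> \bar R}).
Local Open Scope ereal_scope.
Variable D : set T.
Hypotheses (mD : measurable D) (m1 : m D = 1).

Lemma integrable_cst_mass1 (k : R) : m.-integrable D (fun=> k%:E).
Proof.
apply/integrableP; split => //; rewrite integral_cst// m1 mule1/=; exact: ltry.
Qed.

Lemma sqr_integrable (g : T -> R) : measurable_fun D g ->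
  \int[m]_(t in D) (g t ^+ 2)%:E < +oo ->
  m.-integrable D (fun t => (g t ^+ 2)%:E) /\ m.-integrable D (fun t => (g t)%:E).
Proof.
move=> mg g2oo.
have mg2 : measurable_fun D (fun t => (g t ^+ 2)%:E).
  by apply/measurable_EFinP; apply: measurable_funX.
have ig2 : m.-integrable D (fun t => (g t ^+ 2)%:E).
  apply/integrableP; split => //.
  by under eq_integral do rewrite gee0_abs ?lee_fin ?sqr_ge0//.
split => //.
apply: (@le_integrable _ _ _ m D mD _ (fun t => 1%:E + (g t ^+ 2)%:E)).
- exact/measurable_EFinP.
- move=> t _; rewrite -EFinD lee_fin [leRHS]ger0_norm ?addr_ge0 ?sqr_ge0//.
  have h1 := sqr_ge0 (g t - 1); have h2 := sqr_ge0 (g t + 1).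
  by rewrite ler_norml; apply/andP; split; nra.
- by apply: integrableD => //; exact: integrable_cst_mass1.
Qed.

(** Jensen for the square, from [2 c g <= g^2 + c^2] with [c] the mean of [g]. *)
Lemma sqr_integral_le (g : T -> R) (c : R) : measurable_fun D g ->
  c%:E = \int[m]_(t in D) (g t)%:E ->
  (c ^+ 2)%:E <= \int[m]_(t in D) (g t ^+ 2)%:E.
Proof.
move=> mg cE.
have [->|gfin] := eqVneq (\int[m]_(t in D) (g t ^+ 2)%:E) +oo; first exact: leey.
have g2oo : \int[m]_(t in D) (g t ^+ 2)%:E < +oo by rewrite ltey.
have [ig2 ig] := sqr_integrable mg g2oo.
have ic : m.-integrable D (fun=> (c ^+ 2)%:E) by exact: integrable_cst_mass1.
have h : \int[m]_(t in D) ((2 * c)%:E * (g t)%:E) <=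
    \int[m]_(t in D) ((g t ^+ 2)%:E + (c ^+ 2)%:E).
  apply: le_integral => //.
  - exact: integrableZl.
  - exact: integrableD.
  - move=> t _; rewrite -EFinM -EFinD lee_fin.
    have := sqr_ge0 (g t - c); nra.
rewrite integralZl// -cE integralD// integral_cst// m1 mule1 in h.
have := integrable_fin_num mD ig2.
move: h; case: (\int[m]_(t in D) (g t ^+ 2)%:E) => [r| |]// h _.
by move: h; rewrite -EFinM -EFinD !lee_fin => h; nra.
Qed.

End square_integrable.

Section smooth_maps.
Variables (R : realType) (n : nat).
Implicit Types mu : 'rV[R]_n.
Local Notation RT := (measurableTypeR R).
Local Notation lam := (@lebesgue_measure R).
Local Open Scope ereal_scope.

Lemma measurable_itv01 : measurable (`[0%R, 1%R]%classic : set RT).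
Proof. exact: measurable_itv. Qed.

Lemma lebesgue_itv01 : lam (`[0%R, 1%R]%classic : set R) = 1.
Proof. by rewrite lebesgue_measure_itv/= lte_fin ltr01 oppr0 adde0. Qed.

(** Jensen over [0, 1] in each coordinate of the gradient identity, then
    Cauchy-Schwarz against each row of the Jacobian. *)
Lemma norm2_increment_le (f : 'rV[R]_n -> 'rV[R]_n) (df : 'rV[R]_n -> 'M[R]_n)
    (y z : 'rV[R]_n) : measurable_fun setT df ->
  (forall i, (f (y + z) 0 i - f y 0 i)%R%:E =
    \int[lam]_(t in `[0%R, 1%R]) (dot_rV z (row i (df (y + t *: z))))%R%:E) ->
  (norm2 (f (y + z) - f y) ^+ 2)%R%:E <=
  \int[lam]_(t in `[0%R, 1%R]) (norm2 z ^+ 2 * normF (df (y + t *: z)) ^+ 2)%R%:E.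
Proof.
move=> mdf fE.
have mrow i : measurable_fun (setT : set RT) (fun t : RT => norm2 (row i (df (y + t *: z))))%R.
  by meas.
rewrite norm2_sqrE.
under [leRHS]eq_integral do rewrite normF_sqrE mulr_sumr -sumEFin.
rewrite ge0_integral_sum//=; last 2 first.
  by move=> i; apply: measurable_funTS; meas.
  by move=> i t _; rewrite lee_fin mulr_ge0 ?sqr_ge0.
rewrite -sumEFin; apply: lee_sum => i _; rewrite !mxE.
apply: (@le_trans _ _ (\int[lam]_(t in `[0%R, 1%R]) (dot_rV z (row i (df (y + t *: z))) ^+ 2)%R%:E)).
  apply: (@sqr_integral_le _ _ _ lam _ measurable_itv01 lebesgue_itv01).
    by apply: measurable_funTS; meas.
  exact: fE.
apply: ge0_le_integral => //.
- by move=> t _; rewrite lee_fin sqr_ge0.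
- by apply: measurable_funTS; meas.
- by apply: measurable_funTS; meas.
- by move=> t _; rewrite lee_fin dot_rV_sqr_le.
Qed.

Lemma sheared_fourth_le mu sigma e u (f : 'rV[R]_n -> 'rV[R]_n) :
  (sigma != 0)%R -> (0 < e)%R -> (u ^+ 2 <= e / 2)%R -> measurable_fun setT f ->
  \int[normal_rV mu sigma]_y \int[normal_rV 0 sigma]_x (norm2 (f (y + u *: x)%R) ^+ 4)%:E <=
  (shear_cst sigma e ^+ n)%:E *
    \int[normal_rV mu (Num.sqrt (1 + e) * sigma)]_z (norm2 (f z) ^+ 4)%:E.
Proof.
move=> s0 e0 ue mf.
pose F (p : 'rV[R]_n * 'rV[R]_n) := (norm2 (f p.1) ^+ 4)%:E.
have mF : measurable_fun setT F by rewrite /F; meas.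
have F0 p : 0 <= F p by rewrite lee_fin exprn_ge0// norm2_ge0.
apply: le_trans (normal_rV_shear_dominated mu s0 e0 ue mF F0) _.
rewrite /F /= lee_wpmul2l ?lee_fin ?exprn_ge0 ?shear_cst_ge0//.
rewrite le_eqVlt; apply/orP; left; apply/eqP; apply: eq_integral => z _.
rewrite integral_cst// (_ : _ setT = 1) ?mule1//; exact: normal_rV_setT.
Qed.

(** The gradient identity along the segment from [y] to [y + s x] bounds the
    integrand by the mean over [t] in [0, 1] of [|x|^4 |df (y + t s x)|^2]. For
    each fixed [t], shear domination turns the integral of this product into a
    product of two integrals. *)
Lemma sheared_increment_le mu sigma e s (f : 'rV[R]_n -> 'rV[R]_n)
    (df : 'rV[R]_n -> 'M[R]_n) :
  (sigma != 0)%R -> (0 < e)%R -> (0 < s)%R -> (s ^+ 2 <= e / 2)%R ->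
  measurable_fun setT f -> measurable_fun setT df ->
  (forall i, weak_gradient (fun y => f y 0%R i) (fun y => row i (df y))) ->
  \int[normal_rV mu sigma]_y \int[normal_rV 0 sigma]_x
     (dot_rV x (f (y + s *: x) - f y) ^+ 2 / s ^+ 2)%R%:E <=
  (shear_cst sigma e ^+ n)%:E *
    ((\int[normal_rV mu (Num.sqrt (1 + e) * sigma)]_z (normF (df z) ^+ 2)%:E) *
     (\int[normal_rV 0 (Num.sqrt 2 * sigma)]_(x in (setT : set 'rV[R]_n)) (norm2 x ^+ 4)%:E)).
Proof.
move=> s0 e0 sp se mf mdf wdf.
have [A [mA A0 subA]] : exists A : set ('rV[R]_n * 'rV[R]_n),
  [/\ measurable A, (lebesgue_rV R n \x lebesgue_rV R n) A = 0 &
   forall yz, ~ A yz -> forall i, (f (yz.1 + yz.2) 0 i - f yz.1 0 i)%R%:E =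
    \int[lam]_(t in `[0%R, 1%R]) (dot_rV yz.2 (row i (df (yz.1 + t *: yz.2))))%R%:E].
  have : {ae (lebesgue_rV R n \x lebesgue_rV R n), forall yz : 'rV[R]_n * 'rV[R]_n, forall i,
    (f (yz.1 + yz.2) 0 i - f yz.1 0 i)%R%:E =
    \int[lam]_(t in `[0%R, 1%R]) (dot_rV yz.2 (row i (df (yz.1 + t *: yz.2))))%R%:E}.
    by apply: filter_forall => i; exact: wdf.
  move=> [A [mA A0 sA]]; exists A; split => // yz nA.
  by apply: contrapT => h; apply: nA; exact: sA.
pose h (t : RT) (p : 'rV[R]_n * 'rV[R]_n) : \bar R :=
  (\1_`[0%R, 1%R] t)%:E * (norm2 p.2 ^+ 4 * normF (df (p.1 + (t * s) *: p.2)) ^+ 2)%R%:E.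
have h0 t p : 0 <= h t p.
  by rewrite /h mule_ge0// ?lee_fin// mulr_ge0// exprn_ge0// sqrtr_ge0.
have mI : measurable_fun (setT : set RT) (\1_`[0%R, 1%R] : RT -> R).
  by apply: measurable_indic; exact: measurable_itv01.
have mh : measurable_fun setT (fun q : RT * ('rV[R]_n * 'rV[R]_n) => h q.1 q.2).
  by rewrite /h; meas.
have mh' : measurable_fun setT (fun q : ('rV[R]_n * 'rV[R]_n) * RT => h q.2 q.1).
  by rewrite /h; meas.
pose N := normal_rV mu sigma; pose M := normal_rV (0 : 'rV[R]_n) sigma.
pose G (p : 'rV[R]_n * 'rV[R]_n) : \bar R :=
  (dot_rV p.2 (f (p.1 + s *: p.2) - f p.1) ^+ 2 / s ^+ 2)%R%:E.
have mG : measurable_fun setT G by rewrite /G; meas.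
have G0 p : 0 <= G p by rewrite lee_fin divr_ge0 ?sqr_ge0.
pose I (p : 'rV[R]_n * 'rV[R]_n) : \bar R := (\1_A (p.1, s *: p.2)%R)%:E.
have mIA : measurable_fun setT I.
  apply/measurable_EFinP; apply: measurableT_comp; first exact: measurable_indic.
  by meas.
have I0 p : 0 <= I p by rewrite lee_fin.
(* On the exceptional set the bound is +oo; that set has probability zero. *)
have GI p : G p <= \int[lam]_t h t p + +oo * I p.
  have [Ap|nAp] := pselect (A (p.1, s *: p.2)%R).
    by rewrite /I indicE mem_set// mule1 addey ?leey// -ltNye (lt_le_trans _ (integral_ge0 _ _)) ?ltNy0.
  rewrite /I indicE memNset// mule0 adde0.
  have := norm2_increment_le (f := f) (y := p.1) (z := (s *: p.2)%R) mdf (subA _ nAp).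
  set L := \int[lam]_(t in _) _ => Lle.
  have LE : L = (s ^+ 2)%:E * \int[lam]_(t in `[0%R, 1%R])
      (norm2 p.2 ^+ 2 * normF (df (p.1 + (t * s) *: p.2)) ^+ 2)%R%:E.
    rewrite -ge0_integralZl//; last 3 first.
    - by apply: measurable_funTS; meas.
    - by move=> t _; rewrite lee_fin mulr_ge0 ?sqr_ge0.
    - by rewrite lee_fin sqr_ge0.
    apply: eq_integral => t _; rewrite -EFinM scalerA; congr EFin; rewrite [RHS]mulrA.
    congr (_ * _)%R.
    by rewrite !norm2_sqr dot_rVZl dot_rVZr mulrA expr2.
  have hE : \int[lam]_t h t p = (norm2 p.2 ^+ 2)%:E * \int[lam]_(t in `[0%R, 1%R])
      (norm2 p.2 ^+ 2 * normF (df (p.1 + (t * s) *: p.2)) ^+ 2)%R%:E.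
    rewrite -ge0_integralZl//; last 3 first.
    - by apply: measurable_funTS; meas.
    - by move=> t _; rewrite lee_fin mulr_ge0 ?sqr_ge0.
    - by rewrite lee_fin sqr_ge0.
    rewrite [RHS]integral_mkcond; apply: eq_integral => t _.
    rewrite /h patchE indicE; case: ifPn => _; last by rewrite mul0e.
    by rewrite mul1e -EFinM; congr EFin; rewrite [RHS]mulrA -exprD.
  apply: (@le_trans _ _ ((norm2 p.2 ^+ 2 / s ^+ 2)%R%:E * (norm2 (f (p.1 + s *: p.2) - f p.1) ^+ 2)%R%:E)).
    rewrite -EFinM lee_fin [leRHS]mulrAC ler_pM2r ?invr_gt0 ?exprn_gt0//.
    exact: dot_rV_sqr_le.
  apply: le_trans (lee_wpmul2l _ Lle) _; first by rewrite lee_fin divr_ge0 ?sqr_ge0.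
  by rewrite LE hE muleA -EFinM divfK// gt_eqF// exprn_gt0.
rewrite -[leLHS](ge0_integral_product N M mG G0).
have mH : measurable_fun setT (fun p => \int[lam]_t h t p).
  exact: (@measurable_ge0_integral _ _ _ _ _ _ (fun p t => h t p)).
have H0 p : 0 <= \int[lam]_t h t p by exact: integral_ge0.
apply: (@le_trans _ _ (\int[N \x M]_p (\int[lam]_t h t p + +oo * I p))).
  apply: ge0_le_integralT => //.
  by apply: emeasurable_funD => //; apply: emeasurable_funM.
have IA0 : \int[N \x M]_p I p = 0.
  rewrite (ge0_integral_product N M mIA I0).
  exact: normal_rV_null_set.
rewrite ge0_integralD//; last 2 first.
  by move=> p _; rewrite mule_ge0.
  by apply: emeasurable_funM.
rewrite ge0_integralZl// IA0 mule0 adde0.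
rewrite (ge0_integral_product N M mH H0).
rewrite (@ge0_integral_rotate _ _ _ _ _ _ _ N M lam (fun y x t => h t (y, x)))//.
set B := leRHS.
have B0 : 0 <= B.
  rewrite /B !mule_ge0// ?lee_fin ?exprn_ge0 ?shear_cst_ge0//.
  - by apply: integral_ge0 => z _; rewrite lee_fin exprn_ge0// sqrtr_ge0.
  - by apply: integral_ge0 => z _; rewrite lee_fin exprn_ge0// sqrtr_ge0.
apply: (@le_trans _ _ (\int[lam]_t ((\1_`[0%R, 1%R] t)%:E * B))).
  apply: ge0_le_integralT.
  - apply: measurable_ge0_integral => [|t y]; last exact: integral_ge0.
    by apply: measurable_ge0_integral => //; rewrite /h; meas.
  - by apply: emeasurable_funM => //; exact/measurable_EFinP.
  - by move=> t; apply: integral_ge0 => y _; exact: integral_ge0.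
  - move=> t; rewrite /h.
    have [t01|t01] := boolP (t \in (`[0%R, 1%R]%classic : set RT)); last first.
      rewrite indicE (negbTE t01) mul0e integral0_eq// => y _.
      by rewrite integral0_eq// => x _; rewrite mul0e.
    rewrite indicE t01 mul1e.
    under eq_integral do under eq_integral do rewrite mul1e.
    have ts : ((t * s) ^+ 2 <= e / 2)%R.
      apply: le_trans se; rewrite exprMn ler_piMl ?sqr_ge0//.
      by move: t01; rewrite inE/= in_itv/= => /andP[t0 t1]; rewrite expr_le1.
    pose F (p : 'rV[R]_n * 'rV[R]_n) : \bar R := (norm2 p.2 ^+ 4 * normF (df p.1) ^+ 2)%R%:E.
    have mF : measurable_fun setT F by rewrite /F; meas.
    have F0 p : 0 <= F p by rewrite lee_fin mulr_ge0// exprn_ge0// sqrtr_ge0.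
    apply: le_trans (normal_rV_shear_dominated mu s0 e0 ts mF F0) _.
    rewrite /B lee_wpmul2l ?lee_fin ?exprn_ge0 ?shear_cst_ge0//.
    rewrite muleC -ge0_integralZl//; last 3 first.
    + by meas.
    + by move=> z _; rewrite lee_fin exprn_ge0// sqrtr_ge0.
    + by apply: integral_ge0 => z _; rewrite lee_fin exprn_ge0// sqrtr_ge0.
    rewrite le_eqVlt; apply/orP; left; apply/eqP; apply: eq_integral => z _.
    rewrite /F /= muleC -ge0_integralZl//; last 3 first.
    + by meas.
    + by move=> x _; rewrite lee_fin exprn_ge0// sqrtr_ge0.
    + by rewrite lee_fin exprn_ge0// sqrtr_ge0.
    by apply: eq_integral => x _; rewrite -EFinM mulrC.
under eq_integral do rewrite muleC.
rewrite ge0_integralZl//; last by exact/measurable_EFinP.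
by rewrite integral_indic ?setIT ?(measurable_itv01)// [X in B * X]lebesgue_itv01 mule1.
Qed.

(** Everything that is used of the smoothness assumption: one constant serves all
    small [alpha], because [shear_cst] depends on [alpha0] only. *)
Lemma smooth_moment_bounds mu sigma (f : 'rV[R]_n -> 'rV[R]_n) :
  (sigma != 0)%R -> smooth_moment mu sigma f ->
  exists C : R, [/\ (0 <= C)%R,
    \int[normal_rV mu sigma]_y (norm2 (f y) ^+ 4)%:E <= C%:E &
    \forall alpha \near 0^'+,
      \int[normal_rV mu sigma]_y \int[normal_rV 0 sigma]_x
        (norm2 (f (y + Num.sqrt alpha *: x)%R) ^+ 4)%:E <= C%:E /\
      \int[normal_rV mu sigma]_y \int[normal_rV 0 sigma]_x
        (dot_rV x (f (y + Num.sqrt alpha *: x) - f y) ^+ 2 / alpha)%R%:E <= C%:E].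
Proof.
move=> s0 [mf [df [mdf wdf [e [e0 f4 df2]]]]].
have t0 : (Num.sqrt 2 * sigma != 0)%R by rewrite mulf_neq0// gt_eqF// sqrtr_gt0.
have x4 := normal_rV_norm2_pow4 (0 : 'rV[R]_n) t0.
have S0 : (0 <= shear_cst sigma e ^+ n)%R by rewrite exprn_ge0// shear_cst_ge0.
have fin4 mu' s' (q : 'rV[R]_n -> R) k : \int[normal_rV mu' s']_z (q z ^+ (k * 2))%:E < +oo ->
    exists2 B : R, (0 <= B)%R & \int[normal_rV mu' s']_z (q z ^+ (k * 2))%:E = B%:E.
  have : 0 <= \int[normal_rV mu' s']_z (q z ^+ (k * 2))%:E.
    by apply: integral_ge0 => z _; rewrite lee_fin exprM sqr_ge0.
  by case: (\int[_]_z _) => [r| |]// r0 _; exists r.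
have [B4 B40 E4] := fin4 _ _ (fun z => norm2 (f z)) 2%N f4.
have [B2 B20 E2] := fin4 _ _ (fun z => normF (df z)) 1%N df2.
have [D4 D40 ED] := fin4 _ _ (@norm2 R n) 2%N x4.
have e2 : (0 < e / 2)%R by rewrite divr_gt0.
exists (shear_cst sigma e ^+ n * B4 + shear_cst sigma e ^+ n * (B2 * D4))%R.
have C1 : (shear_cst sigma e ^+ n)%:E * B4%:E <= (shear_cst sigma e ^+ n * B4 + shear_cst sigma e ^+ n * (B2 * D4))%R%:E.
  by rewrite -EFinM lee_fin lerDl mulr_ge0// mulr_ge0.
split.
- by rewrite addr_ge0// mulr_ge0// mulr_ge0.
- apply: le_trans C1; rewrite -E4.
  have := sheared_fourth_le mu s0 e0 (_ : (0 ^+ 2 <= e / 2)%R) mf.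
  rewrite expr0n/= => /(_ (ltW e2)); apply: le_trans.
  rewrite le_eqVlt; apply/orP; left; apply/eqP; apply: eq_integral => z _.
  under eq_integral do rewrite scale0r addr0.
  rewrite integral_cst// (_ : _ setT = 1) ?mule1//; exact: normal_rV_setT.
- near=> alpha.
  have a0 : (0 < alpha)%R by near: alpha; exact: nbhs_right_gt.
  have ae : (alpha <= e / 2)%R by near: alpha; exact: nbhs_right_le.
  have s2 : (Num.sqrt alpha ^+ 2 = alpha)%R by rewrite sqr_sqrtr// ltW.
  split.
    by apply: le_trans C1; rewrite -E4; apply: sheared_fourth_le => //; rewrite s2.
  apply: (@le_trans _ _ ((shear_cst sigma e ^+ n)%:E * (B2%:E * D4%:E))); last first.
    by rewrite -!EFinM lee_fin lerDr mulr_ge0.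
  rewrite -E2 -ED -{2}s2; apply: sheared_increment_le => //.
    by rewrite sqrtr_gt0.
  by rewrite s2.
Unshelve. all: by end_near. Qed.

End smooth_maps.

(** * Conditional variance under independence *)

Section quadratic_deviation.
Context d (T : measurableType d) (R : realType) (Q : probability T R).
Local Open Scope ereal_scope.

Lemma integral_quadratic (f : T -> R) (a b k : R) : measurable_fun setT f ->
  \int[Q]_x (f x ^+ 2)%:E < +oo ->
  \int[Q]_x (a * f x ^+ 2 + b * f x + k)%:E =
  (a * fine (\int[Q]_x (f x ^+ 2)%:E) + b * fine (\int[Q]_x (f x)%:E) + k)%:E.
Proof.
move=> mf f2oo.
have [i2 i1] := sqr_integrable measurableT (probability_setT Q) mf f2oo.
have ik : Q.-integrable setT (fun=> k%:E).
  exact: integrable_cst_mass1 measurableT (probability_setT Q) k.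
have ia := integrableZl measurableT a i2; have ib := integrableZl measurableT b i1.
transitivity (\int[Q]_x (a%:E * (f x ^+ 2)%:E + b%:E * (f x)%:E + k%:E)).
  by apply: eq_integral => x _; rewrite -!EFinM -!EFinD.
rewrite integralD//; last exact: integrableD.
have Ik : \int[Q]_x k%:E = k%:E.
  by rewrite integral_cst// [X in _ * X]probability_setT mule1.
rewrite integralD// !integralZl// Ik.
rewrite 2!EFinD (EFinM a) (EFinM b) !fineK//; exact: integrable_fin_num.
Qed.

(** Both sides are the same quadratic polynomial in the first two moments of
    [f]. *)
Lemma integral_sqr_deviation (f : T -> R) : measurable_fun setT f ->
  \int[Q]_x (f x ^+ 2)%:E < +oo ->
  2%:E * \int[Q]_x ((f x)%:E - \int[Q]_x (f x)%:E) ^+ 2 =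
  \int[Q]_x \int[Q]_x' ((f x - f x') ^+ 2)%:E.
Proof.
move=> mf f2oo.
have [i2 i1] := sqr_integrable measurableT (probability_setT Q) mf f2oo.
set A := fine (\int[Q]_x (f x ^+ 2)%:E); set c := fine (\int[Q]_x (f x)%:E).
have cE : \int[Q]_x (f x)%:E = c%:E by rewrite fineK//; exact: integrable_fin_num.
have -> : \int[Q]_x ((f x)%:E - \int[Q]_x (f x)%:E) ^+ 2 = (A - c ^+ 2)%:E.
  transitivity (\int[Q]_x (1 * f x ^+ 2 + (- 2 * c) * f x + c ^+ 2)%:E).
    by apply: eq_integral => x _; rewrite cE -EFinB -EFin_expe; congr EFin; ring.
  by rewrite integral_quadratic// -/A -/c; congr EFin; ring.
transitivity (\int[Q]_x (1 * f x ^+ 2 + (- 2 * c) * f x + A)%:E).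
  by rewrite integral_quadratic// -/A -/c -EFinM; congr EFin; ring.
apply: eq_integral => x _.
transitivity (\int[Q]_x' (1 * f x' ^+ 2 + (- 2 * f x) * f x' + f x ^+ 2)%:E).
  by rewrite integral_quadratic// -/A -/c; congr EFin; ring.
by apply: eq_integral => x' _; congr EFin; ring.
Qed.

Lemma integral_sqr_difference_le (f : T -> R) : measurable_fun setT f ->
  \int[Q]_x \int[Q]_x' ((f x - f x') ^+ 2)%:E <= 4%:E * \int[Q]_x (f x ^+ 2)%:E.
Proof.
move=> mf.
have f20 x : 0 <= (f x ^+ 2)%:E by rewrite lee_fin sqr_ge0.
have I0 : 0 <= \int[Q]_x (f x ^+ 2)%:E by exact: integral_ge0.
apply: (@le_trans _ _ (\int[Q]_x (2%:E * (f x ^+ 2)%:E + 2%:E * \int[Q]_x' (f x' ^+ 2)%:E))).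
  apply: ge0_le_integralT.
  - apply: measurable_ge0_integral; first by meas.
    by move=> x x'; rewrite lee_fin sqr_ge0.
  - by apply: emeasurable_funD => //; meas.
  - by move=> x; apply: integral_ge0 => x' _; rewrite lee_fin sqr_ge0.
  - move=> x; apply: (@le_trans _ _ (\int[Q]_x' (2%:E * (f x ^+ 2)%:E + 2%:E * (f x' ^+ 2)%:E))).
      apply: ge0_le_integralT; [by meas|by meas| |].
        by move=> x'; rewrite lee_fin sqr_ge0.
      move=> x'; rewrite -!EFinM -EFinD lee_fin.
      have := sqr_ge0 (f x + f x'); nra.
    rewrite ge0_integralD; [|exact: measurableT|by move=> ? _; rewrite mule_ge0|by meas|by move=> ? _; rewrite mule_ge0|by meas].
    by rewrite integral_cst// [X in _ * X]probability_setT mule1 ge0_integralZl//; meas.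
rewrite ge0_integralD; [|exact: measurableT|by move=> ? _; rewrite mule_ge0|by meas|by move=> ? _; rewrite mule_ge0|by meas].
rewrite ge0_integralZl//; last by meas.
have -> : \int[Q]_x (2%:E * \int[Q]_x' (f x' ^+ 2)%:E) = 2%:E * \int[Q]_x' (f x' ^+ 2)%:E.
  by rewrite integral_cst// [X in _ * X]probability_setT mule1.
rewrite -ge0_muleDl//.
by rewrite -EFinD -natrD.
Qed.

End quadratic_deviation.

Section conditional_expectation.
Context d (T : measurableType d) (R : realType) (P : probability T R).
Context d1 (T1 : measurableType d1) (Y : {RV P >-> T1}).
Local Open Scope ereal_scope.

Lemma integrable_of_fin_integral d' (S : measurableType d') (m : {measure set S -> \bar R})
    (Z : S -> \bar R) : measurable_fun setT Z -> \int[m]_x Z x \is a fin_num ->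
  m.-integrable setT Z.
Proof.
move=> mZ; rewrite integralE => fZ; apply/integrableP; split => //.
have mp := measurable_funepos mZ; have mn := measurable_funeneg mZ.
have p0 : 0 <= \int[m]_x Z^\+ x by exact: integral_ge0.
have n0 : 0 <= \int[m]_x Z^\- x by exact: integral_ge0.
have -> : \int[m]_x `|Z x| = \int[m]_x Z^\+ x + \int[m]_x Z^\- x.
  by rewrite -ge0_integralD//; apply: eq_integral => x _; rewrite -[LHS]/((abse \o Z) x) fune_abse.
move: fZ p0 n0; case: (\int[m]_x Z^\+ x) => [p| |]//; case: (\int[m]_x Z^\- x) => [q| |]// _ _ _.
by rewrite -EFinD ltry.
Qed.

Lemma sigma_measurable (Z : T -> \bar R) :
  measurable_fun [set: g_sigma_algebra_preimageType Y] Z -> measurable_fun [set: T] Z.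
Proof.
move=> mZ _ B mB; have [C mC] := mZ measurableT B mB.
by rewrite setTI => <-; rewrite -[X in measurable X]setTI; exact: (measurable_funPT Y).
Qed.

Lemma comp_sigma_measurable (e : T1 -> \bar R) : measurable_fun setT e ->
  measurable_fun [set: g_sigma_algebra_preimageType Y] (e \o Y).
Proof.
move=> me _ B mB; rewrite setTI; exists (e @^-1` B); last by rewrite setTI.
by rewrite -[X in measurable X]setTI; exact: me.
Qed.

Lemma is_cond_exp_integrable (X Z : T -> \bar R) : P.-integrable setT X ->
  is_cond_exp P Y X Z -> P.-integrable setT Z.
Proof.
move=> iX [mZ ZE]; apply: integrable_of_fin_integral; first exact: sigma_measurable.
rewrite ZE; first exact: integrable_fin_num.
by exists setT => //; rewrite setTI preimage_setT.
Qed.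

(** Two versions are measurable for the sigma-algebra of [Y] and have the same
    integrals over it, so they agree almost everywhere for the restriction of
    [P] to that sigma-algebra. *)
Lemma is_cond_exp_unique (X Z Z' : T -> \bar R) : P.-integrable setT X ->
  is_cond_exp P Y X Z -> is_cond_exp P Y X Z' -> ae_eq P setT Z Z'.
Proof.
move=> iX cZ cZ'.
have iZ := is_cond_exp_integrable iX cZ; have iZ' := is_cond_exp_integrable iX cZ'.
have [mZ ZE] := cZ; have [mZ' ZE'] := cZ'.
(* The identity, measurable into the coarser sigma-algebra, pushes P to its restriction. *)
pose id' : T -> g_sigma_algebra_preimageType Y := id.
have mid : measurable_fun [set: T] id'.
  move=> _ B [C mC]; rewrite setTI => <-; rewrite setTI preimage_id.
  by rewrite -[X in measurable X]setTI; exact: (measurable_funPT Y).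
pose Ps : {measure set (g_sigma_algebra_preimageType Y) -> \bar R} := pushforward P id'.
have intE (U : T -> \bar R) (E : set T) : P.-integrable setT U ->
    measurable_fun [set: g_sigma_algebra_preimageType Y] U -> g_sigma_algebra_preimage Y E ->
    \int[Ps mid]_(t in E) U t = \int[P]_(t in E) U t.
  move=> iU mU mE; rewrite integral_pushforward//.
  apply: integrableS iU => //; rewrite -[X in measurable X]setTI.
  exact: (mid measurableT E mE).
have [A [mA A0 sA]] : ae_eq (Ps mid) setT Z Z'.
  apply: integral_ae_eq => //.
    apply/integrableP; split => //.
    have /integrableP[_] := iZ; rewrite ge0_integral_pushforward//.
    exact: measurableT_comp.
  by move=> E _ mE; rewrite !intE// ZE// ZE'.
exists A; split => //.
by rewrite -[X in measurable X]setTI; exact: (mid measurableT A mA).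
Qed.

Lemma is_cond_exp_ae (X X' Z : T -> \bar R) :
  measurable_fun setT X -> measurable_fun setT X' -> ae_eq P setT X X' ->
  is_cond_exp P Y X' Z -> is_cond_exp P Y X Z.
Proof.
move=> mX mX' XX' [mZ ZE]; split => // A [C mC] CA; rewrite ZE; last by exists C.
have mA : measurable A.
  by rewrite -CA setTI -[X in measurable X]setTI; exact: (measurable_funPT Y).
apply: ae_eq_integral => //; [exact: measurable_funTS|exact: measurable_funTS|].
by apply: filterS XX' => t /= h _; rewrite h.
Qed.

End conditional_expectation.

Section independence.
Context d (T : measurableType d) (R : realType) (P : probability T R).
Context d1 d2 (T1 : measurableType d1) (T2 : measurableType d2).
Variables (Y : {RV P >-> T1}) (W : {RV P >-> T2}).
Hypothesis indep : forall A B, measurable A -> measurable B ->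
  P (Y @^-1` A `&` W @^-1` B) = (P (Y @^-1` A) * P (W @^-1` B))%E.
Local Open Scope ereal_scope.
Let mu := distribution P Y.
Let Q := distribution P W.
Let pair t := (Y t, W t).

Let measurable_pair : measurable_fun setT pair.
Proof. by apply: measurable_fun_pair. Qed.

Lemma independent_law A : measurable A -> P (pair @^-1` A) = (mu \x Q) A.
Proof.
move=> mA; pose m := pushforward P pair : {measure set (T1 * T2)%type -> \bar R}.
rewrite (@product_measure_unique _ _ _ _ _ mu Q (m measurable_pair))//.
Qed.

Lemma ge0_integral_independent (F : T1 * T2 -> \bar R) :
  measurable_fun setT F -> (forall p, 0 <= F p) ->
  \int[P]_t F (Y t, W t) = \int[mu]_y \int[Q]_x F (y, x).
Proof.
move=> mF F0; rewrite -(ge0_integral_product mu Q mF F0).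
pose m := pushforward P pair : {measure set (T1 * T2)%type -> \bar R}.
transitivity (\int[m measurable_pair]_p F p).
  by rewrite ge0_integral_pushforward.
apply: (@eq_measure_integral _ _ _ _ _ (m measurable_pair)) => A mA _.
exact: independent_law.
Qed.

Section square_integrable_function.
Variable phi : T1 * T2 -> R.
Hypothesis mphi : measurable_fun setT phi.
Hypothesis phi2 : \int[mu]_y \int[Q]_x (phi (y, x) ^+ 2)%:E < +oo.

Let integrable_phi : (mu \x Q).-integrable setT (EFin \o phi).
Proof.
have m1 : (mu \x Q) setT = 1.
  by rewrite -setXTT product_measure1E// -[RHS]mule1; congr (_ * _); exact: probability_setT.
have := @sqr_integrable _ _ _ (mu \x Q)%E setT measurableT m1 phi mphi.
case=> //; rewrite ge0_integral_product//.
  by apply/measurable_EFinP; apply: measurable_funX.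
by move=> p; rewrite lee_fin sqr_ge0.
Qed.

Definition mean_section (y : T1) : \bar R := \int[Q]_x (phi (y, x))%:E.

Lemma measurable_mean_section : measurable_fun setT mean_section.
Proof. exact: measurable_fubini_F integrable_phi. Qed.

Lemma integral_independent (C : set T1) : measurable C ->
  \int[P]_(t in Y @^-1` C) (phi (Y t, W t))%:E = \int[mu]_(y in C) mean_section y.
Proof.
move=> mC.
pose m := pushforward P pair : {measure set (T1 * T2)%type -> \bar R}.
have mD : measurable (C `*` [set: T2]) by exact: measurableX.
have preD : pair @^-1` (C `*` [set: T2]) = Y @^-1` C.
  by apply/seteqP; split => t /=; [case|].
have iP : P.-integrable setT ((EFin \o phi) \o pair).
  have /integrableP[_] := integrable_phi.
  have mabs : measurable_fun setT (abse \o (EFin \o phi)) by do 2 apply: measurableT_comp => //.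
  have abs0 p : 0 <= (abse \o (EFin \o phi)) p by exact: abse_ge0.
  rewrite (ge0_integral_product mu Q mabs abs0) -(ge0_integral_independent mabs abs0).
  move=> oo; apply/integrableP; split => //.
  by apply: measurableT_comp => //; exact/measurable_EFinP.
transitivity (\int[m measurable_pair]_(p in C `*` [set: T2]) (phi p)%:E).
  rewrite integral_pushforward//; first by rewrite preD.
    exact/measurable_EFinP.
  apply: integrableS iP => //; rewrite preD.
  by rewrite -[X in measurable X]setTI; exact: (measurable_funPT Y).
transitivity (\int[mu \x Q]_(p in C `*` [set: T2]) (phi p)%:E).
  by apply: (@eq_measure_integral _ _ _ _ _ (m measurable_pair)) => A mA _; exact: independent_law.
rewrite integral_mkcond [RHS]integral_mkcond.
rewrite -integral12_prod_meas1; last first.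
  by rewrite -integrable_mkcond//; apply: integrableS integrable_phi.
apply: eq_integral => y _; rewrite /fubini_F patchE; case: ifPn => yC.
  apply: eq_integral => x _; rewrite patchE mem_set//; split => //=.
  by move: yC; rewrite inE.
rewrite integral0_eq// => x _; rewrite patchE memNset//= => -[/= Cy _].
by move: yC; rewrite notin_setE.
Qed.

Lemma mean_section_is_cond_exp :
  is_cond_exp P Y (fun t => (phi (Y t, W t))%:E) (mean_section \o Y).
Proof.
split; first by apply: comp_sigma_measurable; exact: measurable_mean_section.
move=> _ [C mC <-]; rewrite setTI integral_independent//.
have mmean := measurable_mean_section.
have imean : mu.-integrable setT mean_section by exact: integrable_fubini_F integrable_phi.
have imY : P.-integrable setT (mean_section \o Y).
  apply/integrableP; split; first exact: measurableT_comp.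
  have /integrableP[_] := imean; rewrite ge0_integral_pushforward//.
  exact: measurableT_comp.
rewrite [RHS]integral_pushforward//; apply: integrableS imY => //.
by rewrite -[X in measurable X]setTI; exact: (measurable_funPT Y).
Qed.

(** Fubini makes the mean of the sections a version of the conditional
    expectation, and versions agree almost surely. *)
Lemma cond_exp_independent (X : T -> R) : measurable_fun setT X ->
  ae_eq P setT X (fun t => phi (Y t, W t)) ->
  P.-integrable setT (EFin \o X) /\
  ae_eq P setT (cond_exp P Y (EFin \o X)) (mean_section \o Y).
Proof.
move=> mX XE.
have mphiT : measurable_fun setT (fun t => phi (Y t, W t)) by exact: (measurableT_comp mphi measurable_pair).
have XE' : ae_eq P setT (EFin \o X) (fun t => (phi (Y t, W t))%:E).
  by apply: filterS XE => t /= h _; rewrite h.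
have c := is_cond_exp_ae (_ : measurable_fun setT (EFin \o X)) (_ : measurable_fun setT (fun t => (phi (Y t, W t))%:E)) XE' mean_section_is_cond_exp.
have {}c : is_cond_exp P Y (EFin \o X) (mean_section \o Y).
  by apply: c; exact/measurable_EFinP.
have iX : P.-integrable setT (EFin \o X).
  apply: integrable_of_fin_integral; first exact/measurable_EFinP.
  have [_ <-] := c.
    have [mm] := mean_section_is_cond_exp.
    have -> : [set: T] = Y @^-1` setT by rewrite preimage_setT.
    move=> ->; last by exists setT => //; rewrite setTI.
    rewrite integral_independent//.
    apply: integrable_fin_num => //; exact: integrable_fubini_F integrable_phi.
  by exists setT => //; rewrite setTI preimage_setT.
by split => //; exact: (is_cond_exp_unique iX (cond_expP Y iX) c).
Qed.

(** Given [Y = y] the variable is [phi (y, W)], whose variance is half the mean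
    squared difference of two independent copies. Summands of [phi] that depend
    on [y] alone cancel in the right-hand side. *)
Lemma integral_cond_var_independent (X : T -> R) : measurable_fun setT X ->
  ae_eq P setT X (fun t => phi (Y t, W t)) ->
  2%:E * \int[P]_t cond_var P Y X t =
  \int[mu]_y \int[Q]_x \int[Q]_x' ((phi (y, x) - phi (y, x')) ^+ 2)%:E.
Proof.
move=> mX XE; have [iX ZE] := cond_exp_independent mX XE.
set Z := cond_exp P Y (EFin \o X) in ZE *.
have mmean := measurable_mean_section.
have mphi_y y : measurable_fun setT (fun x => phi (y, x)).
  by apply: (measurableT_comp mphi); exact: measurable_fun_pair.
pose D (p : T1 * T2) : \bar R := ((phi p)%:E - mean_section p.1) ^+ 2.
have mD : measurable_fun setT D.
  have mB : measurable_fun setT (fun p => (phi p)%:E - mean_section p.1).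
    apply: emeasurable_funB; first exact/measurable_EFinP.
    exact: (measurableT_comp mmean measurable_fst).
  rewrite (_ : D = fun p => ((phi p)%:E - mean_section p.1) * ((phi p)%:E - mean_section p.1)).
    exact: emeasurable_funM.
  by apply/funext => p; rewrite /D expe2.
have D0 p : 0 <= D p by exact: sqre_ge0.
have aephi : {ae mu, forall y, \int[Q]_x (phi (y, x) ^+ 2)%:E < +oo}.
  have i2 : mu.-integrable setT (fun y => \int[Q]_x (phi (y, x) ^+ 2)%:E).
    apply/integrableP; split.
      apply: measurable_ge0_integral => [|y x]; last by rewrite lee_fin sqr_ge0.
      by meas.
    rewrite (eq_integral (fun y => \int[Q]_x (phi (y, x) ^+ 2)%:E)); first exact: phi2.
    by move=> y _; rewrite gee0_abs//; apply: integral_ge0 => x _; rewrite lee_fin sqr_ge0.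
  have := integrable_ae measurableT i2; apply: filterS => y /(_ I) h.
  by rewrite ltey; apply: contraTN h => /eqP ->.
have meanD y : measurable_fun setT (fun x => D (y, x)).
  by apply: (measurableT_comp mD); exact: measurable_fun_pair.
have mdev : measurable_fun setT (fun y => \int[Q]_x \int[Q]_x' ((phi (y, x) - phi (y, x')) ^+ 2)%:E).
  apply: measurable_ge0_integral => [|y x]; last by apply: integral_ge0 => x' _; rewrite lee_fin sqr_ge0.
  apply: measurable_ge0_integral => [|p x']; last by rewrite lee_fin sqr_ge0.
  by meas.
have mDI : measurable_fun setT (fun y => \int[Q]_x D (y, x)).
  apply: measurable_ge0_integral => //.
  by under eq_fun do rewrite -surjective_pairing.
have key : 2%:E * \int[P]_t D (Y t, W t) =
    \int[mu]_y \int[Q]_x \int[Q]_x' ((phi (y, x) - phi (y, x')) ^+ 2)%:E.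
  rewrite (ge0_integral_independent mD D0) -ge0_integralZl//; last first.
    by move=> y _; exact: integral_ge0.
  apply: ge0_ae_eq_integral => //.
  - by apply: emeasurable_funM.
  - by move=> y _; rewrite mule_ge0// integral_ge0.
  - by move=> y _; apply: integral_ge0 => x _; apply: integral_ge0 => x' _; rewrite lee_fin sqr_ge0.
  - apply: filterS aephi => y h _; exact: integral_sqr_deviation.
have phi2_ge0 y : 0 <= \int[Q]_x (phi (y, x) ^+ 2)%:E.
  by apply: integral_ge0 => x _; rewrite lee_fin sqr_ge0.
have Doo : \int[P]_t D (Y t, W t) < +oo.
  have : 2%:E * \int[P]_t D (Y t, W t) < +oo.
    rewrite key; apply: (@le_lt_trans _ _ (\int[mu]_y (4%:E * \int[Q]_x (phi (y, x) ^+ 2)%:E))).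
      apply: ge0_le_integralT => //.
      - apply: emeasurable_funM => //; apply: measurable_ge0_integral => [|y x]; last by rewrite lee_fin sqr_ge0.
        by meas.
      - by move=> y; apply: integral_ge0 => x _; apply: integral_ge0 => x' _; rewrite lee_fin sqr_ge0.
      - by move=> y; exact: integral_sqr_difference_le.
    rewrite ge0_integralZl//; first by rewrite lte_mul_pinfty.
    apply: measurable_ge0_integral => [|y x]; last by rewrite lee_fin sqr_ge0.
    by meas.
  have : 0 <= \int[P]_t D (Y t, W t) by exact: integral_ge0.
  by case: (\int[P]_t D (Y t, W t)) => [r| |]// _; rewrite ?ltry// mulry gtr0_sg// mul1e.
pose V t := ((X t)%:E - Z t) ^+ 2.
have mZ : measurable_fun setT Z by exact: (sigma_measurable (cond_expP Y iX).1).
have mV : measurable_fun setT V.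
  have mB : measurable_fun setT (fun t => (X t)%:E - Z t).
    by apply: emeasurable_funB => //; exact/measurable_EFinP.
  rewrite (_ : V = fun t => ((X t)%:E - Z t) * ((X t)%:E - Z t)).
    exact: emeasurable_funM.
  by apply/funext => t; rewrite /V expe2.
have mDP : measurable_fun setT (fun t => D (Y t, W t)) by exact: (measurableT_comp mD measurable_pair).
have V0 t : 0 <= V t by exact: sqre_ge0.
have VD : \int[P]_t V t = \int[P]_t D (Y t, W t).
  apply: ge0_ae_eq_integral => //.
  by apply: filterS2 XE ZE => t /= h1 h2 _; rewrite /V /D h1// h2.
have iV : P.-integrable setT V.
  apply/integrableP; split => //.
  rewrite (eq_integral V); first by rewrite VD.
  by move=> t _; rewrite gee0_abs.
have [_ VE] := cond_expP Y iV.
rewrite -key -VD; congr (_ * _); apply: VE.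
by exists setT => //; rewrite setTI preimage_setT.
Qed.

End square_integrable_function.
End independence.

(** * Second moments of the total noise *)

Section laws.
Context d (T : measurableType d) (R : realType) (P : probability T R).
Context d' (T' : measurableType d') (X : {RV P >-> T'}) (m : {measure set T' -> \bar R}).
Hypothesis lawX : has_law X m.
Local Open Scope ereal_scope.

Lemma integral_has_law (F : T' -> \bar R) :
  \int[distribution P X]_x F x = \int[m]_x F x.
Proof. by apply: eq_measure_integral => A mA _; exact: lawX. Qed.

Lemma ge0_expectation_has_law (F : T' -> \bar R) : measurable_fun setT F ->
  (forall x, 0 <= F x) -> \int[P]_t F (X t) = \int[m]_x F x.
Proof. by move=> mF F0; rewrite -integral_has_law ge0_integral_distribution. Qed.

Lemma integrable_has_law (F : T' -> \bar R) : m.-integrable setT F ->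
  P.-integrable setT (F \o X) /\ \int[P]_t F (X t) = \int[m]_x F x.
Proof.
move=> /integrableP[mF Foo].
have iF : P.-integrable setT (F \o X).
  apply/integrableP; split; first exact: measurableT_comp.
  rewrite (ge0_expectation_has_law (F := abse \o F))//.
    exact: measurableT_comp.
  by move=> x; exact: abse_ge0.
by split => //; rewrite -integral_has_law integral_distribution.
Qed.

End laws.

Section linear_statistics.
Context d (T : measurableType d) (R : realType) (P : probability T R).
Local Open Scope ereal_scope.

Lemma integral_sqr_linear (I : finType) (X : I -> T -> R) (M : I -> I -> R) (c : I -> R) :
  (forall i j, P.-integrable setT (fun t => (X i t * X j t)%:E)) ->
  (forall i j, \int[P]_t (X i t * X j t)%:E = (M i j)%:E) ->
  \int[P]_t ((\sum_i c i * X i t) ^+ 2)%:E =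
  (\sum_i \sum_j c i * c j * M i j)%:E.
Proof.
move=> iX XM.
transitivity (\int[P]_t (\sum_i \sum_j (c i * c j)%:E * (X i t * X j t)%:E)).
  apply: eq_integral => t _; rewrite expr2 big_distrlr/= -sumEFin.
  apply: eq_bigr => i _; rewrite -sumEFin; apply: eq_bigr => j _.
  by rewrite -EFinM; congr EFin; ring.
have iZ i j : P.-integrable setT (fun t => (c i * c j)%:E * (X i t * X j t)%:E).
  exact: integrableZl.
rewrite integral_sum//; last by move=> i; exact: integrable_sum.
rewrite -sumEFin; apply: eq_bigr => i _.
rewrite integral_sum// -sumEFin; apply: eq_bigr => j _.
by rewrite integralZl// XM -EFinM.
Qed.

End linear_statistics.

Section exchangeable_noise.
Context d (T : measurableType d) (R : realType) (P : probability T R).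
Variables (n K : nat) (sigma rho : R) (w : 'I_K -> {RV P >-> 'rV[R]_n}).
Hypothesis sigma0 : sigma != 0.
Hypothesis law_w : forall k, has_law (w k) (normal_rV (0 : 'rV[R]_n) sigma).
Hypothesis cov_w : forall k k', k != k' -> forall i j,
  covariance P (fun t => w k t 0 i) (fun t => w k' t 0 j) =
  (rho * sigma ^+ 2 * (i == j)%:R)%:E.
Local Open Scope ereal_scope.

Let mw k i : measurable_fun setT (fun t => w k t 0%R i).
Proof. by apply: measurable_rV_coord; exact: measurable_funPT. Qed.

Lemma noise_second_moment k i : \int[P]_t (w k t 0%R i ^+ 2)%:E = (sigma ^+ 2)%:E.
Proof.
rewrite (ge0_expectation_has_law (law_w k) (F := fun v => (v 0%R i ^+ 2)%:E)).
- exact: normal_rV_second_moment.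
- by meas.
- by move=> v; rewrite lee_fin sqr_ge0.
Qed.

Lemma noise_sqr_integrable k i :
  P.-integrable setT (fun t => (w k t 0%R i ^+ 2)%:E) /\
  P.-integrable setT (fun t => (w k t 0%R i)%:E).
Proof.
apply: (sqr_integrable measurableT (probability_setT P) (mw k i)).
by rewrite noise_second_moment ltry.
Qed.

Lemma noise_prod_integrable k k' i j :
  P.-integrable setT (fun t => (w k t 0%R i * w k' t 0%R j)%:E).
Proof.
have [i1 _] := noise_sqr_integrable k i; have [i2 _] := noise_sqr_integrable k' j.
apply: (@le_integrable _ _ _ P setT measurableT _
    (fun t => (w k t 0%R i ^+ 2)%:E + (w k' t 0%R j ^+ 2)%:E)).
- by apply/measurable_EFinP; apply: measurable_funM.
- move=> t _; rewrite -EFinD lee_fin [leRHS]ger0_norm ?addr_ge0 ?sqr_ge0//.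
  move: (w k t _ _) (w k' t _ _) => x y.
  have h1 := sqr_ge0 (x - y); have h2 := sqr_ge0 (x + y).
  by rewrite ler_norml; apply/andP; split; nra.
- exact: integrableD.
Qed.

Lemma noise_mean0 k i : \int[P]_t (w k t 0%R i)%:E = 0.
Proof.
have i1 : (normal_rV (0 : 'rV[R]_n) sigma).-integrable setT (fun v => (v 0%R i)%:E).
  apply: (sqr_integrable measurableT (normal_rV_setT 0 sigma) _ _).2.
    by meas.
  by rewrite normal_rV_second_moment// ltry.
have [_ ->] := integrable_has_law (law_w k) i1.
exact: normal_rV_mean0.
Qed.

Definition noise_cov (p q : 'I_K * 'I_n) : R :=
  ((if p.1 == q.1 then 1 else rho) * sigma ^+ 2 * (p.2 == q.2)%:R)%R.

(** All means vanish, so covariances are product moments; within one replicate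
    they are computed from the normal law, across replicates they are given. *)
Lemma noise_covE (p q : 'I_K * 'I_n) :
  \int[P]_t (w p.1 t 0%R p.2 * w q.1 t 0%R q.2)%:E = (noise_cov p q)%:E.
Proof.
case: p q => [k i] [k' j]; rewrite /noise_cov /=.
have [<-|kk'] := eqVneq k k'.
  rewrite mul1r; have [<-|ij] := eqVneq i j.
    by rewrite mulr1 -(noise_second_moment k i).
  have i1 : (normal_rV (0 : 'rV[R]_n) sigma).-integrable setT (fun v => (v 0%R i * v 0%R j)%:E).
    apply: (@le_integrable _ _ _ _ setT measurableT _ (fun v : 'rV[R]_n => (v 0%R i ^+ 2)%:E + (v 0%R j ^+ 2)%:E)).
    - by meas.
    - move=> v _; rewrite -EFinD lee_fin [leRHS]ger0_norm ?addr_ge0 ?sqr_ge0//.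
      move: (v _ _) (v 0%R j) => x y.
      have h1 := sqr_ge0 (x - y); have h2 := sqr_ge0 (x + y).
      by rewrite ler_norml; apply/andP; split; nra.
    - have h l : (normal_rV (0 : 'rV[R]_n) sigma).-integrable setT (fun v => (v 0%R l ^+ 2)%:E).
        apply: (sqr_integrable measurableT (normal_rV_setT 0 sigma) _ _).1.
          by meas.
        by rewrite normal_rV_second_moment// ltry.
      exact: integrableD.
  have [_ ->] := integrable_has_law (law_w k) i1.
  by rewrite mulr0; exact: normal_rV_uncorrelated.
rewrite -(cov_w kk' i j) covariance.unlock.
have E0 l u : fine 'E_P[(fun t => w l t 0%R u)] = 0%R.
  by rewrite expectation.unlock noise_mean0.
rewrite !E0 expectation.unlock; apply: eq_integral => t _.
by rewrite !fctE /= !subr0.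
Qed.

(** The variance of each coordinate of the sum of the replicates: [K] variances
    [sigma^2] and [K (K - 1)] covariances [rho sigma^2]. *)
Definition total_noise_factor : R := (K%:R * (1 + (K%:R - 1) * rho) * sigma ^+ 2)%R.

Lemma noise_cov_sum (v : 'rV[R]_n) :
  (\sum_(p : 'I_K * 'I_n) \sum_(q : 'I_K * 'I_n) v 0 p.2 * v 0 q.2 * noise_cov p q =
   total_noise_factor * norm2 v ^+ 2)%R.
Proof.
have row (k : 'I_K) : (\sum_(k' < K) (if k == k' then 1 else rho) = 1 + (K%:R - 1) * rho)%R.
  rewrite (bigD1 k)//= eqxx; congr (_ + _)%R.
  rewrite (eq_bigr (fun=> rho)) => [|k' kk']; last by rewrite eq_sym (negbTE kk').
  rewrite sumr_const -[LHS]mulr_natr [RHS]mulrC; congr (rho * _)%R.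
  rewrite (eq_card (_ : _ =i predC1 k)) => [|k']; last by rewrite !inE.
  by rewrite cardC1 card_ord -subn1 natrB// (leq_ltn_trans _ (ltn_ord k)).
transitivity (\sum_(k < K) \sum_(i < n) v 0 i ^+ 2 * (sigma ^+ 2 * (1 + (K%:R - 1) * rho)))%R.
  rewrite [RHS]pair_bigA; apply: eq_bigr => -[k i] _ /=.
  rewrite -(row k) -(pair_bigA _ (fun k' j => v 0 i * v 0 j * noise_cov (k, i) (k', j)))%R/=.
  rewrite mulr_sumr mulr_sumr; apply: eq_bigr => k' _.
  rewrite (bigD1 i)//= big1 => [|j ji]; rewrite /noise_cov/=.
    by rewrite eqxx mulr1n; ring.
  by rewrite [i == j]eq_sym (negbTE ji) !mulr0.
rewrite sumr_const card_ord norm2_sqrE -mulr_suml /total_noise_factor -mulr_natl.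
by ring.
Qed.

Lemma dot_total_noise t (v : 'rV[R]_n) :
  (dot_rV (\sum_k w k t) v = \sum_(p : 'I_K * 'I_n) v 0 p.2 * w p.1 t 0 p.2)%R.
Proof.
rewrite dot_rV_suml -(pair_bigA _ (fun k i => v 0 i * w k t 0 i))%R/=.
by apply: eq_bigr => k _; apply: eq_bigr => i _; rewrite mulrC.
Qed.

Lemma total_noise_second_moment (v : 'rV[R]_n) :
  \int[P]_t (dot_rV (\sum_k w k t)%R v ^+ 2)%:E = (total_noise_factor * norm2 v ^+ 2)%:E.
Proof.
under eq_integral do rewrite dot_total_noise.
rewrite (integral_sqr_linear (M := noise_cov) (X := fun p t => w p.1 t 0%R p.2)); last 2 first.
- by move=> p q; exact: noise_prod_integrable.
- exact: noise_covE.
by rewrite noise_cov_sum.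
Qed.

Lemma total_noise_mean0 (v : 'rV[R]_n) :
  \int[P]_t (dot_rV (\sum_k w k t)%R v)%:E = 0.
Proof.
under eq_integral do rewrite dot_total_noise -sumEFin.
rewrite integral_sum//.
  rewrite big1// => p _; under eq_integral do rewrite EFinM.
  by rewrite integralZl// ?noise_mean0 ?mule0//; exact: (noise_sqr_integrable p.1 p.2).2.
move=> p; under eq_fun do rewrite EFinM; apply: integrableZl => //.
exact: (noise_sqr_integrable p.1 p.2).2.
Qed.

End exchangeable_noise.

(** * Decomposition of one replicate *)

Lemma indic_sqr_le1 (R : realType) (U : Type) (A : set U) (x : U) :
  (\1_A x : R) ^+ 2 <= 1.
Proof. by rewrite indicE; case: (x \in A); rewrite ?expr1n ?expr0n. Qed.

Section one_replicate.
Variables (R : realType) (n m : nat).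
Variables (f0 : 'rV[R]_n -> 'rV[R]_n) (a : 'I_m -> 'rV[R]_n -> 'rV[R]_n)
  (h : 'I_m -> 'rV[R]_n -> R).
Implicit Types (f : 'rV[R]_n -> 'rV[R]_n) (y o : 'rV[R]_n) (s : R).
Local Notation g := (piecewise f0 a h).

Definition noise_increment f s y o : R := dot_rV o (f (y + s *: o) - f y).

(** What is left of one replicate after the linear term in the noise and the
    functions of the signal are split off; the increments compensate the factor
    [2 / s]. *)
Definition regular_part s y o : R :=
  norm2 (g (y + s *: o) - y) ^+ 2 + 2 / s * noise_increment f0 s y o +
  2 / s * \sum_(l < m) \1_[set x | 0 < h l x] (y + s *: o) * noise_increment (a l) s y o.

(** The cross term of the square is [2 / s] times the pairing of [o] with
    [g (y + s o) - y]. Writing the values of [f0] and of the [a l] at [y + s o]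
    as values at [y] plus increments, the contributions of [a l y] are those
    which the control variate removes. Here [c l] stands for the conditional
    mean of the gated noise. *)
Lemma replicate_decomposition s y o (c : 'I_m -> 'rV[R]_n) : s != 0 ->
  norm2 (g (y + s *: o) - (y - s^-1 *: o)) ^+ 2 - (s ^+ 2)^-1 * norm2 o ^+ 2
  + 2 / s * \sum_(l < m) dot_rV (a l y) (c l - \1_[set x | 0 < h l x] (y + s *: o) *: o) =
  regular_part s y o + 2 / s * dot_rV o (f0 y - y)
  + 2 / s * \sum_(l < m) dot_rV (a l y) (c l).
Proof.
move=> s0; rewrite /regular_part /noise_increment; set z := y + s *: o.
have -> : g z - (y - s^-1 *: o) = (g z - y) + s^-1 *: o by rewrite opprB addrA addrAC.
have -> : norm2 (g z - y + s^-1 *: o) ^+ 2 =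
    norm2 (g z - y) ^+ 2 + 2 / s * dot_rV o (g z - y) + (s ^+ 2)^-1 * norm2 o ^+ 2.
  move: (g z - y) => u; rewrite !norm2_sqr dot_rVDl !dot_rVDr !dot_rVZl !dot_rVZr (dot_rVC u o).
  by field.
have -> : dot_rV o (g z - y) = dot_rV o (f0 z - f0 y) + dot_rV o (f0 y - y) +
    \sum_(l < m) \1_[set x | 0 < h l x] z * dot_rV o (a l z).
  rewrite /piecewise !dot_rVDr !dot_rVNr dot_rV_sumr.
  under eq_bigr do rewrite dot_rVZr.
  by ring.
have -> : \sum_(l < m) dot_rV (a l y) (c l - \1_[set x | 0 < h l x] z *: o) =
    \sum_(l < m) dot_rV (a l y) (c l) - \sum_(l < m) \1_[set x | 0 < h l x] z * dot_rV o (a l y).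
  rewrite -sumrB; apply: eq_bigr => l _.
  by rewrite dot_rVDr dot_rVNr dot_rVZr (dot_rVC (a l y) o).
have -> : \sum_(l < m) \1_[set x | 0 < h l x] z * dot_rV o (a l z - a l y) =
    \sum_(l < m) \1_[set x | 0 < h l x] z * dot_rV o (a l z) -
    \sum_(l < m) \1_[set x | 0 < h l x] z * dot_rV o (a l y).
  by rewrite -sumrB; apply: eq_bigr => l _; rewrite dot_rVDr dot_rVNr mulrBr.
by ring.
Qed.

Lemma norm2_sum_pow4_le (v : 'I_m -> 'rV[R]_n) :
  norm2 (\sum_l v l) ^+ 4 <= m%:R ^+ 3 * \sum_l norm2 (v l) ^+ 4.
Proof.
have h2 : norm2 (\sum_l v l) ^+ 2 <= m%:R * \sum_l norm2 (v l) ^+ 2.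
  rewrite norm2_sqrE mulr_sumr.
  under [leRHS]eq_bigr do rewrite norm2_sqrE mulr_sumr.
  rewrite exchange_big/=; apply: ler_sum => i _; rewrite summxE -mulr_sumr.
  by apply: le_trans (sqr_sum_le _) _; rewrite card_ord.
have s0 : 0 <= \sum_l norm2 (v l) ^+ 2 by apply: sumr_ge0 => l _; exact: sqr_ge0.
have : (norm2 (\sum_l v l) ^+ 2) ^+ 2 <= (m%:R * \sum_l norm2 (v l) ^+ 2) ^+ 2.
  by rewrite lerXn2r// ?nnegrE ?sqr_ge0// mulr_ge0.
rewrite -exprM => /le_trans; apply; rewrite exprMn.
rewrite [leRHS](_ : _ = m%:R ^+ 2 * (m%:R * \sum_l norm2 (v l) ^+ 4)); last by ring.
apply: ler_wpM2l; first exact: sqr_ge0.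
apply: le_trans (sqr_sum_le _) _; rewrite card_ord.
by under eq_bigr do rewrite -exprM.
Qed.

Lemma indic_scale_pow4_le (A : set 'rV[R]_n) x (v : 'rV[R]_n) :
  norm2 (\1_A x *: v) ^+ 4 <= norm2 v ^+ 4.
Proof.
rewrite indicE; case: (_ \in _); first by rewrite scale1r.
by rewrite scale0r (exprM _ 2 2) norm2_sqrE big1 ?expr0n ?exprn_ge0 ?norm2_ge0// => i _; rewrite mxE expr0n.
Qed.

(** A bound for the square of [regular_part], up to a constant, by quantities
    that [smooth_moment_bounds] controls in mean. *)
Definition regular_majorant s y o : R :=
  norm2 (f0 (y + s *: o)) ^+ 4 + norm2 y ^+ 4 + noise_increment f0 s y o ^+ 2 / s ^+ 2 +
  \sum_(l < m) (norm2 (a l (y + s *: o)) ^+ 4 + noise_increment (a l) s y o ^+ 2 / s ^+ 2).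

(** The factor 3 comes from the square of a sum of three terms, and each factor 8
    from the fourth power of a sum of two vectors. *)
Definition regular_cst : R := 3 * (8 * (8 * (1 + m%:R + m%:R ^+ 3))).

Lemma regular_part_sqr_le s y o : s != 0 ->
  regular_part s y o ^+ 2 <= regular_cst * regular_majorant s y o.
Proof.
move=> s0; rewrite /regular_part /regular_majorant big_split/=; set z := y + s *: o.
set A := norm2 (g z - y) ^+ 2.
set D0 := noise_increment f0 s y o.
set E := \sum_(l < m) _ * _.
set SA := \sum_(l < m) norm2 _ ^+ 4.
set SD := \sum_(l < m) _ / _.
have SA0 : 0 <= SA by apply: sumr_ge0 => l _; rewrite exprn_ge0// norm2_ge0.
have SD0 : 0 <= SD by apply: sumr_ge0 => l _; rewrite divr_ge0 ?sqr_ge0.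
have F00 : 0 <= norm2 (f0 z) ^+ 4 by rewrite exprn_ge0// norm2_ge0.
have Y0 : 0 <= norm2 y ^+ 4 by rewrite exprn_ge0// norm2_ge0.
have D00 : 0 <= D0 ^+ 2 / s ^+ 2 by rewrite divr_ge0 ?sqr_ge0.
have M0 : 0 <= m%:R :> R by [].
have M30 : 0 <= m%:R ^+ 3 :> R by rewrite exprn_ge0.
have hE : E ^+ 2 / s ^+ 2 <= m%:R * SD.
  rewrite /SD -mulr_suml mulrA ler_pM2r ?invr_gt0 ?exprn_even_gt0//.
  apply: le_trans (sqr_sum_le _) _; rewrite card_ord ler_wpM2l//.
  apply: ler_sum => l _; rewrite exprMn ler_piMl ?sqr_ge0 ?indic_sqr_le1//.
have hA : A ^+ 2 <= 8 * (norm2 (f0 z) ^+ 4 + 8 * (m%:R ^+ 3 * SA + norm2 y ^+ 4)).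
  rewrite /A -exprM /piecewise -addrA.
  apply: le_trans (norm2D_pow4_le _ _) _; rewrite ler_wpM2l// lerD2l.
  apply: le_trans (norm2D_pow4_le _ _) _; rewrite ler_wpM2l//.
  have -> : norm2 (- y) = norm2 y.
    by rewrite /norm2 -scaleN1r dot_rVZl dot_rVZr mulrA mulrNN mulr1 mul1r.
  rewrite lerD2r; apply: le_trans (norm2_sum_pow4_le _) _; rewrite ler_wpM2l//.
  by apply: ler_sum => l _; exact: indic_scale_pow4_le.
have hS : (A + 2 / s * D0 + 2 / s * E) ^+ 2 <=
    3 * A ^+ 2 + 12 * (D0 ^+ 2 / s ^+ 2) + 12 * (E ^+ 2 / s ^+ 2).
  rewrite -subr_ge0 (_ : _ - _ = (A - 2 / s * D0) ^+ 2 + (A - 2 / s * E) ^+ 2 + (2 / s * D0 - 2 / s * E) ^+ 2); last by field.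
  by rewrite !addr_ge0 ?sqr_ge0.
apply: le_trans hS _; rewrite /regular_cst.
have h1 : 0 <= m%:R ^+ 3 * SA by exact: mulr_ge0.
have h2 : 0 <= m%:R * SD by exact: mulr_ge0.
have [h3 h4 h5] : [/\ 0 <= m%:R * (norm2 (f0 z) ^+ 4 + norm2 y ^+ 4 + D0 ^+ 2 / s ^+ 2 + SA) :> R,
   0 <= m%:R ^+ 3 * (norm2 (f0 z) ^+ 4 + norm2 y ^+ 4 + D0 ^+ 2 / s ^+ 2 + SD) :> R &
   0 <= 8 * SA].
  by split; apply: mulr_ge0 => //; do ?apply: addr_ge0.
lra.
Qed.

End one_replicate.

(** * Uniform bound on the regular part *)

Lemma measurable_joint d (T : measurableType d) (R : realType) (P : probability T R)
    n K (w : 'I_K -> {RV P >-> 'rV[R]_n}) : measurable_fun setT (joint w).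
Proof.
apply/measurable_fun_tnthP => k.
rewrite (_ : _ \o _ = w k); first exact: measurable_funPT.
by apply/funext => t; rewrite /= tnth_mktuple.
Qed.

HB.instance Definition _ d (T : measurableType d) (R : realType) (P : probability T R)
    n K (w : 'I_K -> {RV P >-> 'rV[R]_n}) :=
  isMeasurableFun.Build d _ T (K.-tuple 'rV[R]_n) (joint w) (measurable_joint w).

Section regular_part_bound.
Variables (R : realType) (n m : nat) (mu : 'rV[R]_n) (sigma : R).
Variables (f0 : 'rV[R]_n -> 'rV[R]_n) (a : 'I_m -> 'rV[R]_n -> 'rV[R]_n)
  (h : 'I_m -> 'rV[R]_n -> R).
Hypothesis sigma0 : sigma != 0.
Hypothesis smooth_f0 : smooth_moment mu sigma f0.
Hypothesis smooth_a : forall l, smooth_moment mu sigma (a l).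
Hypothesis mh : forall l, measurable_fun setT (h l).
Local Open Scope ereal_scope.
Local Notation N := (normal_rV mu sigma).
Local Notation M := (normal_rV (0 : 'rV[R]_n) sigma).

Lemma measurable_gate l : measurable_fun setT (\1_[set x | (0 < h l x)%R] : 'rV[R]_n -> R).
Proof.
apply: measurable_indic; rewrite -[X in measurable X]setTI.
by apply: measurable_fun_ltr => //; exact: measurable_cst.
Qed.

Lemma measurable_noise_increment d (T : measurableType d) f (s : R) (Y o : T -> 'rV[R]_n) :
  measurable_fun setT f -> measurable_fun setT Y -> measurable_fun setT o ->
  measurable_fun setT (fun t => noise_increment f s (Y t) (o t)).
Proof. by move=> mf mY mo; rewrite /noise_increment; meas. Qed.

Lemma measurable_piecewise : measurable_fun setT (piecewise f0 a h).
Proof.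
have [mf0 _] := smooth_f0.
apply: measurable_rV_add => //; apply: measurable_rV_sum => l.
by have [ma _] := smooth_a l; have mg := measurable_gate l; meas.
Qed.

Lemma measurable_regular_part d (T : measurableType d) (s : R) (Y o : T -> 'rV[R]_n) :
  measurable_fun setT Y -> measurable_fun setT o ->
  measurable_fun setT (fun t => regular_part f0 a h s (Y t) (o t)).
Proof.
move=> mY mo; rewrite /regular_part.
have mg := measurable_piecewise; have [mf0 _] := smooth_f0.
apply: measurable_funD; first apply: measurable_funD.
- by meas.
- by apply: measurable_funM => //; exact: measurable_noise_increment.
- apply: measurable_funM => //; apply: measurable_sum => l.
  have [ma _] := smooth_a l; have mgl := measurable_gate l.
  apply: measurable_funM; last exact: measurable_noise_increment.
  by meas.
Qed.

(** Integrate [regular_majorant]; for small [alpha] the bounds for [f0] and for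
    the finitely many [a l] hold simultaneously. *)
Lemma regular_part_bound : exists C : R, (0 <= C)%R /\
  \forall alpha \near 0^'+,
    \int[N]_y \int[M]_o (regular_part f0 a h (Num.sqrt alpha) y o ^+ 2)%:E <= C%:E.
Proof.
have [mf0 _] := smooth_f0.
have ma l : measurable_fun setT (a l) by have [] := smooth_a l.
have [C0 [C00 _ H0]] := smooth_moment_bounds sigma0 smooth_f0.
have /choice[Ca HCa] := fun l => smooth_moment_bounds sigma0 (smooth_a l).
have [Y4 Y40 EY] : exists2 B : R, (0 <= B)%R & \int[N]_z (norm2 z ^+ 4)%:E = B%:E.
  have := normal_rV_norm2_pow4 mu sigma0.
  have : 0 <= \int[N]_z (norm2 z ^+ 4)%:E.
    by apply: integral_ge0 => z _; rewrite lee_fin exprn_ge0// norm2_ge0.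
  by case: (\int[N]_z _) => [r| |]// r0 _; exists r.
have c0 : (0 <= regular_cst R m)%R.
  have m3 : (0 <= 1 + m%:R + m%:R ^+ 3 :> R)%R by rewrite addr_ge0// exprn_ge0.
  by rewrite /regular_cst; do 3 (apply: mulr_ge0 => //).
exists (regular_cst R m * (C0 + Y4 + C0 + \sum_(l < m) (Ca l + Ca l)))%R; split.
  have S0 : (0 <= \sum_(l < m) (Ca l + Ca l))%R.
    by apply: sumr_ge0 => l _; have [Ca0 _ _] := HCa l; exact: addr_ge0.
  by apply: mulr_ge0 => //; do !apply: addr_ge0 => //.
have Ha : \forall alpha \near 0^'+, forall l,
   \int[N]_y \int[M]_x (norm2 (a l (y + Num.sqrt alpha *: x)%R) ^+ 4)%:E <= (Ca l)%:E /\
   \int[N]_y \int[M]_x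
        (dot_rV x (a l (y + Num.sqrt alpha *: x) - a l y) ^+ 2 / alpha)%R%:E <= (Ca l)%:E.
  by apply: filter_forall => l; have [] := HCa l.
near=> alpha.
have a0 : (0 < alpha)%R by near: alpha; exact: nbhs_right_gt.
have [F4 FD] : 
   \int[N]_y \int[M]_x (norm2 (f0 (y + Num.sqrt alpha *: x)%R) ^+ 4)%:E <= C0%:E /\
   \int[N]_y \int[M]_x
        (dot_rV x (f0 (y + Num.sqrt alpha *: x) - f0 y) ^+ 2 / alpha)%R%:E <= C0%:E.
  by near: alpha.
have HA l : \int[N]_y \int[M]_x (norm2 (a l (y + Num.sqrt alpha *: x)%R) ^+ 4)%:E <= (Ca l)%:E /\
   \int[N]_y \int[M]_x
        (dot_rV x (a l (y + Num.sqrt alpha *: x) - a l y) ^+ 2 / alpha)%R%:E <= (Ca l)%:E.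
  by move: l; near: alpha.
set s := Num.sqrt alpha.
have s0 : s != 0%R by rewrite gt_eqF// sqrtr_gt0.
have s2 : (s ^+ 2 = alpha)%R by rewrite sqr_sqrtr// ltW.
pose J (F : 'rV[R]_n * 'rV[R]_n -> R) := \int[N \x M]_p (F p)%:E.
have JE (F : 'rV[R]_n * 'rV[R]_n -> R) : measurable_fun setT F -> (forall p, 0 <= F p)%R ->
    J F = \int[N]_y \int[M]_o (F (y, o))%:E.
  move=> mF F0; rewrite /J (ge0_integral_product N M (F := EFin \o F))//.
  exact/measurable_EFinP.
have JD (F G : 'rV[R]_n * 'rV[R]_n -> R) : measurable_fun setT F -> (forall p, 0 <= F p)%R ->
    measurable_fun setT G -> (forall p, 0 <= G p)%R ->
    J (fun p => F p + G p)%R = J F + J G.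
  move=> mF F0 mG G0; rewrite /J -ge0_integralD//.
  - by move=> p _; rewrite lee_fin.
  - exact/measurable_EFinP.
  - by move=> p _; rewrite lee_fin.
  - exact/measurable_EFinP.
have mfst : measurable_fun setT (fst : 'rV[R]_n * 'rV[R]_n -> 'rV[R]_n) by exact: measurable_fst.
have msnd : measurable_fun setT (snd : 'rV[R]_n * 'rV[R]_n -> 'rV[R]_n) by exact: measurable_snd.
pose A4 f (p : 'rV[R]_n * 'rV[R]_n) : R := (norm2 (f (p.1 + s *: p.2)%R : 'rV[R]_n) ^+ 4)%R.
pose DD f (p : 'rV[R]_n * 'rV[R]_n) : R := (noise_increment f s p.1 p.2 ^+ 2 / s ^+ 2)%R.
have mA4 f : measurable_fun setT f -> measurable_fun setT (A4 f) by move=> mf; rewrite /A4; meas.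
have mDD f : measurable_fun setT f -> measurable_fun setT (DD f).
  by move=> mf; rewrite /DD /noise_increment; meas.
have A40 f p : (0 <= A4 f p)%R by rewrite exprn_ge0// norm2_ge0.
have DD0 f p : (0 <= DD f p)%R by rewrite divr_ge0 ?sqr_ge0.
pose Y4f (p : 'rV[R]_n * 'rV[R]_n) : R := (norm2 p.1 ^+ 4)%R.
have mY4 : measurable_fun setT Y4f by rewrite /Y4f; meas.
have Y4f0 p : (0 <= Y4f p)%R by rewrite exprn_ge0// norm2_ge0.
pose G (p : 'rV[R]_n * 'rV[R]_n) : R := (\sum_(l < m) (A4 (a l) p + DD (a l) p))%R.
have mG : measurable_fun setT G.
  by apply: measurable_sum => l; apply: measurable_funD; [exact: mA4|exact: mDD].
have G0 p : (0 <= G p)%R by apply: sumr_ge0 => l _; rewrite addr_ge0.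
have JA4 : J (A4 f0) <= C0%:E by rewrite JE//; exact: mA4.
have JDD : J (DD f0) <= C0%:E by rewrite JE//; [rewrite /DD s2|exact: mDD].
have JY : J Y4f = Y4%:E.
  rewrite JE// -EY; apply: eq_integral => z _.
  rewrite /Y4f /= integral_cst// (_ : _ setT = 1) ?mule1//; exact: normal_rV_setT.
have JG : J G <= (\sum_(l < m) (Ca l + Ca l))%R%:E.
  rewrite /J /G; under eq_integral do rewrite -sumEFin.
  rewrite ge0_integral_sum//; last 2 first.
  - by move=> l; apply/measurable_EFinP; apply: measurable_funD; [exact: mA4|exact: mDD].
  - by move=> l p _; rewrite lee_fin addr_ge0.
  rewrite -sumEFin; apply: lee_sum => l _; have [h1 h2] := HA l.
  rewrite -[leLHS]/(J (fun p => A4 (a l) p + DD (a l) p)%R) JD//; [|exact: mA4|exact: mDD].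
  by rewrite EFinD; apply: leeD; rewrite JE//; [exact: mA4|rewrite /DD s2|exact: mDD].
pose major (p : 'rV[R]_n * 'rV[R]_n) : R := (A4 f0 p + Y4f p + DD f0 p + G p)%R.
have mmajor : measurable_fun setT major.
  apply: measurable_funD => //; apply: measurable_funD; last exact: mDD.
  by apply: measurable_funD => //; exact: mA4.
have major0 p : (0 <= major p)%R by rewrite !addr_ge0.
have Jmajor : J major <= (C0 + Y4 + C0 + \sum_(l < m) (Ca l + Ca l))%R%:E.
  rewrite /major JD//; last 2 first.
  - apply: measurable_funD; last exact: mDD.
    by apply: measurable_funD => //; exact: mA4.
  - by move=> p; rewrite !addr_ge0.
  rewrite JD//; last 3 first.
  - by apply: measurable_funD => //; exact: mA4.
  - by move=> p; rewrite !addr_ge0.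
  - exact: mDD.
  rewrite JD//; last exact: mA4.
  by rewrite 3!EFinD; do 2 (apply: leeD => //); apply: leeD => //; rewrite JY.
pose reg2 (p : 'rV[R]_n * 'rV[R]_n) : R := (regular_part f0 a h s p.1 p.2 ^+ 2)%R.
have mreg2 : measurable_fun setT reg2.
  by apply: measurable_funX; exact: measurable_regular_part.
rewrite -[leLHS]/(\int[N]_y \int[M]_o (reg2 (y, o))%:E) -JE//; last by move=> p; exact: sqr_ge0.
apply: (@le_trans _ _ ((regular_cst R m)%:E * J major)); last first.
  by rewrite [leRHS]EFinM; apply: lee_wpmul2l; [rewrite lee_fin|exact: Jmajor].
rewrite /J -ge0_integralZl; [|exact: measurableT|exact/measurable_EFinP|by move=> p _; rewrite lee_fin|by rewrite lee_fin].
apply: ge0_le_integralT.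
- exact/measurable_EFinP.
- by apply: emeasurable_funM => //; exact/measurable_EFinP.
- by move=> p; rewrite lee_fin sqr_ge0.
- by move=> p; rewrite -EFinM lee_fin; exact: regular_part_sqr_le.
Unshelve. all: by end_near. Qed.

End regular_part_bound.

(** * Resampling energy *)

Section resampling.
Context d1 d2 (T1 : measurableType d1) (T2 : measurableType d2) (R : realType).
Variables (mu : probability T1 R) (Q : probability T2 R).
Local Open Scope ereal_scope.

(** Twice the expected variance of [phi] given its first argument, when the two
    arguments are independent. In this form no conditional expectation occurs
    and functions of the first argument visibly contribute nothing. *)
Definition resampling_energy (phi : T1 * T2 -> R) : \bar R :=
  \int[mu]_y \int[Q]_x \int[Q]_x' ((phi (y, x) - phi (y, x')) ^+ 2)%:E.

Lemma measurable_resampling (phi : T1 * T2 -> R) : measurable_fun setT phi ->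
  measurable_fun setT (fun y => \int[Q]_x \int[Q]_x' ((phi (y, x) - phi (y, x')) ^+ 2)%:E).
Proof.
move=> mphi; apply: measurable_ge0_integral => [|y x]; last first.
  by apply: integral_ge0 => x' _; rewrite lee_fin sqr_ge0.
by apply: measurable_ge0_integral => [|p x']; [meas|rewrite lee_fin sqr_ge0].
Qed.

Lemma measurable_section (phi : T1 * T2 -> R) y : measurable_fun setT phi ->
  measurable_fun setT (fun x => phi (y, x)).
Proof. by move=> mphi; apply: (measurableT_comp mphi); exact: measurable_fun_pair. Qed.

Lemma resampling_energy_le (phi : T1 * T2 -> R) : measurable_fun setT phi ->
  resampling_energy phi <= 4%:E * \int[mu]_y \int[Q]_x (phi (y, x) ^+ 2)%:E.
Proof.
move=> mphi.
have m2 : measurable_fun setT (fun y => \int[Q]_x (phi (y, x) ^+ 2)%:E).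
  by apply: measurable_ge0_integral => [|y x]; [meas|rewrite lee_fin sqr_ge0].
rewrite -ge0_integralZl//; last first.
  by move=> y _; apply: integral_ge0 => x _; rewrite lee_fin sqr_ge0.
apply: ge0_le_integralT.
- exact: measurable_resampling.
- by apply: emeasurable_funM.
- by move=> y; apply: integral_ge0 => x _; apply: integral_ge0 => x' _; rewrite lee_fin sqr_ge0.
- by move=> y; apply: integral_sqr_difference_le; exact: measurable_section.
Qed.

(** The hypothesis compares differences at a common [y], so it is insensitive to
    adding functions of [y] to [f1], [f2] or [f3]. *)
Lemma resampling_energyD_le (f1 f2 f3 : T1 * T2 -> R) :
  measurable_fun setT f1 -> measurable_fun setT f2 -> measurable_fun setT f3 ->
  (forall y x x', (f1 (y, x) - f1 (y, x')) ^+ 2 <=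
    2 * (f2 (y, x) - f2 (y, x')) ^+ 2 + 2 * (f3 (y, x) - f3 (y, x')) ^+ 2)%R ->
  resampling_energy f1 <= 2%:E * resampling_energy f2 + 2%:E * resampling_energy f3.
Proof.
move=> m1 m2 m3 le123.
have pos (f : T1 * T2 -> R) y x x' : 0 <= ((f (y, x) - f (y, x')) ^+ 2)%:E by rewrite lee_fin sqr_ge0.
have pos1 (f : T1 * T2 -> R) y x : 0 <= \int[Q]_x' ((f (y, x) - f (y, x')) ^+ 2)%:E.
  by apply: integral_ge0.
have pos2 (f : T1 * T2 -> R) y : 0 <= \int[Q]_x \int[Q]_x' ((f (y, x) - f (y, x')) ^+ 2)%:E.
  by apply: integral_ge0.
have mR (f : T1 * T2 -> R) y : measurable_fun setT f -> measurable_fun setT (fun x => \int[Q]_x' ((f (y, x) - f (y, x')) ^+ 2)%:E).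
  move=> mf; apply: measurable_ge0_integral => //; meas.
have mS (f : T1 * T2 -> R) y x : measurable_fun setT f -> measurable_fun setT (fun x' => ((f (y, x) - f (y, x')) ^+ 2)%:E).
  by move=> mf; meas.
have mT := measurable_resampling.
have Zl (d : measure_display) (T : measurableType d) (m : {measure set T -> \bar R}) (F G : T -> \bar R) :
    measurable_fun setT F -> measurable_fun setT G -> (forall x, 0 <= F x) -> (forall x, 0 <= G x) ->
    \int[m]_x (2%:E * F x + 2%:E * G x) = 2%:E * \int[m]_x F x + 2%:E * \int[m]_x G x.
  move=> mF mG F0 G0; rewrite ge0_integralD//; last 4 first.
  - by move=> x _; exact: mule_ge0.
  - by apply: emeasurable_funM.
  - by move=> x _; exact: mule_ge0.
  - by apply: emeasurable_funM.
  by rewrite !ge0_integralZl.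
have mZ (d : measure_display) (T : measurableType d) (F G : T -> \bar R) :
    measurable_fun setT F -> measurable_fun setT G ->
    measurable_fun setT (fun x => 2%:E * F x + 2%:E * G x).
  by move=> mF mG; apply: emeasurable_funD; apply: emeasurable_funM.
rewrite /resampling_energy -Zl//; [|exact: mT|exact: mT].
apply: ge0_le_integralT => //; [exact: mT|by apply: mZ; exact: mT|move=> y].
rewrite -Zl//; [|exact: mR|exact: mR].
apply: ge0_le_integralT => //; [exact: mR|by apply: mZ; exact: mR|move=> x].
rewrite -Zl//; [|exact: mS|exact: mS].
apply: ge0_le_integralT => //; [exact: mS|by apply: mZ; exact: mS|move=> x'].
by rewrite -!EFinM -EFinD lee_fin.
Qed.

End resampling.

(** * Decomposition of the adjusted estimator *)

Section conditional_variance.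
Variables (R : realType) (n K m : nat) (mu : 'rV[R]_n) (sigma rho : R).
Context d (T : measurableType d) (P : probability T R).
Variables (Y : {RV P >-> 'rV[R]_n}) (w : 'I_K -> {RV P >-> 'rV[R]_n}).
Variables (f0 : 'rV[R]_n -> 'rV[R]_n) (a : 'I_m -> 'rV[R]_n -> 'rV[R]_n)
  (h : 'I_m -> 'rV[R]_n -> R).
Hypothesis K0 : (0 < K)%N.
Hypothesis sigma0 : sigma != 0.
Hypothesis lawY : has_law Y (normal_rV mu sigma).
Hypothesis indep : independent_joint Y w.
Hypothesis law_w : forall k, has_law (w k) (normal_rV (0 : 'rV[R]_n) sigma).
Hypothesis cov_w : forall k k', k != k' -> forall i j,
  covariance P (fun t => w k t 0 i) (fun t => w k' t 0 j) =
  (rho * sigma ^+ 2 * (i == j)%:R)%:E.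
Hypothesis smooth_f0 : smooth_moment mu sigma f0.
Hypothesis smooth_a : forall l, smooth_moment mu sigma (a l).
Hypothesis mh : forall l, measurable_fun setT (h l).
Local Open Scope ereal_scope.
Local Notation N := (normal_rV mu sigma).
Local Notation M := (normal_rV (0 : 'rV[R]_n) sigma).
Local Notation S := (K.-tuple 'rV[R]_n).

Definition noise_tuple : {RV P >-> S} := joint w.
Local Notation muY := (distribution P Y).
Local Notation Q := (distribution P noise_tuple).
Local Notation kappa := (total_noise_factor K sigma rho).

Let mf0 : measurable_fun setT f0. Proof. by have [] := smooth_f0. Qed.
Let ma l : measurable_fun setT (a l). Proof. by have [] := smooth_a l. Qed.
Let mw k : measurable_fun setT (w k). Proof. exact: measurable_funPT. Qed.
Let mY : measurable_fun setT Y. Proof. exact: measurable_funPT. Qed.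
Let K_neq0 : (K%:R != 0 :> R)%R. Proof. by rewrite pnatr_eq0 -lt0n. Qed.

Lemma noise_tupleE t k : tnth (noise_tuple t) k = w k t.
Proof. by rewrite /noise_tuple /= tnth_mktuple. Qed.

Lemma integral_noise_tuple k (F : 'rV[R]_n -> \bar R) : measurable_fun setT F ->
  (forall o, 0 <= F o) -> \int[Q]_x F (tnth x k) = \int[M]_o F o.
Proof.
move=> mF F0; rewrite (@ge0_integral_distribution _ _ _ _ _ _ noise_tuple (fun x => F (tnth x k)))//.
  rewrite -(ge0_expectation_has_law (law_w k))//.
  by apply: eq_integral => t _; rewrite /= noise_tupleE.
by meas.
Qed.

Lemma integral_Y_noise_tuple k (F : 'rV[R]_n * 'rV[R]_n -> \bar R) : measurable_fun setT F ->
  (forall p, 0 <= F p) ->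
  \int[muY]_y \int[Q]_x F (y, tnth x k) = \int[N]_y \int[M]_o F (y, o).
Proof.
move=> mF F0; rewrite (integral_has_law lawY); apply: eq_integral => y _.
by rewrite (integral_noise_tuple k (F := fun o => F (y, o)))//; meas.
Qed.

Definition linear_part (s : R) (p : 'rV[R]_n * S) : R :=
  (2 / (K%:R * s) * dot_rV (\sum_k tnth p.2 k) (f0 p.1 - p.1))%R.

Lemma measurable_linear_part s : measurable_fun setT (linear_part s).
Proof. by rewrite /linear_part; meas. Qed.

Lemma linear_part_mean0 s y : \int[Q]_x (linear_part s (y, x))%:E = 0.
Proof.
have mL : measurable_fun setT (fun x : S => linear_part s (y, x)).
  exact: measurable_section (measurable_linear_part s).
have iS : P.-integrable setT (fun t => (dot_rV (\sum_k w k t) (f0 y - y))%R%:E).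
  apply: (sqr_integrable measurableT (probability_setT P) _ _).2.
    by apply: measurable_dot_rV; meas; exact: mw.
  by rewrite (total_noise_second_moment sigma0 law_w cov_w) ltry.
have E t : linear_part s (y, noise_tuple t) =
    (2 / (K%:R * s) * dot_rV (\sum_k w k t) (f0 y - y))%R.
  by rewrite /linear_part /=; under eq_bigr do rewrite noise_tupleE.
rewrite integral_distribution//; last 2 first.
- exact/measurable_EFinP.
- rewrite (_ : _ \o _ = fun t => (2 / (K%:R * s))%:E * (dot_rV (\sum_k w k t) (f0 y - y))%R%:E).
    exact: integrableZl.
  by apply/funext => t; rewrite /= E EFinM.
under eq_integral do rewrite /= E EFinM.
by rewrite integralZl// (total_noise_mean0 sigma0 law_w) mule0.
Qed.

Lemma linear_part_second_moment s y : \int[Q]_x (linear_part s (y, x) ^+ 2)%:E =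
  ((2 / (K%:R * s)) ^+ 2 * kappa * norm2 (f0 y - y) ^+ 2)%:E.
Proof.
have mL : measurable_fun setT (fun x : S => linear_part s (y, x)).
  exact: measurable_section (measurable_linear_part s).
have E t : linear_part s (y, noise_tuple t) =
    (2 / (K%:R * s) * dot_rV (\sum_k w k t) (f0 y - y))%R.
  by rewrite /linear_part /=; under eq_bigr do rewrite noise_tupleE.
rewrite (@ge0_integral_distribution _ _ _ _ _ _ noise_tuple (fun x => (linear_part s (y, x) ^+ 2)%:E)); last 2 first.
- by apply/measurable_EFinP; apply: measurable_funX.
- by move=> x; rewrite lee_fin sqr_ge0.
rewrite -mulrA EFinM -(total_noise_second_moment sigma0 law_w cov_w) -ge0_integralZl//; last 3 first.
- by apply/measurable_EFinP; apply: measurable_funX; apply: measurable_dot_rV; meas; exact: mw.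
- by move=> t _; rewrite lee_fin sqr_ge0.
- by rewrite lee_fin sqr_ge0.
by apply: eq_integral => t _; rewrite /= E exprMn EFinM.
Qed.

(** For each [y] the linear part has mean zero, so its variance is its second
    moment. *)
Lemma linear_part_energy s : (0 <= kappa)%R ->
  resampling_energy muY Q (linear_part s) =
  (2 * (2 / (K%:R * s)) ^+ 2 * kappa)%R%:E * \int[N]_y (norm2 (f0 y - y)%R ^+ 2)%:E.
Proof.
move=> kappa0.
transitivity (\int[muY]_y ((2 * (2 / (K%:R * s)) ^+ 2 * kappa)%R%:E * (norm2 (f0 y - y)%R ^+ 2)%:E)).
  apply: eq_integral => y _.
  have mL : measurable_fun setT (fun x : S => linear_part s (y, x)).
    exact: measurable_section (measurable_linear_part s).
  rewrite -(@integral_sqr_deviation _ _ _ Q (fun x => linear_part s (y, x)))//; last first.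
    by rewrite linear_part_second_moment ltry.
  under eq_integral do rewrite linear_part_mean0 sube0 -EFin_expe.
  by rewrite linear_part_second_moment -!EFinM; congr EFin; ring.
have c0 : 0 <= (2 * (2 / (K%:R * s)) ^+ 2 * kappa)%R%:E.
  by rewrite lee_fin mulr_ge0// mulr_ge0// sqr_ge0.
rewrite (integral_has_law lawY) ge0_integralZl; [by []|exact: measurableT|by meas| |exact: c0].
by move=> y _; rewrite lee_fin sqr_ge0.
Qed.

Lemma bias_integrable : \int[N]_y (norm2 (f0 y - y)%R ^+ 2)%:E < +oo.
Proof.
have [C [C0 HC _]] := smooth_moment_bounds sigma0 smooth_f0.
have Y4 := normal_rV_norm2_pow4 mu sigma0.
apply: (@le_lt_trans _ _ (\int[N]_y (1%:E + (8%:E * (norm2 (f0 y) ^+ 4)%:E + 8%:E * (norm2 y ^+ 4)%:E)))).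
  apply: ge0_le_integralT.
  - by meas.
  - by meas.
  - by move=> y; rewrite lee_fin sqr_ge0.
  - move=> y; rewrite -!EFinM -!EFinD lee_fin.
    have := norm2D_pow4_le (f0 y) (- y).
    have -> : norm2 (- y) = norm2 y.
      by rewrite /norm2 -scaleN1r dot_rVZl dot_rVZr mulrA mulrNN mulr1 mul1r.
    have := sqr_ge0 (norm2 (f0 y - y) ^+ 2 - 1); rewrite (exprM (norm2 (f0 y - y)) 2 2).
    by move: (norm2 (f0 y - y) ^+ 2)%R => q; have := sqr_ge0 q; lra.
have p4 (v : 'rV[R]_n) : 0 <= (norm2 v ^+ 4)%:E by rewrite lee_fin exprn_ge0// norm2_ge0.
have m4 : measurable_fun setT (fun y => (norm2 (f0 y) ^+ 4)%:E) by meas.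
have m4' : measurable_fun setT (fun y : 'rV[R]_n => (norm2 y ^+ 4)%:E) by meas.
rewrite ge0_integralD//; last 2 first.
- by move=> y _; rewrite adde_ge0// mule_ge0.
- by apply: emeasurable_funD; apply: emeasurable_funM.
have -> : \int[N]_y 1%:E = 1 by rewrite integral_cst// mul1e; exact: normal_rV_setT.
rewrite ge0_integralD//; last 4 first.
- by move=> y _; rewrite mule_ge0.
- by apply: emeasurable_funM.
- by move=> y _; rewrite mule_ge0.
- by apply: emeasurable_funM.
rewrite !ge0_integralZl//.
rewrite lte_add_pinfty ?ltry// lte_add_pinfty// lte_mul_pinfty//.
exact: le_lt_trans HC (ltry _).
Qed.

Definition average_regular_part (s : R) (p : 'rV[R]_n * S) : R :=
  (K%:R^-1 * \sum_k regular_part f0 a h s p.1 (tnth p.2 k))%R.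

Let measurable_regular_pair s : measurable_fun setT
  (fun p : 'rV[R]_n * 'rV[R]_n => regular_part f0 a h s p.1 p.2).
Proof. exact: (measurable_regular_part smooth_f0 smooth_a mh). Qed.

Lemma measurable_average_regular_part s : measurable_fun setT (average_regular_part s).
Proof.
apply: measurable_funM => //; apply: measurable_sum => k.
by apply: (measurable_regular_part smooth_f0 smooth_a mh); meas.
Qed.

(** Convexity of the square: only the common law of the replicates enters, not
    their joint law. *)
Lemma average_regular_part_sqr_le s :
  \int[muY]_y \int[Q]_x (average_regular_part s (y, x) ^+ 2)%:E <=
  \int[N]_y \int[M]_o (regular_part f0 a h s y o ^+ 2)%:E.
Proof.
have mr := measurable_regular_pair s.
have Ki0 : (0 <= K%:R^-1 :> R)%R by rewrite invr_ge0.
pose F (p : 'rV[R]_n * 'rV[R]_n) : \bar R := (K%:R^-1 * regular_part f0 a h s p.1 p.2 ^+ 2)%:E.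
have mF : measurable_fun setT F by rewrite /F; meas.
have F0 p : 0 <= F p by rewrite lee_fin mulr_ge0// sqr_ge0.
have mFk k : measurable_fun setT (fun p : 'rV[R]_n * S => F (p.1, tnth p.2 k)) by meas.
have mFky k y : measurable_fun setT (fun x : S => F (y, tnth x k)) by meas.
have mIF k : measurable_fun setT (fun y => \int[Q]_x F (y, tnth x k)).
  exact: (@measurable_ge0_integral _ _ _ _ _ _ (fun y (x : S) => F (y, tnth x k))).
have ma2 : measurable_fun setT (fun p : 'rV[R]_n * S => (average_regular_part s p ^+ 2)%:E).
  by apply/measurable_EFinP; apply: measurable_funX; exact: measurable_average_regular_part.
apply: (@le_trans _ _ (\int[muY]_y \sum_k \int[Q]_x F (y, tnth x k))).
  apply: ge0_le_integralT.
  - apply: measurable_ge0_integral => [|y x]; last by rewrite lee_fin sqr_ge0.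
    by under eq_fun do rewrite -surjective_pairing.
  - exact: emeasurable_sum.
  - by move=> y; apply: integral_ge0 => x _; rewrite lee_fin sqr_ge0.
  - move=> y; rewrite -ge0_integral_sum//.
    apply: ge0_le_integralT.
    + by apply: (measurableT_comp ma2); exact: measurable_fun_pair.
    + exact: emeasurable_sum.
    + by move=> x; rewrite lee_fin sqr_ge0.
    + move=> x; rewrite /F sumEFin lee_fin /average_regular_part/= -mulr_sumr exprMn expr2 -mulrA.
      rewrite ler_wpM2l// mulrC ler_pdivrMr ?ltr0n// mulrC.
      by apply: le_trans (sqr_sum_le _) _; rewrite card_ord.
rewrite ge0_integral_sum//; last by move=> k y _; exact: integral_ge0.
under eq_bigr do rewrite integral_Y_noise_tuple//.
pose R2 := \int[N]_y \int[M]_o (regular_part f0 a h s y o ^+ 2)%:E.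
have mI : measurable_fun setT (fun y => \int[M]_o (regular_part f0 a h s y o ^+ 2)%:E).
  by apply: measurable_ge0_integral => [|y o]; [meas|rewrite lee_fin sqr_ge0].
have -> : \int[N]_y \int[M]_o F (y, o) = (K%:R^-1)%:E * R2.
  have Ki0E : 0 <= (K%:R^-1 : R)%:E by rewrite lee_fin.
  have sq0 y o : 0 <= (regular_part f0 a h s y o ^+ 2)%:E by rewrite lee_fin sqr_ge0.
  have mo y : measurable_fun setT (fun o => (regular_part f0 a h s y o ^+ 2)%:E).
    by apply/measurable_EFinP; apply: measurable_funX;
       apply: (measurable_regular_part smooth_f0 smooth_a mh); meas.
  rewrite /R2 -ge0_integralZl; [|exact: measurableT|exact: mI| |exact: Ki0E]; last first.
    by move=> y _; exact: integral_ge0.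
  apply: eq_integral => y _.
  rewrite -ge0_integralZl; [|exact: measurableT|exact: mo|by []|exact: Ki0E].
  by apply: eq_integral => o _; rewrite /F EFinM.
rewrite -/R2.
have R20 : 0 <= R2.
  by apply: integral_ge0 => y _; apply: integral_ge0 => o _; rewrite lee_fin sqr_ge0.
move: R20; move: (R2) => r2 R20.
case: r2 R20 => [r _|_|//]; last by rewrite leey.
by rewrite -EFinM sumEFin lee_fin sumr_const card_ord -(mulr_natl (_ * r)%R) mulrA divff// mul1r.
Qed.

(** A function of the pair (signal, replicates), so that its conditional mean is
    found by integrating the replicates out. *)
Definition gate_coord (l : 'I_m) (k : 'I_K) (s : R) (i : 'I_n) (p : 'rV[R]_n * S) : R :=
  (\1_[set z | (0 < h l z)%R] (p.1 + s *: tnth p.2 k) *: tnth p.2 k)%R 0%R i.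

Lemma measurable_gate_coord l k s i : measurable_fun setT (gate_coord l k s i).
Proof. by rewrite /gate_coord; have mg := measurable_gate mh l; meas. Qed.

Lemma gate_coord_second_moment l k s i y :
  \int[Q]_x (gate_coord l k s i (y, x) ^+ 2)%:E <= (sigma ^+ 2)%:E.
Proof.
rewrite -(normal_rV_second_moment i sigma0).
rewrite -(integral_noise_tuple k (F := fun o => (o 0%R i ^+ 2)%:E)); last 2 first.
- by meas.
- by move=> o; rewrite lee_fin sqr_ge0.
apply: ge0_le_integralT.
- apply/measurable_EFinP; apply: measurable_funX.
  exact: measurable_section (measurable_gate_coord l k s i).
- by meas.
- by move=> x; rewrite lee_fin sqr_ge0.
- move=> x; rewrite lee_fin /gate_coord mxE exprMn ler_piMl ?sqr_ge0 ?indic_sqr_le1//.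
Qed.

Lemma gate_coord_square_integrable l k s i :
  \int[muY]_y \int[Q]_x (gate_coord l k s i (y, x) ^+ 2)%:E < +oo.
Proof.
have mg := measurable_gate_coord l k s i.
apply: (@le_lt_trans _ _ (\int[muY]_y (sigma ^+ 2)%:E)).
  apply: ge0_le_integralT => //.
  - apply: measurable_ge0_integral => [|y x]; last by rewrite lee_fin sqr_ge0.
    by meas.
  - by move=> y; apply: integral_ge0 => x _; rewrite lee_fin sqr_ge0.
  - by move=> y; exact: gate_coord_second_moment.
by rewrite integral_cst// [X in _ * X](probability_setT muY) mule1 ltry.
Qed.

Definition control_mean (l : 'I_m) (k : 'I_K) (s : R) (y : 'rV[R]_n) : 'rV[R]_n :=
  (\row_i fine (mean_section noise_tuple (gate_coord l k s i) y))%R.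

Let indep_tuple : forall A B, measurable A -> measurable B ->
  P (Y @^-1` A `&` noise_tuple @^-1` B) = P (Y @^-1` A) * P (noise_tuple @^-1` B).
Proof. exact: indep. Qed.

Lemma measurable_control_mean l k s : measurable_fun setT (control_mean l k s).
Proof.
apply/measurable_fun_matrixP => i j; under eq_fun do rewrite mxE.
apply: measurableT_comp => //.
exact: (measurable_mean_section (measurable_gate_coord l k s j)
         (gate_coord_square_integrable l k s j)).
Qed.

Lemma control_mean_le l k s y : (norm2 (control_mean l k s y) ^+ 2 <= n%:R * sigma ^+ 2)%R.
Proof.
rewrite norm2_sqrE.
have -> : (n%:R * sigma ^+ 2 = \sum_(i < n) sigma ^+ 2)%R.
  by rewrite sumr_const card_ord mulr_natl.
apply: ler_sum => i _; rewrite mxE -lee_fin.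
have mg : measurable_fun setT (fun x : S => gate_coord l k s i (y, x)).
  exact: measurable_section (measurable_gate_coord l k s i).
have g2oo := le_lt_trans (gate_coord_second_moment l k s i y) (ltry _).
apply: le_trans (gate_coord_second_moment l k s i y).
apply: (sqr_integral_le measurableT (probability_setT Q) mg).
rewrite fineK//; apply: integrable_fin_num => //.
exact: (sqr_integrable measurableT (probability_setT Q) mg g2oo).2.
Qed.

Let gated_noise_coordE l k alpha i :
  (fun t => gated_noise Y w (h l) alpha k t 0%R i) =
  (fun t => gate_coord l k (Num.sqrt alpha) i (Y t, noise_tuple t)).
Proof. by apply/funext => t; rewrite /gate_coord /gated_noise /= noise_tupleE. Qed.

Let cond_exp_gated_noise_coord l k alpha i :
  P.-integrable setT (fun t => (gated_noise Y w (h l) alpha k t 0%R i)%:E) /\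
  ae_eq P setT (cond_exp P Y (fun t => (gated_noise Y w (h l) alpha k t 0%R i)%:E))
    (mean_section noise_tuple (gate_coord l k (Num.sqrt alpha) i) \o Y).
Proof.
apply: (cond_exp_independent indep_tuple (measurable_gate_coord l k _ i)
  (gate_coord_square_integrable l k _ i) (X := fun t => gated_noise Y w (h l) alpha k t 0%R i)).
  rewrite gated_noise_coordE; apply: (measurableT_comp (measurable_gate_coord l k _ i)).
  exact: measurable_fun_pair.
by apply: aeW => t _; exact: (congr1 (fun q => q t) (gated_noise_coordE l k alpha i)).
Qed.

Lemma gated_noise_integrable l k alpha i :
  P.-integrable setT (fun t => (gated_noise Y w (h l) alpha k t 0%R i)%:E).
Proof. by have [] := cond_exp_gated_noise_coord l k alpha i. Qed.

Lemma cond_exp_gated_noise l k (alpha : R) :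
  {ae P, forall t, cond_exp_rV P Y (gated_noise Y w (h l) alpha k) t =
    control_mean l k (Num.sqrt alpha) (Y t)}.
Proof.
pose s := Num.sqrt alpha.
have : {ae P, forall t, forall i, cond_exp P Y (fun u => (gated_noise Y w (h l) alpha k u 0%R i)%:E) t =
    mean_section noise_tuple (gate_coord l k s i) (Y t)}.
  apply: filter_forall => i.
  by have [_ H] := cond_exp_gated_noise_coord l k alpha i; apply: filterS H => t /(_ I).
by apply: filterS => t Ht; apply/rowP => i; rewrite !mxE Ht.
Qed.

(** The conditional means in the control variate depend on the signal alone; they
    carry no resampling energy. *)
Definition control_part (s : R) (y : 'rV[R]_n) : R :=
  (2 / (K%:R * s) * \sum_k \sum_(l < m) dot_rV (a l y) (control_mean l k s y))%R.

Lemma measurable_control_part s : measurable_fun setT (control_part s).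
Proof.
apply: measurable_funM => //; apply: measurable_sum => k; apply: measurable_sum => l.
by have mc := measurable_control_mean l k s; have mal := ma l; meas.
Qed.

Lemma control_part_square_integrable s : \int[N]_y (control_part s y ^+ 2)%:E < +oo.
Proof.
have mc := measurable_control_part s.
pose c : R := ((2 / (K%:R * s)) ^+ 2 * (K * m)%:R * (n%:R * sigma ^+ 2))%R.
have c0 : (0 <= c)%R by apply: mulr_ge0; apply: mulr_ge0; rewrite ?sqr_ge0.
have mr (p : 'I_K * 'I_m) : measurable_fun setT (fun y => (1 + norm2 (a p.2 y) ^+ 4)%:E).
  by have mal := ma p.2; meas.
apply: (@le_lt_trans _ _ (\int[N]_y \sum_(p : 'I_K * 'I_m) c%:E * (1 + norm2 (a p.2 y) ^+ 4)%:E)).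
  apply: ge0_le_integralT.
  - by meas.
  - by apply: emeasurable_sum => p; apply: emeasurable_funM.
  - by move=> y; rewrite lee_fin sqr_ge0.
  - move=> y; under eq_bigr do rewrite -EFinM.
    rewrite sumEFin lee_fin /control_part pair_bigA exprMn.
    apply: (@le_trans _ _ ((2 / (K%:R * s)) ^+ 2 * ((K * m)%:R *
        \sum_(p : 'I_K * 'I_m) dot_rV (a p.2 y) (control_mean p.2 p.1 s y) ^+ 2))%R).
      rewrite ler_wpM2l ?sqr_ge0//; apply: le_trans (sqr_sum_le _) _.
      by rewrite card_prod !card_ord.
    rewrite mulrA !mulr_sumr; apply: ler_sum => p _; rewrite /c -[leRHS]mulrA.
    apply: ler_wpM2l; first by apply: mulr_ge0; rewrite ?sqr_ge0.
    apply: le_trans (dot_rV_sqr_le _ _) _; rewrite mulrC.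
    apply: ler_pM; rewrite ?sqr_ge0 ?control_mean_le//.
    have := sqr_ge0 (norm2 (a p.2 y) ^+ 2 - 1); rewrite (exprM (norm2 (a p.2 y)) 2 2).
    by move: (norm2 (a p.2 y) ^+ 2)%R => q; have := sqr_ge0 q; lra.
have cE0 : 0 <= c%:E by rewrite lee_fin.
have m4 (p : 'I_K * 'I_m) : measurable_fun setT (fun y => (norm2 (a p.2 y) ^+ 4)%:E).
  by have mal := ma p.2; meas.
have p4 (p : 'I_K * 'I_m) y : 0 <= (norm2 (a p.2 y) ^+ 4)%:E.
  by rewrite lee_fin exprn_ge0// norm2_ge0.
have r0 (p : 'I_K * 'I_m) y : 0 <= (1 + norm2 (a p.2 y) ^+ 4)%:E.
  by rewrite EFinD adde_ge0.
rewrite ge0_integral_sum//; last 2 first.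
- by move=> p; apply: emeasurable_funM.
- by move=> p y _; rewrite mule_ge0.
apply: lte_sum_pinfty => p _.
have [C [C0 HC _]] := smooth_moment_bounds sigma0 (smooth_a p.2).
rewrite ge0_integralZl; [|exact: measurableT|exact: mr|by []|exact: cE0].
rewrite lte_mul_pinfty//; under eq_integral do rewrite EFinD.
rewrite ge0_integralD; [|exact: measurableT|by []|by []|by []|exact: m4].
have -> : \int[N]_y 1 = 1 by rewrite integral_cst// mul1e; exact: normal_rV_setT.
rewrite lte_add_pinfty ?ltry//.
exact: le_lt_trans HC (ltry _).
Qed.

Definition estimator_kernel (s : R) (p : 'rV[R]_n * S) : R :=
  (average_regular_part s p + linear_part s p + control_part s p.1)%R.

Lemma measurable_estimator_kernel s : measurable_fun setT (estimator_kernel s).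
Proof.
apply: measurable_funD; last exact: (measurableT_comp (measurable_control_part s) measurable_fst).
by apply: measurable_funD;
  [exact: measurable_average_regular_part|exact: measurable_linear_part].
Qed.

Lemma estimator_kernel_square_integrable s :
  \int[N]_y \int[M]_o (regular_part f0 a h s y o ^+ 2)%:E < +oo ->
  (0 <= kappa)%R ->
  \int[muY]_y \int[Q]_x (estimator_kernel s (y, x) ^+ 2)%:E < +oo.
Proof.
move=> Boo kappa0.
pose I (f : 'rV[R]_n * S -> R) := \int[muY]_y \int[Q]_x (f (y, x) ^+ 2)%:E.
pose V (p : 'rV[R]_n * S) := control_part s p.1.
have mV : measurable_fun setT V by exact: (measurableT_comp (measurable_control_part s) measurable_fst).
have mA := measurable_average_regular_part s; have mL := measurable_linear_part s.
have mE := measurable_estimator_kernel s.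
have msq (f : 'rV[R]_n * S -> R) : measurable_fun setT f -> measurable_fun setT (fun p : 'rV[R]_n * S => (f p ^+ 2)%:E).
  by move=> mf; apply/measurable_EFinP; apply: measurable_funX.
have mI (f : 'rV[R]_n * S -> R) : measurable_fun setT f -> measurable_fun setT (fun y => \int[Q]_x (f (y, x) ^+ 2)%:E).
  move=> mf; apply: measurable_ge0_integral => [|y x]; last by rewrite lee_fin sqr_ge0.
  by under eq_fun do rewrite -surjective_pairing; exact: msq.
have mS (f : 'rV[R]_n * S -> R) y : measurable_fun setT f -> measurable_fun setT (fun x : S => (f (y, x) ^+ 2)%:E).
  by move=> mf; apply/measurable_EFinP; apply: measurable_funX; exact: measurable_section.
have p0 (f : 'rV[R]_n * S -> R) y x : 0 <= (f (y, x) ^+ 2)%:E by rewrite lee_fin sqr_ge0.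
have pI (f : 'rV[R]_n * S -> R) y : 0 <= \int[Q]_x (f (y, x) ^+ 2)%:E by exact: integral_ge0.
have t0 : 0 <= (3%:E : \bar R) by rewrite lee_fin.
have sum3 y : \int[Q]_x (estimator_kernel s (y, x) ^+ 2)%:E <=
    3%:E * (\int[Q]_x (average_regular_part s (y, x) ^+ 2)%:E +
            \int[Q]_x (linear_part s (y, x) ^+ 2)%:E + \int[Q]_x (V (y, x) ^+ 2)%:E).
  rewrite -ge0_integralD; [|exact: measurableT|by []|exact: mS|by []|exact: mS].
  have mAL : measurable_fun setT (fun x => (average_regular_part s (y, x) ^+ 2)%:E + (linear_part s (y, x) ^+ 2)%:E).
    by apply: emeasurable_funD; exact: mS.
  rewrite -ge0_integralD; [|exact: measurableT|by move=> x _; rewrite adde_ge0|exact: mAL|by []|exact: mS].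
  have mALV := emeasurable_funD mAL (mS V y mV).
  rewrite -ge0_integralZl; [|exact: measurableT|exact: mALV|by move=> x _; rewrite !adde_ge0|exact: t0].
  apply: ge0_le_integralT; [exact: mS|by apply: emeasurable_funM => //; exact: mALV|by []|move=> x].
  rewrite -!EFinD -EFinM lee_fin /estimator_kernel -/(V (y, x)).
  move: (average_regular_part s (y, x)) (linear_part s (y, x)) (V (y, x)) => b l v.
  by have := sqr_ge0 (b - l)%R; have := sqr_ge0 (b - v)%R; have := sqr_ge0 (l - v)%R; lra.
have mAL : measurable_fun setT (fun y => \int[Q]_x (average_regular_part s (y, x) ^+ 2)%:E +
            \int[Q]_x (linear_part s (y, x) ^+ 2)%:E).
  by apply: emeasurable_funD; exact: mI.
have mALV := emeasurable_funD mAL (mI V mV).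
apply: (@le_lt_trans _ _ (3%:E * (I (average_regular_part s) + I (linear_part s) + I V))).
  rewrite /I -ge0_integralD; [|exact: measurableT|by []|exact: mI|by []|exact: mI].
  rewrite -ge0_integralD; [|exact: measurableT|by move=> y _; apply: adde_ge0; exact: pI|exact: mAL|by []|exact: mI].
  rewrite -ge0_integralZl; [|exact: measurableT|exact: mALV|by move=> y _; apply: adde_ge0; [apply: adde_ge0|]; exact: pI|exact: t0].
  by apply: ge0_le_integralT; [exact: mI|by apply: emeasurable_funM => //; exact: mALV| |].
have Aoo : I (average_regular_part s) < +oo.
  exact: le_lt_trans (average_regular_part_sqr_le s) Boo.
have Loo : I (linear_part s) < +oo.
  rewrite /I; under eq_integral do rewrite linear_part_second_moment EFinM.
  have c0 : 0 <= ((2 / (K%:R * s)) ^+ 2 * kappa)%R%:E.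
    by rewrite lee_fin mulr_ge0 ?sqr_ge0.
  rewrite (integral_has_law lawY) ge0_integralZl; [|exact: measurableT|by meas| |exact: c0].
    by rewrite lte_mul_pinfty// bias_integrable.
  by move=> y _; rewrite lee_fin sqr_ge0.
have Voo : I V < +oo.
  rewrite /I (_ : (fun y => _) = fun y => (control_part s y ^+ 2)%:E).
    by rewrite (integral_has_law lawY) control_part_square_integrable.
  apply/funext => y; rewrite /V/= integral_cst// [X in _ * X](probability_setT Q) mule1//.
move: (I _) (I _) (I _) Aoo Loo Voo => A L C Aoo Loo Voo.
by rewrite lte_mul_pinfty// lte_add_pinfty// lte_add_pinfty.
Qed.

(** The identity of [replicate_decomposition], averaged over the replicates; it
    holds almost surely since conditional expectations are versions. *)
Lemma adjusted_CVE alpha : (0 < alpha)%R ->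
  ae_eq P setT (adjusted_CV Y w (piecewise f0 a h) a h alpha)
    (fun t => estimator_kernel (Num.sqrt alpha) (Y t, noise_tuple t)).
Proof.
move=> alpha0; set s := Num.sqrt alpha.
have s0 : (s != 0)%R by rewrite sqrtr_eq0 -ltNge.
have : {ae P, forall t, forall l k,
    cond_exp_rV P Y (gated_noise Y w (h l) alpha k) t = control_mean l k s (Y t)}.
  by apply: filter_forall => l; apply: filter_forall => k; exact: cond_exp_gated_noise.
apply: filterS => t Ht _.
have wE : tnth (noise_tuple t) = w^~ t by apply/funext => k; exact: noise_tupleE.
rewrite /adjusted_CV /CV /control_variate /estimator_kernel /average_regular_part
  /linear_part /control_part wE /= -/s.
under [X in (_ + _ * X)%R]eq_bigr do under eq_bigr do rewrite /residual Ht /gated_noise -/s.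
have -> : alpha^-1%R = ((s ^+ 2)^-1)%R by rewrite sqr_sqrtr// ltW.
rewrite (_ : (2 / (K%:R * s) = K%:R^-1 * (2 / s))%R); last by field; rewrite ?s0 ?K_neq0.
rewrite -!mulrA -mulrDr [X in _ = X](_ : _ = (K%:R^-1 * (\sum_k (regular_part f0 a h s (Y t) (w k t) +
   2 / s * dot_rV (w k t) (f0 (Y t) - Y t) + 2 / s * \sum_(l < m) dot_rV (a l (Y t)) (control_mean l k s (Y t)))))%R).
  congr (_ * _)%R; rewrite !mulr_sumr -big_split/=; apply: eq_bigr => k _.
  by rewrite -replicate_decomposition// mulrA.
rewrite !big_split/= -!mulr_sumr dot_rV_suml !mulrDr.
by rewrite !mulrA.
Qed.

Lemma measurable_cond_exp_gated_noise l k alpha :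
  measurable_fun setT (cond_exp_rV P Y (gated_noise Y w (h l) alpha k)).
Proof.
apply/measurable_fun_matrixP => i j; under eq_fun do rewrite mxE.
apply: measurableT_comp => //; apply: (@sigma_measurable _ _ _ P _ _ Y).
exact: (cond_expP Y (gated_noise_integrable l k alpha j)).1.
Qed.

Lemma measurable_adjusted_CV alpha :
  measurable_fun setT (adjusted_CV Y w (piecewise f0 a h) a h alpha).
Proof.
have mp := measurable_piecewise smooth_f0 smooth_a mh.
apply: measurable_funD; apply: measurable_funM => //; apply: measurable_sum => k.
  by have mwk := mw k; meas.
apply: measurable_sum => l; apply: measurable_dot_rV.
  exact: (measurableT_comp (ma l) mY).
apply: measurable_rV_add; first exact: measurable_cond_exp_gated_noise.
apply: measurable_rV_opp; rewrite /gated_noise.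
by have mg := measurable_gate mh l; have mwk := mw k; meas.
Qed.

Lemma expected_cond_var alpha : (0 < alpha)%R -> (0 <= kappa)%R ->
  \int[N]_y \int[M]_o (regular_part f0 a h (Num.sqrt alpha) y o ^+ 2)%:E < +oo ->
  2%:E * \int[P]_t cond_var P Y (adjusted_CV Y w (piecewise f0 a h) a h alpha) t =
  resampling_energy muY Q (estimator_kernel (Num.sqrt alpha)).
Proof.
move=> alpha0 kappa0 Boo.
exact: (integral_cond_var_independent indep_tuple
  (measurable_estimator_kernel _) (estimator_kernel_square_integrable Boo kappa0)
  (measurable_adjusted_CV alpha) (adjusted_CVE alpha0)).
Qed.

Lemma average_regular_part_energy_le s :
  resampling_energy muY Q (average_regular_part s) <=
  4%:E * \int[N]_y \int[M]_o (regular_part f0 a h s y o ^+ 2)%:E.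
Proof.
apply: le_trans (resampling_energy_le _ _ (measurable_average_regular_part s)) _.
by rewrite lee_pmul2l ?lte_fin//; exact: average_regular_part_sqr_le.
Qed.

Lemma estimator_kernel_energy_le s :
  resampling_energy muY Q (estimator_kernel s) <=
  2%:E * resampling_energy muY Q (average_regular_part s) +
  2%:E * resampling_energy muY Q (linear_part s).
Proof.
apply: resampling_energyD_le; [exact: measurable_estimator_kernel|
  exact: measurable_average_regular_part|exact: measurable_linear_part|].
move=> y x x'; rewrite /estimator_kernel/=.
move: (average_regular_part s (y, x)) (average_regular_part s (y, x')) => b b'.
move: (linear_part s (y, x)) (linear_part s (y, x')) (control_part s y) => l l' v.
by have := sqr_ge0 ((b - b') - (l - l'))%R; lra.
Qed.

Lemma linear_part_energy_le s :
  resampling_energy muY Q (linear_part s) <=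
  2%:E * resampling_energy muY Q (estimator_kernel s) +
  2%:E * resampling_energy muY Q (average_regular_part s).
Proof.
apply: resampling_energyD_le; [exact: measurable_linear_part|
  exact: measurable_estimator_kernel|exact: measurable_average_regular_part|].
move=> y x x'; rewrite /estimator_kernel/=.
move: (average_regular_part s (y, x)) (average_regular_part s (y, x')) => b b'.
move: (linear_part s (y, x)) (linear_part s (y, x')) (control_part s y) => l l' v.
by have := sqr_ge0 (2 * (b - b') + (l - l'))%R; lra.
Qed.

(** The linear part vanishes in mean square, and only the regular part is
    left. *)
Lemma bounded_expected_cond_var : kappa = 0%R ->
  exists C : R, \forall alpha \near 0^'+,
    \int[P]_t cond_var P Y (adjusted_CV Y w (piecewise f0 a h) a h alpha) t <= C%:E.
Proof.
move=> kappa0; have [C [C0 HC]] := regular_part_bound sigma0 smooth_f0 smooth_a mh.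
exists (4 * C)%R; near=> alpha.
have alpha0 : (0 < alpha)%R by near: alpha; exact: nbhs_right_gt.
have HCa : \int[N]_y \int[M]_o (regular_part f0 a h (Num.sqrt alpha) y o ^+ 2)%:E <= C%:E.
  by near: alpha.
have kappa0' : (0 <= kappa)%R by rewrite kappa0.
have E := expected_cond_var alpha0 kappa0' (le_lt_trans HCa (ltry C)).
rewrite -(@lee_pmul2l _ 2%:E)// ?lte_fin// E.
apply: le_trans (estimator_kernel_energy_le _) _.
rewrite linear_part_energy// kappa0 mulr0 mul0e mule0 adde0 -EFinM.
rewrite EFinM lee_pmul2l ?lte_fin//.
apply: le_trans (average_regular_part_energy_le _) _.
by rewrite EFinM lee_pmul2l ?lte_fin.
Unshelve. all: by end_near. Qed.

(** The linear part is the estimator minus its regular part, up to functions of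
    the signal, so a bounded conditional variance would bound its energy; but
    that energy is exactly of order [1 / alpha]. *)
Lemma unbounded_expected_cond_var : (0 < kappa)%R ->
  0 < \int[N]_y (norm2 (f0 y - y)%R ^+ 2)%:E ->
  ~ exists C : R, \forall alpha \near 0^'+,
    \int[P]_t cond_var P Y (adjusted_CV Y w (piecewise f0 a h) a h alpha) t <= C%:E.
Proof.
move=> kappa0 beta0 [C' HC'].
have [C [C0 HC]] := regular_part_bound sigma0 smooth_f0 smooth_a mh.
have [b b0 bE] : exists2 b : R, (0 < b)%R & \int[N]_y (norm2 (f0 y - y)%R ^+ 2)%:E = b%:E.
  by move: beta0 bias_integrable; case: (\int[N]_y _) => [b| |]//; rewrite lte_fin => b0 _; exists b.
pose B := (4 * C' + 8 * C)%R.
have KB0 : (0 < K%:R ^+ 2 * (`|B| + 1) :> R)%R.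
  by rewrite mulr_gt0 ?exprn_even_gt0//= ltr_wpDl.
(* For alpha < eps the energy of the linear part exceeds `|B| + 1. *)
pose eps := (8 * kappa * b / (K%:R ^+ 2 * (`|B| + 1)))%R.
have eps0 : (0 < eps)%R by apply: divr_gt0 => //; apply: mulr_gt0 => //; exact: mulr_gt0.
have [alpha [alpha0 alphaeps HCa HCa']] : exists alpha : R, [/\ (0 < alpha)%R, (alpha < eps)%R,
    \int[N]_y \int[M]_o (regular_part f0 a h (Num.sqrt alpha) y o ^+ 2)%:E <= C%:E &
    \int[P]_t cond_var P Y (adjusted_CV Y w (piecewise f0 a h) a h alpha) t <= C'%:E].
  apply: (@filter_ex _ (0%R : R)^'+); near=> alpha; split; near: alpha => //.
  - exact: nbhs_right_gt.
  - exact: nbhs_right_lt.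
have E := expected_cond_var alpha0 (ltW kappa0) (le_lt_trans HCa (ltry C)).
have : resampling_energy muY Q (linear_part (Num.sqrt alpha)) <= B%:E.
  apply: le_trans (linear_part_energy_le _) _; rewrite -E /B [leRHS]EFinD.
  have -> : (4 * C' = 2 * (2 * C'))%R by ring.
  have -> : (8 * C = 2 * (4 * C))%R by ring.
  apply: leeD; rewrite [leRHS]EFinM lee_pmul2l ?lte_fin// [leRHS]EFinM.
    by rewrite lee_pmul2l ?lte_fin.
  apply: le_trans (average_regular_part_energy_le _) _.
  by rewrite lee_pmul2l ?lte_fin.
rewrite linear_part_energy ?(ltW kappa0)// bE -EFinM lee_fin.
have -> : (2 * (2 / (K%:R * Num.sqrt alpha)) ^+ 2 * kappa * b = 8 * kappa * b / (K%:R ^+ 2 * alpha))%R.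
  have s0 : (Num.sqrt alpha != 0)%R by rewrite sqrtr_eq0 -ltNge.
  rewrite -[in RHS](sqr_sqrtr (ltW alpha0)); field.
  by rewrite s0 K_neq0.
apply/negP; rewrite -ltNge; apply: (le_lt_trans (y := `|B|%R)); first exact: ler_norm.
have Ka0 : (0 < K%:R ^+ 2 * alpha :> R)%R by rewrite mulr_gt0// exprn_even_gt0.
rewrite ltr_pdivlMr//.
move: alphaeps; rewrite /eps ltr_pdivlMr//; apply: le_lt_trans.
rewrite (_ : alpha * _ = `|B| * (K%:R ^+ 2 * alpha) + K%:R ^+ 2 * alpha)%R; last by ring.
by rewrite lerDl ltW.
Unshelve. all: by end_near. Qed.

End conditional_variance.

(** * The critical correlation *)

Lemma total_noise_factor_ge0 (R : realType) (K : nat) (sigma rho : R) : (2 <= K)%N ->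
  - (1 / (K%:R - 1)) <= rho -> 0 <= total_noise_factor K sigma rho.
Proof.
move=> K2 rho1; have K1 : 0 < K%:R - 1 :> R by rewrite subr_gt0 ltr1n.
apply: mulr_ge0; last exact: sqr_ge0.
apply: mulr_ge0 => //; move: rho1; rewrite -mulNr ler_pdivrMr// mulrC; lra.
Qed.

Lemma total_noise_factor_eq0 (R : realType) (K : nat) (sigma rho : R) : (2 <= K)%N ->
  sigma != 0 -> total_noise_factor K sigma rho = 0 <-> rho = - (1 / (K%:R - 1)).
Proof.
move=> K2 s0; have K1 : 0 < K%:R - 1 :> R by rewrite subr_gt0 ltr1n.
have K0 : K%:R != 0 :> R by rewrite pnatr_eq0 -lt0n ltnW.
split=> [/eqP|->].
  rewrite /total_noise_factor !mulf_eq0 (negbTE K0) (negbTE s0) !orbF /= => /eqP h.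
  by apply: (mulfI (lt0r_neq0 K1)); rewrite mulrN mul1r divff ?lt0r_neq0//; lra.
by rewrite /total_noise_factor mulrN mul1r divff ?lt0r_neq0// subrr mulr0 mul0r.
Qed.

Theorem theorem5p2 (R : realType) (n K m : nat) (mu : 'rV[R]_n) (sigma rho : R)
    (d : measure_display) (T : measurableType d) (P : probability T R)
    (Y : {RV P >-> 'rV[R]_n}) (w : 'I_K -> {RV P >-> 'rV[R]_n})
    (f0 : 'rV[R]_n -> 'rV[R]_n) (a : 'I_m -> 'rV[R]_n -> 'rV[R]_n)
    (h : 'I_m -> 'rV[R]_n -> R) :
  (1 <= n)%N -> (2 <= K)%N -> (1 <= m)%N -> 0 < sigma ^+ 2 ->
  - (1 / (K%:R - 1)) <= rho <= 1 ->
  has_law Y (normal_rV mu sigma) ->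
  independent_joint Y w ->
  exchangeable_normal sigma rho w ->
  smooth_moment mu sigma f0 ->
  (forall l, smooth_moment mu sigma (a l)) ->
  (forall l, measurable_fun setT (h l)) ->
  (0 < 'E_P[fun t => (norm2 (f0 (Y t) - Y t) ^+ 2)%R])%E ->
  (exists C : R, \forall alpha \near 0^'+,
     (\int[P]_t cond_var P Y
        (adjusted_CV Y w (piecewise f0 a h) a h alpha) t <= C%:E)%E)
  <-> rho = - (1 / (K%:R - 1)).
Proof.
move=> _ K2 _ sigma2 /andP[rho1 _] lawY indep [_ law_w cov_w] sf0 sa mh.
have sigma0 : sigma != 0 by apply: contraTneq sigma2 => ->; rewrite expr0n ltxx.
have [mf0 _] := sf0.
rewrite unlock (@ge0_expectation_has_law _ _ _ _ _ _ Y (normal_rV mu sigma) lawY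
  (fun y => (norm2 (f0 y - y) ^+ 2)%:E)); last 2 first.
- by meas.
- by move=> y; rewrite lee_fin sqr_ge0.
move=> bias0; have kappa0 := total_noise_factor_ge0 sigma K2 rho1.
rewrite -(total_noise_factor_eq0 rho K2 sigma0); split => [bounded|kappa_eq0].
  apply/eqP; apply: contrapT => /negP kappa_neq0.
  apply: (unbounded_expected_cond_var (ltnW K2) sigma0 lawY indep law_w cov_w sf0 sa mh _ bias0 bounded).
  by rewrite lt0r kappa_neq0.
exact: (bounded_expected_cond_var (ltnW K2) sigma0 lawY indep law_w cov_w sf0 sa mh).
Qed.
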